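(* Let $1\le j\le k-1$ be fixed integers and let $p_0=p_0(k,j):=\frac{1}{\binom{k}{j}-1}\cdot\frac{1}{\binom{n}{k-j}}$. Let $\varepsilon=\varepsilon(n)>0$ satisfy $\varepsilon\to 0$, $\varepsilon^3 n^j\to\infty$ and $\varepsilon^2 n^{1-2\delta}\to\infty$ as $n\to\infty$, for some constant $\delta>0$. (a) If $p=(1-\varepsilon)p_0$, then with high probability all $j$-components of $\mathcal{H}^k(n,p)$ have size at most $O(\varepsilon^{-2}\log n)$. (b) If $p=(1+\varepsilon)p_0$, then with high probability the largest $j$-component of $\mathcal{H}^k(n,p)$ has size $(1\pm o(1))\frac{2\varepsilon}{\binom{k}{j}-1}\binom{n}{j}$, while all other $j$-components have size $o(\varepsilon n^j)$.
   Context: $\mathcal{H}^k(n,p)$ is the random $k$-uniform hypergraph on vertex set $[n]$ in which each $k$-element subset of $[n]$ is an edge independently with probability $p$. Two $j$-element vertex sets $J_1,J_2$ are $j$-connected if there is a sequence of edges $E_1,\dots,E_\ell$ with $J_1\subseteq E_1$, $J_2\subseteq E_\ell$ and $|E_i\cap E_{i+1}|\ge j$ for all $i$; this is an equivalence relation on $j$-sets, and its equivalence classes are the $j$-components. The size of a $j$-component is its number of $j$-sets. ''With high probability'' means with probability tending to $1$ as $n\to\infty$; asymptotics are as $n\to\infty$. *)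

(* Defs.v *)
From HB Require Import structures.
From mathcomp Require Import all_boot all_order all_algebra.
From mathcomp Require Import all_classical all_reals all_analysis.
Set Implicit Arguments. Unset Strict Implicit. Unset Printing Implicit Defensive.
Import Order.TTheory GRing.Theory Num.Theory.
Import numFieldNormedType.Exports.
Local Open Scope classical_set_scope.
Local Open Scope ring_scope.

Definition ksets (n k : nat) : {set {set 'I_n}} := [set E : {set 'I_n} | #|E| == k].

(* Probability that the random k-uniform hypergraph H^k(n,p) satisfies the
   event A: a hypergraph is its edge set H, a set of k-subsets of 'I_n; each
   k-set is an edge independently with probability p, so
   P(H) = p^|H| (1-p)^(C(n,k) - |H|). *)
Definition hprob {R : realType} (n k : nat) (p : R)
    (A : {set {set 'I_n}} -> bool) : R :=
  \sum_(H : {set {set 'I_n}} | (H \subset ksets n k) && A H)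
     p ^+ #|H| * (1 - p) ^+ ('C(n, k) - #|H|).

Definition jadj (n j : nat) (H : {set {set 'I_n}}) : rel {set 'I_n} :=
  fun E F => [&& E \in H, F \in H & j <= #|E :&: F|]%N.

(* J1, J2 are j-connected: J1 = J2 (reflexivity, j-components are the
   classes of an equivalence relation on j-sets), or there are edges
   E1 ⊇ J1, El ⊇ J2 of H joined by a sequence of edges with consecutive
   intersections of size >= j. *)
Definition jconn (n j : nat) (H : {set {set 'I_n}}) (J1 J2 : {set 'I_n}) : bool :=
  (J1 == J2) ||
  [exists E1 : {set 'I_n}, exists E2 : {set 'I_n},
     [&& E1 \in H, E2 \in H, J1 \subset E1, J2 \subset E2 &
         connect (jadj j H) E1 E2]].

Definition jcomp (n j : nat) (H : {set {set 'I_n}}) (J : {set 'I_n})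
  : {set {set 'I_n}} :=
  [set J' : {set 'I_n} | (#|J'| == j) && jconn j H J J'].

Definition whp {R : realType} (P : nat -> R) : Prop := P @ \oo --> (1 : R).

Definition p0 {R : realType} (k j n : nat) : R :=
  ('C(k, j)%:R - 1)^-1 * ('C(n, (k - j)%N)%:R)^-1.

Arguments hprob {R} n k p A.
Arguments jcomp {n} j H J.
Arguments jconn {n} j H J1 J2.
Arguments jadj {n} j H.
Arguments p0 {R} k j n.

(* Main.v *)
(* Edges are revealed one at a time, always an edge touching the set [F] of [j]-sets found so far,
   and every probabilistic estimate comes from a function of the unqueried edges and of [F] whose
   mean cannot increase (or decrease) under one more query.  With m = C(k,j) - 1, the function
   exp(- zeta |F| - mu |active edges|) gives the exponential tail of part (a), and in part (b) the
   probability, at most (1 + o(1)) theta with theta = 2 eps / m, that a component is larger than a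
   constant times eps^-2.  For the matching lower bound, the exploration must not slow down because
   found [j]-sets share potential edges; exponential potentials, in which a [j]-set weighs more the
   closer it is to a given one, show that no [j]-set shares too many potential edges with [F] while
   |F| is at most a small multiple of eps C(n,j).  Such weights also show that two explorations
   which reach that size have so many potential edges in common that sprinkling a few edges joins
   them.  The first two moments of the number of [j]-sets in large components then give a single
   giant, by Markov's inequality. *)
Require Import Defs.
From HB Require Import structures.
From mathcomp Require Import all_boot all_order all_algebra.
From mathcomp Require Import all_classical all_reals all_analysis.
From mathcomp Require Import ring lra zify.
From mathcomp Require Import fintype finset.
Set Implicit Arguments. Unset Strict Implicit. Unset Printing Implicit Defensive.
Import Order.TTheory GRing.Theory Num.Theory.
Import numFieldNormedType.Exports.
Local Open Scope ring_scope.

(** * Means over a random subset of a finite set *)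

Section RandomSubset.
Variables (R : realType) (E : finType).
Implicit Types (p : R) (U H : {set E}) (f g : {set E} -> R).

(** The obstacle is that the exploration is supercritical only by a factor [1 + e] with [e] tending
    to 0, so whatever slows it down may cost a relative [O(g * e)] at most, where [g] is a small
    constant fixed before [n] grows. Found [j]-sets overlap, and the edges that a new one shares
    with the earlier ones are few on average but might be many locally; a union bound over all
    [j]-sets needs exponentially small tails, hence exponential potentials. The value [theta] comes
    from [exp (- mu) = 1 - p + p * exp (- m * D * mu)]: if [p * m * D = 1 + e], where [D] is the
    degree, the positive root has [D * mu] close to [2 * e / m]. No filtration or stopping time
    appears: a bound on a mean is an induction on the set of unqueried edges. For the sprinkling,
    the hypergraph is a union of two independent ones, the sparser of which keeps the surplus
    [(1 - g) * e], so that its survival probability is still [(1 - O(g)) * theta]. At the end the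
    moments are combined linearly so that their leading terms cancel and a mean of order [g] is
    left. *)

Definition Er p U f : R :=
  \sum_(H : {set E} | H \subset U) p ^+ #|H| * (1 - p) ^+ (#|U| - #|H|) * f H.

Lemma eq_Er p U f g : (forall H, H \subset U -> f H = g H) -> Er p U f = Er p U g.
Proof. by move=> fg; apply: eq_bigr => H HU; rewrite fg. Qed.

Lemma le_Er p U f g : 0 <= p <= 1 ->
  (forall H, H \subset U -> f H <= g H) -> Er p U f <= Er p U g.
Proof.
move=> /andP[p0 p1] fg; apply: ler_sum => H HU; apply: ler_wpM2l; last exact: fg.
by rewrite mulr_ge0 ?exprn_ge0 ?subr_ge0.
Qed.

Lemma ErD p U f g : Er p U (fun H => f H + g H) = Er p U f + Er p U g.
Proof. by rewrite /Er -big_split; apply: eq_bigr => H _; rewrite mulrDr. Qed.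

Lemma ErZ p U a f : Er p U (fun H => a * f H) = a * Er p U f.
Proof. by rewrite /Er mulr_sumr; apply: eq_bigr => H _; rewrite mulrCA. Qed.

Lemma Er_sum (I : finType) (P : pred I) p U (f : I -> {set E} -> R) :
  Er p U (fun H => \sum_(i | P i) f i H) = \sum_(i | P i) Er p U (f i).
Proof.
by rewrite /Er exchange_big; apply: eq_bigr => H _; rewrite mulr_sumr.
Qed.

Lemma Er_set0 p f : Er p set0 f = f set0.
Proof.
rewrite /Er (big_pred1 set0) ?cards0 ?expr0 ?mul1r// => H.
by rewrite subset0.
Qed.

Lemma Er_step p U K f : K \in U ->
  Er p U f = (1 - p) * Er p (U :\ K) f + p * Er p (U :\ K) (fun H => f (K |: H)).
Proof.
move=> KU; rewrite {1}/Er (bigID (fun H : {set E} => K \in H)) /= addrC.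
have cU : #|U| = #|U :\ K|.+1 by rewrite (cardsD1 K) KU.
congr (_ + _).
  rewrite /Er mulr_sumr; apply: eq_big => H; first by rewrite subsetD1.
  move=> /andP[HU KH]; have : (#|H| <= #|U :\ K|)%N.
    by apply: subset_leq_card; rewrite subsetD1 HU.
  by move=> h; rewrite cU subSn// exprS; ring.
rewrite /Er mulr_sumr (reindex_onto (fun H => K |: H) (fun H => H :\ K)) /=; last first.
  by move=> H /andP[_ KH]; rewrite setD1K.
apply: eq_big => H.
  rewrite subUset sub1set KU /= setU11 andbT subsetD1.
  case: (H \subset U) => //=; apply/eqP/idP => [<-|KH]; first by rewrite setD11.
  by rewrite setU1K.
move=> /andP[_ /eqP HK]; have KH : K \notin H by rewrite -HK setD11.
by rewrite cardsU1 KH cU add1n subSS exprS; ring.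
Qed.

Lemma set_ind (P : {set E} -> Prop) :
  (forall U, (forall K, K \in U -> P (U :\ K)) -> P U) -> forall U, P U.
Proof.
move=> IH U; have [c] := ubnP #|U|; elim: c U => // c IHc U ltU.
by apply: IH => K KU; apply: IHc; move: ltU; rewrite (cardsD1 K) KU.
Qed.

Lemma Er_cst p U c : Er p U (fun=> c) = c.
Proof.
elim/set_ind: U => U IH; have [->|[K KU]] := set_0Vmem U; first exact: Er_set0.
by rewrite (Er_step _ _ KU) IH//; ring.
Qed.

Lemma Er_sub p U U' f : U' \subset U ->
  (forall K H, K \in U :\: U' -> f (K |: H) = f H) -> Er p U f = Er p U' f.
Proof.
elim/set_ind: U => U IH U'U fK.
have [/eqP|[K KU]] := set_0Vmem (U :\: U').
  by rewrite setD_eq0 => UU'; congr Er; apply/eqP; rewrite eqEsubset UU'.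
have [KU1 KU2] := setDP KU; have U'D : U' \subset U :\ K by rewrite subsetD1 U'U.
have e : Er p (U :\ K) f = Er p U' f.
  apply: IH => // L H; rewrite !inE => /and3P[LU' _ LU].
  by apply: fK; rewrite !inE LU' LU.
rewrite (Er_step _ _ KU1) (@eq_Er _ _ (fun H => f (K |: H)) f) => [|H _]; last exact: fK.
by rewrite e; ring.
Qed.

(** Two-round exposure: an element is missing from the union exactly when both rounds miss it. This
    is what allows sprinkling. *)
Lemma Er_union p p1 p2 U f : 1 - p = (1 - p1) * (1 - p2) ->
  Er p U f = Er p1 U (fun H1 => Er p2 U (fun H2 => f (H1 :|: H2))).
Proof.
move=> pE; elim/set_ind: U f => U IH f.
have [->|[K KU]] := set_0Vmem U; first by rewrite !Er_set0 setU0.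
have e (g : {set E} -> R) : Er p1 (U :\ K) (fun H1 => Er p2 U (fun H2 => g (H1 :|: H2)))
   = (1 - p2) * Er p (U :\ K) g + p2 * Er p (U :\ K) (fun H => g (K |: H)).
  rewrite !IH// -!ErZ -ErD; apply: eq_Er => H1 _; rewrite (Er_step _ _ KU).
  by congr (_ + _ * _); apply: eq_Er => H2 _; rewrite setUCA.
rewrite (Er_step _ _ KU) [RHS](Er_step _ _ KU) e.
rewrite (@eq_Er p1 _ _ (fun H1 => Er p2 U (fun H2 => f (K |: (H1 :|: H2))))); last first.
  by move=> H1 _; apply: eq_Er => H2 _; rewrite setUA.
rewrite (e (fun H => f (K |: H))) (@eq_Er _ _ (fun H => f (K |: (K |: H))) (fun H => f (K |: H))).
  by rewrite (_ : p = 1 - (1 - p1) * (1 - p2)); [ring|rewrite -pE; ring].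
by move=> H _; rewrite setUA setUid.
Qed.

End RandomSubset.

(** * Components of a hypergraph as closures of vertex sets *)

Section Closure.
Variables (V E : finType) (inc : E -> {set V}).
Implicit Types (K : E) (F A : {set V}) (H U : {set E}) (u v : V).

Definition touch K F := inc K :&: F != set0.

Definition hadj H : rel V := fun u v => [exists K in H, (u \in inc K) && (v \in inc K)].

(** The union of the components of [H] that meet [F]. In the application the vertices are [j]-sets
    and [inc K] consists of the [j]-subsets of the edge [K]. *)
Definition cl H F : {set V} := [set v | [exists u in F, connect (hadj H) u v]].

Lemma touchP K F : reflect (exists2 u, u \in inc K & u \in F) (touch K F).
Proof.
apply: (iffP (set0Pn _)) => [[u /setIP[uK uF]]|[u uK uF]]; exists u => //.
by rewrite inE uK.
Qed.

Lemma touchS K F A : F \subset A -> touch K F -> touch K A.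
Proof. by move=> /subsetP FA /touchP[u uK /FA uA]; apply/touchP; exists u. Qed.

Lemma touch1 K u : touch K [set u] = (u \in inc K).
Proof.
by apply/touchP/idP => [[v vK /set1P <-]//|uK]; exists u; rewrite ?set11.
Qed.

Lemma touchU K F A : touch K (F :|: A) = touch K F || touch K A.
Proof. by rewrite /touch setIUr setU_eq0 negb_and. Qed.

Definition hclosed H A := forall K, K \in H -> touch K A -> inc K \subset A.

Lemma clP H F v : reflect (exists2 u, u \in F & connect (hadj H) u v) (v \in cl H F).
Proof.
rewrite inE; apply: (iffP existsP) => [[u /andP[]]|[u uF c]]; first by exists u.
by exists u; rewrite uF.
Qed.

Lemma sub_cl H F : F \subset cl H F.
Proof. by apply/subsetP => v vF; apply/clP; exists v. Qed.

Lemma cl_closed H F : hclosed H (cl H F).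
Proof.
move=> K KH /touchP[u uK /clP[w wF wu]]; apply/subsetP => v vK; apply/clP.
exists w => //; apply: connect_trans wu (connect1 _).
by apply/existsP; exists K; rewrite KH uK.
Qed.

Lemma cl_min H F A : F \subset A -> hclosed H A -> cl H F \subset A.
Proof.
move=> /subsetP FA cA; apply/subsetP => v /clP[u /FA uA /connectP[s]].
elim: s u uA => [|w s IH] u uA /=; first by move=> _ ->.
move=> /andP[/existsP[K /and3P[KH uK wK]] sp]; apply: IH => //.
by apply: (subsetP (cA K KH _)) wK; apply/touchP; exists u.
Qed.

Lemma hclosedS H H' A : H \subset H' -> hclosed H' A -> hclosed H A.
Proof. by move=> /subsetP HH' cA K /HH'; apply: cA. Qed.

Lemma clS H H' F F' : H \subset H' -> F \subset F' -> cl H F \subset cl H' F'.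
Proof.
move=> HH' FF'; apply: cl_min; first exact: subset_trans (sub_cl _ _).
exact: hclosedS HH' (@cl_closed _ _).
Qed.

Lemma cl_dead H F : (forall K, K \in H -> ~~ touch K F) -> cl H F = F.
Proof.
move=> d; apply/eqP; rewrite eqEsubset sub_cl andbT; apply: cl_min => // K KH t.
by move: (d K KH); rewrite t.
Qed.

(** After a positive answer the edge can be forgotten once its vertices are counted as found. This
    makes the recursion along the queries exact. *)
Lemma cl_add H K F : touch K F -> cl (K |: H) F = cl H (F :|: inc K).
Proof.
move=> t; apply/eqP; rewrite eqEsubset; apply/andP; split; apply: cl_min.
- exact: subset_trans (subsetUl _ _) (sub_cl _ _).
- move=> L /setU1P[->|LH]; last exact: cl_closed.
  by move=> _; apply: subset_trans (subsetUr _ _) (sub_cl _ _).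
- rewrite subUset sub_cl /=; apply: cl_closed; first exact: setU11.
  exact: touchS (sub_cl _ _) t.
- exact: hclosedS (subsetUr _ _) (@cl_closed _ _).
Qed.

Lemma connect_hadjC H : connect_sym (hadj H).
Proof.
apply: sym_connect_sym => u v; apply: eq_existsb => K.
by rewrite [(u \in _) && _]andbC.
Qed.

Lemma cl1P H u v : (v \in cl H [set u]) = connect (hadj H) u v.
Proof. by apply/clP/idP => [[w /set1P -> //]|c]; exists u; rewrite ?set11. Qed.

Lemma cl1_id H u : u \in cl H [set u].
Proof. by rewrite cl1P. Qed.

Lemma cl1_eq H u v : v \in cl H [set u] -> cl H [set v] = cl H [set u].
Proof.
rewrite cl1P => c; apply/setP => w; rewrite !cl1P.
by apply/esym; apply: (same_connect (@connect_hadjC H) c).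
Qed.

Lemma clE H F v : (v \in cl H F) = (cl H [set v] :&: F != set0).
Proof.
apply/clP/set0Pn => [[u uF c]|[u /setIP[]]].
  by exists u; rewrite inE uF cl1P connect_hadjC c.
by rewrite cl1P connect_hadjC; exists u.
Qed.

End Closure.

(** * Taylor bounds for the exponential *)

Section ExpBounds.
Variable R : realType.
Implicit Types x : R.

Lemma le_of_derive_ge0 (f df : R -> R) :
  (forall x, is_derive x 1 f (df x)) -> (forall x, 0 <= x -> 0 <= df x) ->
  forall x, 0 <= x -> f 0 <= f x.
Proof.
move=> fd df0 x x0; rewrite -subr_ge0.
have [|c cx ->] := @MVT_segment R f df 0 x x0 (fun y _ => fd y).
  apply: derivable_within_continuous => y _; exact: ex_derive.
by rewrite mulr_ge0 ?subr0// df0// (itvP cx).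
Qed.

Lemma expRN_le x : 0 <= x -> expR (- x) <= 1 - x + x ^+ 2 / 2.
Proof.
move=> x0; rewrite -subr_ge0.
pose f (y : R) := 1 - y + y ^+ 2 / 2 - expR (- y).
have <- : f 0 = 0 by rewrite /f oppr0 expR0; lra.
apply: (@le_of_derive_ge0 f (fun y => - 1 + y + expR (- y))) => // y.
  by apply: is_derive_eq; rewrite /GRing.scale /=; field.
by move=> y0; have := @expR_ge1Dx R (- y); lra.
Qed.

Lemma expRN_ge x : 0 <= x -> 1 - x + x ^+ 2 / 2 - x ^+ 3 / 6 <= expR (- x).
Proof.
move=> x0; rewrite -subr_ge0.
pose f (y : R) := expR (- y) - (1 - y + y ^+ 2 / 2 - y ^+ 3 / 6).
have <- : f 0 = 0 by rewrite /f oppr0 expR0; lra.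
apply: (@le_of_derive_ge0 f (fun y => 1 - y + y ^+ 2 / 2 - expR (- y))) => // y.
  by apply: is_derive_eq; rewrite /GRing.scale /=; field.
by move=> y0; have := expRN_le y0; lra.
Qed.

Lemma expR_le2 x : x <= 2^-1 -> expR x <= 1 + x + 2 * x ^+ 2.
Proof.
move=> x2; have h := @expR_ge1Dx R (- x).
have px : 0 < 1 - x by lra.
rewrite -[expR x]invrK -expRN.
apply: (@le_trans _ _ (1 - x)^-1); first by rewrite lef_pV2 ?posrE ?expR_gt0.
rewrite -[leLHS]mul1r ler_pdivrMr//.
have -> : (1 + x + 2 * x ^+ 2) * (1 - x) = 1 + x ^+ 2 * (1 - 2 * x) by ring.
by rewrite lerDl mulr_ge0 ?sqr_ge0//; lra.
Qed.

End ExpBounds.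

(** Here an edge with [m.+1] vertices has [f] found ones before a step and [x] newly found ones.
    Without overlaps each new vertex would bring [m] unfound neighbours through the edge; the
    shortfall is charged to the [x * (f + x).-1] pairs of a new vertex and another found vertex of
    the edge. A queried edge brings nothing, and [0 < f] because it touches the found set. *)
Lemma loss_queried (m f x : nat) : (0 < f)%N -> (m * x <= m.+1 * (x * (f + x).-1))%N.
Proof. by case: x => [|x] f0; [rewrite muln0|nia]. Qed.

Lemma loss_unqueried (m f x : nat) : (f + x <= m.+1)%N ->
  ((0 < f) * (m.+1 - f) + m * x <=
   (0 < f + x) * (m.+1 - (f + x)) + m.+1 * (x * (f + x).-1))%N.
Proof.
case: x => [|[|x]]; first by rewrite !muln0 !addn0.
  by rewrite addn1 /=; case: f => [|f] /=; nia.
have := @loss_queried m f x.+2.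
case: f => [|f]; first by rewrite add0n /= => _ _; nia.
by move=> /(_ isT); rewrite /= => h l; nia.
Qed.

(** * Exploration of a uniform hypergraph, one edge at a time *)

Section Exploration.
Variables (R : realType) (V E : finType) (inc : E -> {set V}).
Variables (U0 : {set E}) (V0 : {set V}) (m D : nat) (p : R).
Hypotheses (p01 : 0 <= p <= 1) (inc_card : forall K, K \in U0 -> #|inc K| = m.+1)
  (inc_sub : forall K, K \in U0 -> inc K \subset V0)
  (deg_le : forall v, (#|[set K in U0 | v \in inc K]| <= D)%N).
Implicit Types (K : E) (F : {set V}) (H U W : {set E}) (u v : V)
  (Phi : {set E} -> {set V} -> R).

Local Notation touch := (touch inc).
Local Notation cl := (cl inc).

Definition active U F := [set K in U | touch K F].

(* [U] is the set of unqueried edges and [F] the set of vertices found so far; the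
   edges of [W] outside [U] have been queried. *)
Definition state W U F :=
  [/\ U \subset U0, F \subset V0 & forall K, K \in W :\: U -> touch K F].

Definition stp Phi U F K := (1 - p) * Phi (U :\ K) F + p * Phi (U :\ K) (F :|: inc K).

Lemma activeP U F K : reflect (K \in U /\ touch K F) (K \in active U F).
Proof. by rewrite inE; apply: andP. Qed.

Lemma state_closed W U F K : state W U F -> K \in active U F -> state W (U :\ K) F.
Proof.
move=> [UU FV QF] /activeP[KU tK]; split => //.
  exact: subset_trans (subD1set _ _) UU.
move=> L; rewrite !inE negb_and negbK => /andP[/orP[/eqP -> //|LU] LU0].
by apply: QF; rewrite !inE LU.
Qed.

Lemma state_open W U F K : state W U F -> K \in active U F -> state W (U :\ K) (F :|: inc K).
Proof.
move=> s Ka; have [UU FV QF] := state_closed s Ka; split => //.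
  have /activeP[KU _] := Ka; case: s => /subsetP UU0 _ _.
  by rewrite subUset FV inc_sub// UU0.
by move=> L /QF; apply: touchS; apply: subsetUl.
Qed.

Lemma state_init v : v \in V0 -> state U0 U0 [set v].
Proof.
by move=> vV; split => //; [rewrite sub1set|move=> K; rewrite setDv inE].
Qed.

(** Optional stopping by induction on the unqueried edges. In each state either the bound is already
    known, which is where the exploration stops, or some active edge can be queried without raising
    the mean of [Phi]. The invariant [P], usually a bound on [#|F|], has to be checked only after a
    positive answer, since a negative one leaves [F] unchanged. *)
Lemma explore_le W (P : {set V} -> Prop) (A Phi : {set E} -> {set V} -> R) :
  (forall U F K, state W U F -> K \in active U F -> A U F = stp A U F K) ->
  (forall U F, state W U F -> P F ->
     A U F <= Phi U F \/
     exists2 K, K \in active U F & stp Phi U F K <= Phi U F /\ P (F :|: inc K)) ->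
  forall U F, state W U F -> P F -> A U F <= Phi U F.
Proof.
move=> HA HPhi; elim/set_ind => U IH F s PF.
have [//|[K Ka [hK PK]]] := HPhi _ _ s PF; have /activeP[KU _] := Ka.
apply: le_trans hK; rewrite (HA _ _ _ s Ka) /stp.
have /andP[p0 p1] := p01.
apply: lerD; apply: ler_wpM2l; rewrite ?subr_ge0//; apply: IH => //.
  exact: state_closed.
exact: state_open.
Qed.

Lemma Er_explore_le W (P : {set V} -> Prop) (X : {set E} -> {set V} -> R) Phi :
  (forall H F K, touch K F -> X (K |: H) F = X H (F :|: inc K)) ->
  (forall U F, state W U F -> P F ->
     Er p U (X^~ F) <= Phi U F \/
     exists2 K, K \in active U F & stp Phi U F K <= Phi U F /\ P (F :|: inc K)) ->
  forall U F, state W U F -> P F -> Er p U (X^~ F) <= Phi U F.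
Proof.
move=> HX; apply: explore_le => U F K s /activeP[KU tK].
rewrite (Er_step _ _ KU) /stp; congr (_ + _ * _).
by apply: eq_Er => H _; rewrite HX.
Qed.

Lemma Er_le_cst U (X : {set E} -> R) c :
  (forall H, H \subset U -> X H <= c) -> Er p U X <= c.
Proof. by move=> Xc; rewrite -[leRHS](Er_cst p U); apply: le_Er. Qed.

Lemma active_nil U F : active U F = set0 -> forall H, H \subset U -> cl H F = F.
Proof.
move=> a0 H /subsetP HU; apply: cl_dead => K /HU KU.
by apply/negP => tK; have : K \in active U F by [apply/activeP]; rewrite a0 inE.
Qed.

Lemma card_new W U F K : state W U F -> K \in active U F -> (#|inc K :\: F| <= m)%N.
Proof.
move=> [/subsetP UU _ _] /activeP[KU /touchP[u uK uF]].
have := inc_card (UU _ KU); rewrite (cardsD1 u) uK add1n => -[<-].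
apply: subset_leq_card; apply/subsetP => v; rewrite !inE => /andP[vF ->].
by rewrite andbT; apply: contraNneq vF => ->.
Qed.

Lemma card_open F K : #|F :|: inc K| = (#|F| + #|inc K :\: F|)%N.
Proof.
have := cardsUI F (inc K); have := cardsID F (inc K).
by rewrite [inc K :&: F]setIC; lia.
Qed.

Lemma card_bigcup_le (I T : finType) (A : {set I}) (B : I -> {set T}) :
  (#|\bigcup_(i in A) B i| <= \sum_(i in A) #|B i|)%N.
Proof.
elim/big_rec2: _ => [|i c C _ IH]; first by rewrite cards0.
apply: leq_trans (leq_of_leqif (leq_card_setU _ _)) _.
by rewrite leq_add2l.
Qed.

Lemma card_active_closed U F K : K \in active U F ->
  #|active U F| = #|active (U :\ K) F|.+1.
Proof.
move=> Ka; rewrite (cardsD1 K) Ka; congr _.+1; apply: eq_card => L.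
by rewrite !inE andbA.
Qed.

Lemma card_active_open U F K : U \subset U0 ->
  (#|active U (F :|: inc K)| <= #|active U F| + #|inc K :\: F| * D)%N.
Proof.
move=> /subsetP UU.
apply: (@leq_trans #|active U F :|: \bigcup_(u in inc K :\: F) [set L in U0 | u \in inc L]|).
  apply: subset_leq_card; apply/subsetP => L /activeP[LU].
  have [LF _|LF] := boolP (touch L F); first by rewrite inE; apply/orP; left; apply/activeP.
  rewrite touchU (negbTE LF) /= => /touchP[u uL uK].
  rewrite inE; apply/orP; right; apply/bigcupP; exists u; last by rewrite inE uL UU.
  rewrite inE uK andbT; apply: contraNN LF => uF.
  by apply/touchP; exists u.
apply: leq_trans (leq_of_leqif (leq_card_setU _ _)) _; rewrite leq_add2l.
apply: leq_trans (card_bigcup_le _ _) _; rewrite -sum_nat_const.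
by apply: leq_sum => u _; apply: deg_le.
Qed.

Lemma card_active_open1 W U F K : state W U F -> K \in active U F ->
  (#|active (U :\ K) (F :|: inc K)| <= #|active (U :\ K) F| + m * D)%N.
Proof.
move=> s Ka; have [UU _ _] := state_closed s Ka.
apply: leq_trans (card_active_open _ _ UU) _.
by rewrite leq_add2l leq_mul2r (card_new s Ka) orbT.
Qed.

Lemma card_queried U F : state U0 U F -> (#|U0| - #|U| <= D * #|F|)%N.
Proof.
move=> [UU _ QF]; rewrite -(cardsDS UU).
apply: (@leq_trans #|\bigcup_(u in F) [set L in U0 | u \in inc L]|).
  apply: subset_leq_card; apply/subsetP => L LU.
  have /touchP[u uL uF] := QF _ LU; apply/bigcupP; exists u => //.
  by move: LU; rewrite !inE uL => /andP[_ ->].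
apply: leq_trans (card_bigcup_le _ _) _; rewrite mulnC -sum_nat_const.
by apply: leq_sum => u _; apply: deg_le.
Qed.

(** * Laplace transform of the component size, and upper bounds on moments *)

Section GeneratingFunction.
Variables zeta mu : R.
Hypotheses (zeta0 : 0 <= zeta) (mu0 : 0 <= mu).

(* The mean of [gfun] after one more query can be compared with [gfun] itself when [mu] solves
   the equation of the branching process approximating the exploration. *)
Definition gfun U F : R := expR (- (zeta * #|F|%:R + mu * #|active U F|%:R)).

Lemma gfun_gt0 U F : 0 < gfun U F. Proof. exact: expR_gt0. Qed.

Lemma gfun_le U F : gfun U F <= expR (- (zeta * #|F|%:R)).
Proof. by rewrite ler_expR lerN2 lerDl mulr_ge0. Qed.

(** A positive answer finds at most [m] vertices, each bringing at most [D] active edges. The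
    hypothesis on [mu] is the balance in this worst case, in which the exploration is a branching
    process; fewer new vertices or edges only increase [gfun]. *)
Lemma stp_gfun W U F K :
  expR (- mu) <= 1 - p + p * expR (- (m%:R * (zeta + mu * D%:R))) ->
  state W U F -> K \in active U F -> gfun U F <= stp gfun U F K.
Proof.
move=> Hmu s Ka; have /andP[p0 p1] := p01.
have := card_active_closed Ka; have := card_active_open1 s Ka.
have := card_open F K; have := card_new s Ka; rewrite /stp /gfun.
set a := #|active (U :\ K) F|; set b := #|active _ (_ :|: _)|; set w := #|_ :\: _|.
move=> wm -> bE ->.
set z := expR (- (zeta * #|F|%:R + mu * a%:R)).
have -> : expR (- (zeta * #|F|%:R + mu * a.+1%:R)) = z * expR (- mu).
  by rewrite -expRD; congr expR; rewrite -natr1; ring.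
apply: (@le_trans _ _ (z * (1 - p + p * expR (- (m%:R * (zeta + mu * D%:R)))))).
  by rewrite ler_wpM2l// expR_ge0.
rewrite mulrDr [z * (1 - p)]mulrC lerD2l mulrCA ler_wpM2l// -expRD ler_expR.
have : b%:R <= a%:R + m%:R * D%:R :> R by rewrite -natrM -natrD ler_nat.
have : w%:R <= m%:R :> R by rewrite ler_nat.
rewrite natrD; set B := b%:R; set A := a%:R; set w' := w%:R; set M := m%:R.
move=> h1 h2; have := ler_wpM2l zeta0 h1; have := ler_wpM2l mu0 h2.
by lra.
Qed.

(** The reciprocal controls an exponential moment of the component size. Its condition on [mu] can
    be met with positive [zeta] when the branching process is subcritical. *)
Lemma stp_inv_gfun W U F K :
  1 - p + p * expR (m%:R * (zeta + mu * D%:R)) <= expR mu ->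
  state W U F -> K \in active U F -> stp (fun U F => (gfun U F)^-1) U F K <= (gfun U F)^-1.
Proof.
move=> Hmu s Ka; have /andP[p0 p1] := p01.
have := card_active_closed Ka; have := card_active_open1 s Ka.
have := card_open F K; have := card_new s Ka; rewrite /stp /gfun -!expRN !opprK.
set a := #|active (U :\ K) F|; set b := #|active _ (_ :|: _)|; set w := #|_ :\: _|.
move=> wm -> bE ->.
set z := expR (zeta * #|F|%:R + mu * a%:R).
have -> : expR (zeta * #|F|%:R + mu * a.+1%:R) = z * expR mu.
  by rewrite -expRD; congr expR; rewrite -natr1; ring.
apply: (@le_trans _ _ (z * (1 - p + p * expR (m%:R * (zeta + mu * D%:R))))); last first.
  by rewrite ler_wpM2l// expR_ge0.
rewrite mulrDr [z * (1 - p)]mulrC lerD2l mulrCA ler_wpM2l// -expRD ler_expR.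
have : b%:R <= a%:R + m%:R * D%:R :> R by rewrite -natrM -natrD ler_nat.
have : w%:R <= m%:R :> R by rewrite ler_nat.
rewrite natrD; set B := b%:R; set A := a%:R; set w' := w%:R; set M := m%:R.
move=> h1 h2; have := ler_wpM2l zeta0 h1; have := ler_wpM2l mu0 h2.
by lra.
Qed.

Lemma Er_gfun W U F :
  expR (- mu) <= 1 - p + p * expR (- (m%:R * (zeta + mu * D%:R))) ->
  state W U F -> gfun U F <= Er p U (fun H => expR (- (zeta * #|cl H F|%:R))).
Proof.
move=> Hmu s; rewrite -lerN2 -mulN1r -ErZ.
pose X (H : {set E}) F := -1 * expR (- (zeta * #|cl H F|%:R)).
have HX H F' K : touch K F' -> X (K |: H) F' = X H (F' :|: inc K).
  by move=> tK; rewrite /X cl_add.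
apply: (Er_explore_le (P := fun=> True) HX (Phi := fun U F => - gfun U F) _ s) => // U' F' s' _.
have [/active_nil a0|[K Ka]] := set_0Vmem (active U' F').
  by left; apply: Er_le_cst => H /a0; rewrite /X => ->; rewrite mulN1r lerN2 gfun_le.
right; exists K => //; split=> //; rewrite /stp !mulrN -opprD lerN2; exact: stp_gfun s' Ka.
Qed.

Lemma Er_inv_gfun W U F :
  1 - p + p * expR (m%:R * (zeta + mu * D%:R)) <= expR mu ->
  state W U F -> Er p U (fun H => expR (zeta * #|cl H F|%:R)) <= (gfun U F)^-1.
Proof.
move=> Hmu s.
pose X (H : {set E}) F := expR (zeta * #|cl H F|%:R).
have HX H F' K : touch K F' -> X (K |: H) F' = X H (F' :|: inc K).
  by move=> tK; rewrite /X cl_add.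
apply: (Er_explore_le (P := fun=> True) HX (Phi := fun U F => (gfun U F)^-1) _ s) => // U' F' s' _.
have [/active_nil a0|[K Ka]] := set_0Vmem (active U' F').
  left; apply: Er_le_cst => H /a0; rewrite /X => ->.
  by rewrite -[leLHS]invrK lef_pV2 ?posrE ?invr_gt0 ?expR_gt0 ?gfun_gt0// -expRN gfun_le.
right; exists K => //; split=> //; exact: stp_inv_gfun s' Ka.
Qed.

Hypothesis Hmu : expR (- mu) <= 1 - p + p * expR (- (m%:R * (zeta + mu * D%:R))).
Let q := zeta + mu * D%:R.

(** A single vertex has at most [D] active edges. With the later choice of [zeta] and [mu], the
    number [q] is close to the survival probability [theta]. *)
Lemma gfun1 U v : U \subset U0 -> 1 - gfun U [set v] <= q.
Proof.
move=> UU; rewrite lerBlDr -lerBlDl /gfun cards1 mulr1.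
apply: le_trans (expR_ge1Dx _); rewrite lerD2l lerN2 /q lerD2l ler_wpM2l// ler_nat.
apply: leq_trans (deg_le v); apply: subset_leq_card; apply/subsetP => K.
by rewrite !inE touch1 => /andP[/(subsetP UU) -> ->].
Qed.

Lemma Er_one_sub_le W U F : state W U F ->
  Er p U (fun H => 1 - expR (- (zeta * #|cl H F|%:R))) <= 1 - gfun U F.
Proof.
move=> s; rewrite (_ : Er _ _ _ = 1 - Er p U (fun H => expR (- (zeta * #|cl H F|%:R)))).
  by rewrite lerD2l lerN2; apply: Er_gfun s.
by rewrite -[X in X - _](Er_cst p U 1) -mulN1r -ErZ -ErD; apply: eq_Er => H _; rewrite mulN1r.
Qed.

(** From [1 - exp (- s) >= s / (1 + s)]. It turns a bound on the mean of [1 - exp (- zeta * t)] into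
    a bound on the mean of a truncated size. *)
Lemma le_concave (t T : R) : 0 < zeta -> 0 <= t <= T ->
  t <= (1 + zeta * T) / zeta * (1 - expR (- (zeta * t))).
Proof.
move=> z0 /andP[t0 tT]; rewrite expRN.
have h : 1 + zeta * t <= expR (zeta * t) := expR_ge1Dx _.
have zt : 0 <= zeta * t by rewrite mulr_ge0.
have hp : 0 < 1 + zeta * t by lra.
have h2 : (expR (zeta * t))^-1 <= (1 + zeta * t)^-1 by rewrite lef_pV2 ?posrE ?expR_gt0.
apply: (@le_trans _ _ ((1 + zeta * T) / zeta * (1 - (1 + zeta * t)^-1))); last first.
  rewrite ler_wpM2l ?lerD2l ?lerN2// divr_ge0// addr_ge0// mulr_ge0//; exact: le_trans tT.
have -> : 1 - (1 + zeta * t)^-1 = zeta * t / (1 + zeta * t).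
  by field; rewrite gt_eqF.
have -> : (1 + zeta * T) / zeta * (zeta * t / (1 + zeta * t)) = t * ((1 + zeta * T) / (1 + zeta * t)).
  by field; rewrite !gt_eqF.
rewrite ler_peMr// ler_pdivlMr// mul1r lerD2l ler_wpM2l//.
Qed.

Variable M0 : R.
Hypotheses (zeta_gt0 : 0 < zeta) (M0_gt0 : 0 < M0).

Lemma small_term_gt0 : 0 < 1 - expR (- (zeta * M0)).
Proof. by rewrite subr_gt0 expR_lt1 oppr_lt0 mulr_gt0. Qed.

(** Markov's inequality for [1 - exp (- zeta * #|cl H F|)]. *)
Lemma Er_large_le W U F : state W U F ->
  Er p U (fun H => (M0 <= #|cl H F|%:R)%R%:R) <= (1 - gfun U F) / (1 - expR (- (zeta * M0))).
Proof.
move=> s; rewrite ler_pdivlMr ?small_term_gt0// mulrC -ErZ.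
apply: le_trans (Er_one_sub_le s); apply: le_Er => // H _.
have [h|h] := leP M0 #|cl H F|%:R; last by rewrite /= mulr0 subr_ge0 -expR0 ler_expR oppr_le0 mulr_ge0.
by rewrite mulr1 lerD2l lerN2 ler_expR lerN2 ler_wpM2l.
Qed.

Lemma Er_large1_le U v : U \subset U0 -> v \in V0 ->
  Er p U (fun H => (M0 <= #|cl H [set v]|%:R)%R%:R) <= q / (1 - expR (- (zeta * M0))).
Proof.
move=> UU vV; have s : state set0 U [set v].
  by split; rewrite ?sub1set// => K; rewrite set0D inE.
apply: le_trans (Er_large_le s) _; rewrite ler_pM2r ?invr_gt0 ?small_term_gt0//.
exact: gfun1.
Qed.

Lemma Er_small1_le U v : U \subset U0 -> v \in V0 ->
  Er p U (fun H => #|cl H [set v]|%:R * (#|cl H [set v]|%:R < M0)%R%:R)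
    <= (1 + zeta * M0) / zeta * q.
Proof.
move=> UU vV; have s : state set0 U [set v].
  by split; rewrite ?sub1set// => K; rewrite set0D inE.
have c0 : 0 <= (1 + zeta * M0) / zeta.
  by rewrite divr_ge0// addr_ge0// mulr_ge0// ltW.
apply: le_trans (_ : (1 + zeta * M0) / zeta * (1 - gfun U [set v]) <= _); last first.
  by rewrite ler_wpM2l// gfun1.
apply: le_trans (ler_wpM2l c0 (Er_one_sub_le s)); rewrite -ErZ.
apply: le_Er => // H _; have [h|h] := ltP #|cl H [set v]|%:R M0.
  by rewrite mulr1 le_concave// ler0n ltW.
by rewrite /= mulr0 mulr_ge0// subr_ge0 -expR0 ler_expR oppr_le0 mulr_ge0.
Qed.

Lemma cl_sub0 H F : H \subset U0 -> F \subset V0 -> cl H F \subset V0.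
Proof.
move=> /subsetP HU FV; apply: cl_min => // K /HU KU _; exact: inc_sub.
Qed.

(* A vertex [v] of [cl H F] outside [F] either has a large component, or its component in
   the edges not touching [F] is small and is left through an open edge touching [F]. *)
Lemma card_cl_le U F H : U \subset U0 -> F \subset V0 -> H \subset U ->
  (#|cl H F| <= #|F| + \sum_(v in V0) (M0 <= #|cl H [set v]|%:R)%R +
   \sum_(K in active U F) \sum_(u in inc K)
      (K \in H) * (#|cl (H :\: active U F) [set u]| *
        (#|cl (H :\: active U F) [set u]|%:R < M0)%R))%N.
Proof.
move=> UU FV HU; set H' := H :\: active U F.
pose L := [set v in V0 | M0 <= #|cl H [set v]|%:R].
pose B K := if K \in H then \bigcup_(u in inc K)
  (if #|cl H' [set u]|%:R < M0 then cl H' [set u] else set0) else set0.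
have sub : cl H F \subset F :|: L :|: \bigcup_(K in active U F) B K.
  apply/subsetP => v vF.
  have vV : v \in V0.
    by apply: (subsetP (cl_sub0 _ FV)) vF; apply: subset_trans UU.
  rewrite !inE vV /= ; have [//|vF'] := boolP (v \in F); rewrite orFb.
  have [//|small] := leP M0 #|cl H [set v]|%:R; rewrite orFb.
  have [/exists_inP[K KH /andP[aK tK]]|/exists_inPn none] :=
      boolP [exists K in H, (K \in active U F) && touch K (cl H' [set v])].
    apply/bigcupP; exists K => //; rewrite /B KH.
    have /touchP[u uK uv] := tK; apply/bigcupP; exists u => //.
    have e := cl1_eq uv; have -> : #|cl H' [set u]|%:R < M0.
      rewrite e; apply: le_lt_trans small; rewrite ler_nat; apply: subset_leq_card.
      by apply: clS => //; apply: subsetDl.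
    by rewrite e cl1_id.
  have cB : hclosed inc H (cl H' [set v]).
    move=> K KH tK; apply: cl_closed (tK); rewrite inE KH andbT.
    by apply: contraNN (none K KH) => ->; rewrite tK.
  have HB : cl H [set v] \subset cl H' [set v] by apply: cl_min; rewrite ?sub1set ?cl1_id.
  have Bc : cl H' [set v] \subset ~: F.
    apply: cl_min; first by rewrite sub1set inE.
    move=> K; rewrite inE => /andP[Ka KH] _; apply/subsetP => u uK.
    rewrite inE; apply: contraNN Ka => uF; apply/activeP; split.
      exact: (subsetP HU).
    by apply/touchP; exists u.
  move: vF; rewrite clE => /set0Pn[u /setIP[/(subsetP HB)/(subsetP Bc)]].
  by rewrite inE => /negbTE ->.
apply: leq_trans (subset_leq_card sub) _.
apply: leq_trans (leq_of_leqif (leq_card_setU _ _)) _; apply: leq_add.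
  apply: leq_trans (leq_of_leqif (leq_card_setU _ _)) _; rewrite leq_add2l.
  by rewrite -sum1_card big_mkcond [leqRHS]big_mkcond /=; apply: leq_sum => v _; rewrite inE; case: (v \in V0); case: (M0 <= _).
apply: leq_trans (card_bigcup_le _ _) _; apply: leq_sum => K _; rewrite /B.
case: (K \in H); last by rewrite cards0.
apply: leq_trans (card_bigcup_le _ _) _; apply: leq_sum => u _; rewrite mul1n.
by case: ifP; rewrite ?cards0 // muln1.
Qed.

(** In the preceding decomposition the small components avoid all edges touching [F], so they are
    independent of the presence of the active edge [K]; the factor [p] splits off, and [b] bounds
    the mean of what is left. *)
Lemma Er_card_cl_le U F (a b : R) : U \subset U0 -> F \subset V0 ->
  (forall v, v \in V0 -> Er p U (fun H => (M0 <= #|cl H [set v]|%:R)%R%:R) <= a) ->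
  (forall U' v, U' \subset U0 -> v \in V0 ->
     Er p U' (fun H => #|cl H [set v]|%:R * (#|cl H [set v]|%:R < M0)%R%:R) <= b) ->
  Er p U (fun H => #|cl H F|%:R) <=
    #|F|%:R + a * #|V0|%:R + #|active U F|%:R * (p * (m.+1)%:R * b).
Proof.
move=> UU FV ha hb; have /andP[p0 p1] := p01.
pose T := active U F.
apply: (@le_trans _ _ (Er p U (fun H => #|F|%:R + \sum_(v in V0) (M0 <= #|cl H [set v]|%:R)%R%:R
   + \sum_(K in T) \sum_(u in inc K) (K \in H)%:R * (#|cl (H :\: T) [set u]|%:R *
        (#|cl (H :\: T) [set u]|%:R < M0)%R%:R)))).
  apply: le_Er => // H HU; have := card_cl_le UU FV HU.
  rewrite -(ler_nat R) !natrD !natr_sum => /le_trans -> //; rewrite lerD2l.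
  apply: ler_sum => K _; rewrite natr_sum; apply: ler_sum => u _.
  by rewrite !natrM.
rewrite !ErD Er_cst !Er_sum -addrA -addrA lerD2l; apply: lerD.
  by rewrite mulrC mulr_natl -sumr_const; apply: ler_sum => v /ha.
rewrite mulr_natl -sumr_const; apply: ler_sum => K KT.
have /activeP[KU tK] := KT; have KU0 := subsetP UU _ KU.
rewrite Er_sum -mulrA mulrCA mulr_natl -(inc_card KU0) -sumr_const.
apply: ler_sum => u uK; rewrite (Er_step _ _ KU).
have -> : Er p (U :\ K) (fun H => (K \in H)%:R * (#|cl (H :\: T) [set u]|%:R *
        (#|cl (H :\: T) [set u]|%:R < M0)%R%:R)) = 0.
  rewrite -[RHS](Er_cst p (U :\ K)); apply: eq_Er => H; rewrite subsetD1 => /andP[_ /negbTE ->].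
  by rewrite mul0r.
rewrite mulr0 add0r ler_wpM2l//.
have uV : u \in V0 by apply: (subsetP (inc_sub KU0)).
apply: le_trans (hb (U :\: T) u _ uV); last exact: subset_trans (subsetDl _ _) UU.
pose g A : R := #|cl A [set u]|%:R * (#|cl A [set u]|%:R < M0)%R%:R.
have addT L H : L \in T -> (L |: H) :\: T = H :\: T.
  move=> LT; apply/setP => x; rewrite !inE; have [->|//] := eqVneq x L.
  by move: LT; rewrite inE => ->.
rewrite (@eq_Er _ _ _ _ _ (fun H => g (H :\: T))) => [|H _]; last first.
  by rewrite setU11 mul1r addT.
rewrite (@Er_sub _ _ p (U :\ K) (U :\: T)); last first.
- move=> L H /setDP[/setD1P[_ LU]]; rewrite inE LU andbT negbK => LT.
  by rewrite addT.
- apply/subsetP => L; rewrite !inE => /andP[LT ->]; rewrite andbT.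
  by apply: contraNneq LT => ->; rewrite KU tK.
apply: le_Er => // H /subsetDP[_ HT]; rewrite (_ : H :\: T = H)//.
exact/setDidPl.
Qed.

Lemma gfun_le1 U F : gfun U F <= 1.
Proof. by rewrite -expR0 ler_expR oppr_le0 addr_ge0// mulr_ge0. Qed.

(* The number of active edges has drift at most [e] per query, so its mean when [M0] vertices
   have been found is controlled by the mean number of vertices found. *)
Lemma Er_giant_le (a b e : R) v : (0 < m)%N -> v \in V0 -> 0 <= a -> 0 <= b -> 0 <= e ->
  p * m%:R * D%:R <= 1 + e ->
  (forall v, v \in V0 -> forall U, U \subset U0 ->
     Er p U (fun H => (M0 <= #|cl H [set v]|%:R)%R%:R) <= a) ->
  (forall U' v, U' \subset U0 -> v \in V0 ->
     Er p U' (fun H => #|cl H [set v]|%:R * (#|cl H [set v]|%:R < M0)%R%:R) <= b) ->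
  Er p U0 (fun H => #|cl H [set v]|%:R * (M0 <= #|cl H [set v]|%:R)%R%:R) <=
    ((M0 + m%:R + a * #|V0|%:R) / (1 - expR (- (zeta * M0))) +
     p * m.+1%:R * b * (e * D%:R * ((1 + zeta * (M0 + m%:R)) / zeta))) * q +
    p * m.+1%:R * b * D%:R.
Proof.
move=> m0 vV a0 b0 e0 pmD ha hb; have /andP[p0 p1] := p01.
set c1 := (_ + _ + _) / _; set c2 := p * _ * b; set c3 := e * _ * _.
have d0 := small_term_gt0.
have c10 : 0 <= c1.
  by rewrite divr_ge0 ?(ltW d0)// !addr_ge0 ?mulr_ge0// ltW.
have c20 : 0 <= c2 by rewrite !mulr_ge0.
have Mm0 : 0 <= M0 + m%:R by rewrite addr_ge0// ltW.
have z0 : 0 <= (1 + zeta * (M0 + m%:R)) / zeta by rewrite divr_ge0// addr_ge0// mulr_ge0.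
have c30 : 0 <= c3 by rewrite /c3 mulr_ge0// mulr_ge0.
(* The coefficient [c1] pays, once [M0] vertices are found, for these vertices and for all vertices
   in large components; [c2] is the mean number of vertices gained through an active edge. Each
   query lowers [#|U|] by one, so the term [e * #|U|] offsets the drift of the number of active
   edges. The price is a negative term of size at most [e * D * #|F|], since queried edges touch
   [F], and [c3 * (1 - gfun U F)] outweighs it. *)
pose Phi U F := c1 * (1 - gfun U F) +
  c2 * (#|active U F|%:R + e * (#|U|%:R - #|U0|%:R) + c3 * (1 - gfun U F)).
pose X (H : {set E}) F : R := #|cl H F|%:R * (M0 <= #|cl H F|%:R)%R%:R.
have HX H F K : touch K F -> X (K |: H) F = X H (F :|: inc K).
  by move=> tK; rewrite /X cl_add.
have queried U F : state U0 U F -> #|F|%:R <= M0 + m%:R ->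
    0 <= e * (#|U|%:R - #|U0|%:R) + c3 * (1 - gfun U F).
  move=> s FM; have [UU _ _] := s; have := card_queried s.
  rewrite -(ler_nat R) natrB ?subset_leq_card// natrM => hq.
  have hF : #|F|%:R <= (1 + zeta * (M0 + m%:R)) / zeta * (1 - gfun U F).
    apply: (@le_trans _ _ ((1 + zeta * (M0 + m%:R)) / zeta * (1 - expR (- (zeta * #|F|%:R))))).
      by apply: le_concave => //; rewrite ler0n.
    by apply: ler_wpM2l => //; rewrite lerD2l lerN2 gfun_le.
  have := ler_wpM2l e0 hq.
  have := ler_wpM2l e0 (ler_wpM2l (ler0n R D) hF).
  rewrite /c3; set z := _ / zeta; lra.
suff : Er p U0 (X^~ [set v]) <= Phi U0 [set v].
  move=> /le_trans -> //; rewrite /Phi subrr mulr0 addr0.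
  have h1 := gfun1 v (subxx U0).
  have h2 : #|active U0 [set v]|%:R <= D%:R :> R.
    rewrite ler_nat; apply: leq_trans (deg_le v); apply: subset_leq_card.
    by apply/subsetP => K; rewrite !inE touch1.
  have := ler_wpM2l c10 h1; have := ler_wpM2l c20 h2; have := ler_wpM2l (mulr_ge0 c20 c30) h1.
  lra.
apply: (Er_explore_le (P := fun F => #|F|%:R <= M0 + m%:R) HX _ (state_init vV)); last first.
  by rewrite cards1 -[1%:R]add0r lerD ?(ltW M0_gt0)// ler_nat.
move=> U F s FM; have [UU FV _] := s.
have [MF|FM0] := leP M0 #|F|%:R.
  left; apply: (@le_trans _ _ (Er p U (fun H => #|cl H F|%:R))).
    apply: le_Er => // H _; rewrite /X.
    by case: (M0 <= _); rewrite ?mulr1//= mulr0.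
  apply: le_trans (Er_card_cl_le UU FV (fun v vV => ha v vV U UU) hb) _.
  have : M0 + m%:R + a * #|V0|%:R <= c1 * (1 - gfun U F).
    apply: (@le_trans _ _ (c1 * (1 - expR (- (zeta * M0))))).
      by rewrite divfK// gt_eqF.
    rewrite ler_wpM2l// lerD2l lerN2; apply: le_trans (gfun_le _ _) _.
    by rewrite ler_expR lerN2 ler_wpM2l.
  have := ler_wpM2l c20 (queried _ _ s FM); rewrite mulr0 /Phi -/c2; lra.
have [a_nil|[K Ka]] := set_0Vmem (active U F).
  left; apply: Er_le_cst => H /(active_nil a_nil) e1.
  have -> : X H F = 0 by rewrite /X e1 [(M0 <= _)%R]leNgt FM0 mulr0.
  rewrite /Phi a_nil cards0 add0r.
  apply: addr_ge0; apply: mulr_ge0 => //; first by rewrite subr_ge0 gfun_le1.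
  exact: queried.
right; exists K => //; split; last first.
  rewrite card_open natrD; apply: lerD; first exact: ltW.
  by rewrite ler_nat (card_new s Ka).
have := stp_gfun Hmu s Ka; have := card_active_closed Ka; have := card_active_open1 s Ka.
have /activeP[KU _] := Ka; have := cardsD1 K U; rewrite KU /Phi /stp.
move=> -> hop ->; rewrite -(ler_nat R) natrD natrM in hop.
set y := gfun U F; set y1 := gfun _ F; set y2 := gfun _ (_ :|: _) => hy.
rewrite natrD -(natr1 #|active (U :\ K) F|) -[true%:R]/(1 : R).
move: hop; set A1 := #|active (U :\ K) (_ :|: _)|%:R; set A := #|active (U :\ K) F|%:R => hop.
have := ler_wpM2l c10 hy; have := ler_wpM2l (mulr_ge0 c20 c30) hy.
have := ler_wpM2l p0 hop => h1.
have h2 : p * A1 + (1 - p) * A <= A + 1 + e by lra.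
have := ler_wpM2l c20 h2.
set u := #|_ :\ _|%:R; set u0 := #|U0|%:R; lra.
Qed.

End GeneratingFunction.

(** * Exponential potentials for additive functionals of the exploration *)

Section Potentials.
Implicit Types (phi c : V -> R).

Definition Lam phi U F : R := \sum_(K in active U F) \sum_(u in inc K :\: F) phi u.

Definition nbr_sum phi v : R :=
  \sum_(K in U0 | v \in inc K) \sum_(u in inc K :\ v) phi u.

Lemma LamN phi U F : Lam (fun u => - phi u) U F = - Lam phi U F.
Proof. by rewrite /Lam -sumrN; apply: eq_bigr => K _; rewrite sumrN. Qed.

Lemma nbr_sumN phi v : nbr_sum (fun u => - phi u) v = - nbr_sum phi v.
Proof. by rewrite /nbr_sum -sumrN; apply: eq_bigr => K _; rewrite sumrN. Qed.

Lemma Lam_closed phi U F K : K \in active U F ->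
  Lam phi U F = \sum_(u in inc K :\: F) phi u + Lam phi (U :\ K) F.
Proof.
move=> Ka; rewrite /Lam (bigD1 K)//=; congr (_ + _); apply: eq_bigl => L.
by rewrite !inE andbC andbA.
Qed.

Lemma ler_sum_subset (I : finType) (A B : {set I}) (f : I -> R) :
  A \subset B -> (forall i, i \in B -> 0 <= f i) -> \sum_(i in A) f i <= \sum_(i in B) f i.
Proof.
move=> /subsetP AB f0; rewrite big_mkcond [leRHS]big_mkcond /=.
apply: ler_sum => i _; case: ifP => [/AB -> //|_].
by case: ifP => // /f0.
Qed.

(** Edges that were already active can only lose terms, and an edge that becomes active contains a
    vertex [u] of [inc K :\: F], to whose [nbr_sum] it is charged. *)
Lemma Lam_open phi U F K : (forall u, 0 <= phi u) -> U \subset U0 ->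
  Lam phi U (F :|: inc K) <= Lam phi U F + \sum_(u in inc K :\: F) nbr_sum phi u.
Proof.
move=> phi0 /subsetP UU.
have s0 (A : {set V}) : 0 <= \sum_(u in A) phi u by apply: sumr_ge0.
rewrite /Lam (bigID (fun L => touch L F)) /=; apply: lerD.
  rewrite (eq_bigl [in active U F]) => [|L]; last first.
    by rewrite !inE touchU; case: (touch L F); rewrite /= ?andbT ?andbF.
  apply: ler_sum => L _; apply: ler_sum_subset => //.
  exact: setDS (subsetUl _ _).
pose N := inc K :\: F.
apply: (@le_trans _ _ (\sum_(L in U0) \sum_(u in N | u \in inc L) \sum_(v in inc L :\ u) phi v)).
  rewrite big_mkcond [leRHS]big_mkcond /=; apply: ler_sum => L _.
  case: ifP => [/andP[/activeP[LU]]|_]; last by case: ifP => // _; apply: sumr_ge0.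
  rewrite touchU => tL /negbTE LF; rewrite (UU _ LU).
  move: tL; rewrite LF /= => /touchP[u uL uK].
  have uF : u \notin F by apply: contraFN LF => uF; apply/touchP; exists u.
  rewrite [leRHS](bigD1 u) /=; last by rewrite /N !inE uF uK uL.
  apply: ler_wpDr; first exact: sumr_ge0.
  apply: ler_sum_subset => //; apply/subsetP => v; rewrite !inE negb_or.
  move=> /andP[/andP[_ vK] ->]; rewrite andbT.
  by apply: contraNneq vK => ->.
rewrite (exchange_big_dep (mem N)) /=; last by move=> ? ? _ /andP[].
by apply: ler_sum => u uN; rewrite /nbr_sum le_eqVlt; apply/orP; left; apply/eqP; apply: eq_bigl => L; rewrite uN.
Qed.

Lemma sum_found c F K :
  \sum_(u in F :|: inc K) c u = \sum_(u in F) c u + \sum_(u in inc K :\: F) c u.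
Proof.
rewrite -bigU /=; last by rewrite -setI_eq0 setIDA setIC -setIDA setDv setI0.
by apply: eq_bigl => u; rewrite !inE; case: (u \in F).
Qed.

(* [Lam phi] is what the active edges are about to bring, and a new vertex [v] adds at most
   [nbr_sum phi v] to it: [epot] is superharmonic if [c v] compensates for this. *)
Definition epot c phi U F : R := expR (\sum_(v in F) c v + Lam phi U F).

Lemma epot_ge0 c phi U F : 0 <= epot c phi U F. Proof. exact: expR_ge0. Qed.

(** The query releases [phi] of the unfound vertices of [K], and a positive answer adds at most [X],
    the sum of [c u + nbr_sum phi u] over them. As [X <= tau], one has
    [exp X - 1 <= (1 + 2 * tau) * X] for [X > 0], so a linear inequality at each vertex suffices. *)
Lemma stp_epot c phi tau W U F K : (forall u, 0 <= phi u) -> 0 <= tau <= 2^-1 ->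
  (forall u, u \in V0 -> c u + nbr_sum phi u <= tau / m%:R) ->
  (forall u, u \in V0 -> p * (1 + 2 * tau) * (c u + nbr_sum phi u) <= phi u) ->
  state W U F -> K \in active U F -> stp (epot c phi) U F K <= epot c phi U F.
Proof.
move=> phi0 /andP[tau0 tau2] hX hphi s Ka; have /andP[p0 p1] := p01.
have [UU FV _] := state_closed s Ka; have [UU' _ _] := s.
have /activeP[KU _] := Ka.
have NV u : u \in inc K :\: F -> u \in V0.
  move=> /setDP[uK _]; apply: subsetP uK; apply: inc_sub.
  exact: (subsetP UU').
set X := \sum_(u in inc K :\: F) (c u + nbr_sum phi u).
set g := \sum_(u in inc K :\: F) phi u.
set z := epot c phi (U :\ K) F.
have e1 : epot c phi U F = z * expR g.
  by rewrite /z /epot (Lam_closed _ Ka) -expRD; congr expR; rewrite -/g; ring.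
have e2 : epot c phi (U :\ K) (F :|: inc K) <= z * expR X.
  rewrite /z /epot -expRD ler_expR sum_found /X big_split /=.
  by have := Lam_open F K phi0 UU; lra.
rewrite /stp -/z e1.
apply: (@le_trans _ _ (z * (1 - p + p * expR X))).
  by have := ler_wpM2l p0 e2; lra.
rewrite ler_wpM2l ?epot_ge0//.
have Xtau : X <= tau.
  apply: (@le_trans _ _ (\sum_(u in inc K :\: F) (tau / m%:R))); first by apply: ler_sum => u /NV /hX.
  rewrite sumr_const -[leLHS]mulr_natr -mulrA ler_piMr//.
  have := card_new s Ka; case: (m) => [|m'] wm; first by rewrite invr0 mul0r.
  by rewrite mulrC ler_pdivrMr ?ltr0Sn// mul1r ler_nat.
have g0 : 0 <= g by apply: sumr_ge0.
apply: le_trans (expR_ge1Dx g).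
suff : p * (expR X - 1) <= g by lra.
have [X0|X0] := leP X 0.
  apply: le_trans g0; rewrite mulr_ge0_le0// subr_le0 -expR0 ler_expR//.
apply: (@le_trans _ _ (p * (1 + 2 * tau) * X)); last first.
  by rewrite /X mulr_sumr; apply: ler_sum => u /NV; apply: hphi.
rewrite -mulrA ler_wpM2l//.
have := @expR_le2 R X (le_trans Xtau tau2).
have : X ^+ 2 <= tau * X by rewrite expr2 ler_wpM2r// ltW.
lra.
Qed.

(** The version for lower tails. The second-order error [2 * X ^+ 2] is no longer proportional to
    [X] with a favourable sign, so it is paid by [sig] for each new vertex. *)
Lemma stp_epotN c phi sig x0 W U F K : (forall u, phi u <= 0) -> 0 <= x0 ->
  m%:R * x0 <= 2^-1 -> 2 * m%:R * x0 ^+ 2 <= sig ->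
  (forall u, u \in V0 -> `|c u + nbr_sum phi u| <= x0) ->
  (forall u, u \in V0 -> phi u <= p * (c u + nbr_sum phi u - sig)) ->
  state W U F -> K \in active U F ->
  stp (epot (fun u => - c u) (fun u => - phi u)) U F K <=
    epot (fun u => - c u) (fun u => - phi u) U F.
Proof.
move=> phi0 x00 mx0 sigx hX hphi s Ka; have /andP[p0 p1] := p01.
have [UU FV _] := state_closed s Ka; have [UU' _ _] := s.
have /activeP[KU _] := Ka.
have NV u : u \in inc K :\: F -> u \in V0.
  move=> /setDP[uK _]; apply: subsetP uK; apply: inc_sub.
  exact: (subsetP UU').
set X := \sum_(u in inc K :\: F) (c u + nbr_sum phi u).
set g := \sum_(u in inc K :\: F) phi u.
set z := epot (fun u => - c u) (fun u => - phi u) (U :\ K) F.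
have e1 : epot (fun u => - c u) (fun u => - phi u) U F = z * expR (- g).
  by rewrite /z /epot (Lam_closed _ Ka) -expRD; congr expR; rewrite !sumrN -/g; ring.
have e2 : epot (fun u => - c u) (fun u => - phi u) (U :\ K) (F :|: inc K) <= z * expR (- X).
  have phiN u : 0 <= - phi u by rewrite oppr_ge0.
  rewrite /z /epot -expRD ler_expR sum_found /X big_split /= opprD -!sumrN.
  have := Lam_open F K phiN UU.
  rewrite (eq_bigr (fun u => - nbr_sum phi u)) => [|u _]; last exact: nbr_sumN.
  by lra.
rewrite /stp -/z e1.
apply: (@le_trans _ _ (z * (1 - p + p * expR (- X)))).
  by have := ler_wpM2l p0 e2; lra.
rewrite ler_wpM2l ?epot_ge0//.
set w : R := #|inc K :\: F|%:R.
have wm : w <= m%:R by rewrite ler_nat (card_new s Ka).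
have w0 : 0 <= w by [].
have Xx : `|X| <= w * x0.
  apply: le_trans (ler_norm_sum _ _ _) _.
  apply: (@le_trans _ _ (\sum_(u in inc K :\: F) x0)); first by apply: ler_sum => u /NV /hX.
  by rewrite sumr_const mulr_natl.
have X2 : - X <= 2^-1.
  apply: le_trans (ler_norm _) _; rewrite normrN; apply: le_trans Xx _.
  by apply: le_trans mx0; rewrite ler_wpM2r.
have XX : 2 * X ^+ 2 <= w * sig.
  have : X ^+ 2 <= (w * x0) ^+ 2 by rewrite -real_normK ?num_real// ler_pXn2r ?nnegrE ?mulr_ge0.
  have : w * (2 * m%:R * x0 ^+ 2) <= w * sig by rewrite ler_wpM2l.
  have : w * x0 ^+ 2 * w <= w * x0 ^+ 2 * m%:R by rewrite ler_wpM2l// mulr_ge0// exprn_ge0.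
  rewrite exprMn; nra.
apply: le_trans (expR_ge1Dx (- g)).
suff : g <= p * (1 - expR (- X)) by lra.
apply: (@le_trans _ _ (p * (X - w * sig))).
  have -> : X - w * sig = \sum_(u in inc K :\: F) (c u + nbr_sum phi u - sig).
    by rewrite sumrB sumr_const mulr_natl.
  by rewrite mulr_sumr; apply: ler_sum => u /NV /hphi.
rewrite ler_wpM2l//.
by have := expR_le2 X2; rewrite sqrrN; lra.
Qed.

End Potentials.

Definition codeg u v := #|[set K in U0 | (u \in inc K) && (v \in inc K)]|.

(** Counts the pairs of an edge through [u] and another found vertex on it: the overlap that slows
    the exploration down. *)
Definition load F u := (\sum_(v in F :\ u) codeg u v)%N.

(** This is [Lam] for the constant function 1. It measures what is left to explore, and vanishes
    when no edge is active. *)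
Definition Lam1 U F := (\sum_(K in active U F) #|inc K :\: F|)%N.

Lemma card_set_sum (T : finType) (A : {set T}) (P : pred T) :
  #|[set x in A | P x]| = (\sum_(x in A) P x)%N.
Proof.
rewrite -sum1_card big_mkcond [RHS]big_mkcond /=.
by apply: eq_bigr => x _; rewrite inE; case: (x \in A); case: (P x).
Qed.

Lemma loadE F u :
  load F u = (\sum_(K in U0 | u \in inc K) #|inc K :&: (F :\ u)|)%N.
Proof.
rewrite /load; under eq_bigr do rewrite /codeg card_set_sum.
rewrite exchange_big [RHS]big_mkcondr /=; apply: eq_bigr => K _.
case: ifP => uK; last by rewrite big1.
have -> : inc K :&: (F :\ u) = [set v in F :\ u | v \in inc K].
  by apply/setP => v; rewrite !inE andbC.
by rewrite card_set_sum.
Qed.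

Hypothesis deg_eq : forall v, v \in V0 -> #|[set K in U0 | v \in inc K]| = D.

(** The sum over all edges of [loss_queried] and [loss_unqueried]. Without overlaps each new vertex
    would add [m * D]. *)
Lemma Lam1_open U F K : state U0 U F -> K \in active U F ->
  (Lam1 (U :\ K) F + #|inc K :\: F| * (m * D) <=
   Lam1 (U :\ K) (F :|: inc K) + m.+1 * \sum_(u in inc K :\: F) load (F :|: inc K) u)%N.
Proof.
move=> s Ka; have [UU FV QF] := state_closed s Ka.
have /activeP[KU tK] := Ka; have [/subsetP UU' _ _] := s.
set N := inc K :\: F; set U' := U :\ K; set F' := F :|: inc K.
have NV u : u \in N -> u \in V0.
  by move=> /setDP[uK _]; apply: subsetP uK; apply: inc_sub; exact: UU'.
have lam A : Lam1 U' A = (\sum_(L in U0) (L \in active U' A) * #|inc L :\: A|)%N.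
  rewrite /Lam1 big_mkcond [RHS]big_mkcond /=; apply: eq_bigr => L _.
  case: (boolP (L \in active U' A)) => [/activeP[LU _]|_]; last by rewrite mul0n; case: ifP.
  by rewrite (subsetP UU _ LU) mul1n.
have -> : (#|N| * (m * D) = \sum_(L in U0) m * #|inc L :&: N|)%N.
  rewrite -big_distrr /= mulnCA; congr (_ * _)%N.
  rewrite (eq_bigr (fun L => \sum_(u in N) (u \in inc L))%N); last first.
    move=> L _; rewrite setIC -card_set_sum; apply: eq_card => u; by rewrite !inE.
  rewrite exchange_big -sum_nat_const /=; apply: eq_bigr => u uN.
  by rewrite -card_set_sum deg_eq// NV.
have -> : (\sum_(u in N) load F' u = \sum_(L in U0) \sum_(u in N) (u \in inc L) * #|inc L :&: (F' :\ u)|)%N.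
  rewrite [RHS]exchange_big; apply: eq_bigr => u _; rewrite loadE [LHS]big_mkcondr.
  by apply: eq_bigr => L _; case: (u \in inc L); rewrite ?mul1n.
rewrite !lam big_distrr -!big_split /=; apply: leq_sum => L LU0.
have disj : F :&: N = set0 by rewrite /N setIDA setIC -setIDA setDv setI0.
have F'E : F' = F :|: N by apply/setP => u; rewrite !inE; case: (u \in F).
set f := #|inc L :&: F|; set x := #|inc L :&: N|.
have cF' : #|inc L :&: F'| = (f + x)%N.
  rewrite F'E setIUr cardsU setIACA disj setI0 cards0 subn0 //.
have cL := inc_card LU0.
have dF : #|inc L :\: F| = (m.+1 - f)%N by rewrite cardsD cL.
have dF' : #|inc L :\: F'| = (m.+1 - (f + x))%N by rewrite cardsD cL cF'.
have lef : (f + x <= m.+1)%N by rewrite -cL -cF'; apply: subset_leq_card; apply: subsetIl.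
have sumE : (\sum_(u in N) (u \in inc L) * #|inc L :&: (F' :\ u)| = x * (f + x).-1)%N.
  rewrite (eq_bigr (fun u => (u \in inc L) * (f + x).-1)%N) => [|u uN].
    rewrite -big_distrl /= -card_set_sum; congr (_ * _)%N; apply: eq_card => u.
    by rewrite !inE andbC.
  case uL: (u \in inc L); rewrite ?mul0n// !mul1n -cF' setIDA (cardsD1 u (inc L :&: F')) inE uL.
  by have -> : u \in F' by move: uN; rewrite F'E !inE => ->; rewrite orbT.
rewrite sumE dF dF'.
have actE A : (L \in active U' A) = (L \in U') && (0 < #|inc L :&: A|)%N.
  by rewrite inE /touch card_gt0.
rewrite !actE cF' -/f.
have [LU|LU] := boolP (L \in U'); first by rewrite !andTb; apply: loss_unqueried.
rewrite !andFb !mul0n !add0n; apply: loss_queried.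
have tL : touch L F by apply: QF; rewrite inE LU.
by rewrite card_gt0.
Qed.

(** Every query removes the unfound vertices of [K] from [Lam1], and a positive answer returns at
    least [m * D - m.+1 * L] for each of them; [x1] is this amount in units of [mu^-1], or less. The
    factor [1 - m * x1 / 2] comes from [exp (- s) <= 1 - s + s ^+ 2 / 2]. *)
Lemma stp_lam1 (mu : R) L x1 U F K : 0 <= mu -> 0 <= x1 -> m%:R * x1 <= 1 ->
  x1 <= mu * (m%:R * D%:R - m.+1%:R * L) ->
  mu <= p * (x1 * (1 - m%:R * x1 / 2)) ->
  (forall u, u \in V0 -> u \notin F -> (load (F :|: inc K) u)%:R <= L) ->
  state U0 U F -> K \in active U F ->
  stp (fun U F => expR (- (mu * (Lam1 U F)%:R))) U F K <= expR (- (mu * (Lam1 U F)%:R)).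
Proof.
move=> mu0 x10 mx1 hx1 hmu hL s Ka; have /andP[p0 p1] := p01.
have [UU FV _] := s; have /activeP[KU _] := Ka.
have := Lam1_open s Ka; have := card_new s Ka.
have NV u : u \in inc K :\: F -> u \in V0 /\ u \notin F.
  move=> /setDP[uK ->]; split => //; apply: subsetP uK; apply: inc_sub.
  exact: (subsetP UU).
have : (\sum_(u in inc K :\: F) load (F :|: inc K) u)%:R <= #|inc K :\: F|%:R * L.
  by rewrite natr_sum mulr_natl -sumr_const; apply: ler_sum => u /NV[uV uF]; apply: hL.
have lam_closed : Lam1 U F = (#|inc K :\: F| + Lam1 (U :\ K) F)%N.
  rewrite /Lam1 (bigD1 K)//=; congr (_ + _)%N; apply: eq_bigl => A.
  by rewrite !inE andbC andbA.
rewrite /stp lam_closed; set N := inc K :\: F; set S := (\sum_(u in N) _)%N.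
set B := Lam1 _ (_ :|: _); set A := Lam1 _ F; set w := #|N|.
move=> hS wm; rewrite -(ler_nat R) !natrD !natrM => hB.
have w0 : 0 <= w%:R :> R by [].
have wm' : w%:R <= m%:R :> R by rewrite ler_nat.
have hB2 : w%:R * x1 <= mu * B%:R - mu * A%:R.
  have := ler_wpM2l w0 hx1; have := ler_wpM2l mu0 hB.
  have := ler_wpM2l mu0 (ler_wpM2l (ler0n R m.+1) hS).
  by lra.
set z := expR (- (mu * A%:R)).
have -> : expR (- (mu * (w%:R + A%:R))) = z * expR (- (w%:R * mu)).
  by rewrite -expRD; congr expR; ring.
apply: (@le_trans _ _ (z * (1 - p + p * expR (- (w%:R * x1))))).
  rewrite mulrDr [z * (1 - p)]mulrC lerD2l mulrCA ler_wpM2l// -expRD ler_expR; lra.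
rewrite ler_wpM2l ?expR_ge0//.
apply: le_trans (expR_ge1Dx _).
have wx0 : 0 <= w%:R * x1 by rewrite mulr_ge0.
have := expRN_le wx0 => h1.
have h2 : w%:R * x1 * (1 - m%:R * x1 / 2) <= 1 - expR (- (w%:R * x1)).
  have : (w%:R * x1) * (w%:R * x1) <= (w%:R * x1) * (m%:R * x1).
    by rewrite ler_wpM2l// ler_wpM2r.
  by move: h1; rewrite expr2; lra.
have := ler_wpM2l p0 h2; have := ler_wpM2l w0 hmu; lra.
Qed.

(** * Survival of the exploration, and meeting of two explorations *)

Section Survival.
(** The potential [BP] stands for the event that some vertex gets load above [L] while at most
    [M + m] vertices are found: it is superharmonic and at least 1 on that event, so its initial
    value bounds the probability. Up to [m] vertices may be found beyond [M] in the last step. *)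
Variables (BP : {set E} -> {set V} -> R) (L M rho : R).
Hypotheses (BP_ge0 : forall U F, 0 <= BP U F)
  (stp_BP : forall U F K, state U0 U F -> K \in active U F -> stp BP U F K <= BP U F)
  (BP_bad : forall U F u, state U0 U F -> #|F|%:R <= M + m%:R -> u \in V0 ->
     L < (load F u)%:R -> 1 <= BP U F)
  (codeg_le : forall u v, u != v -> (codeg u v)%:R <= rho)
  (m_gt0 : (0 < m)%N) (M_gt0 : 0 < M).

Definition good F := [forall u in V0, (load F u)%:R <= L].

Lemma load_open W U F K u : state W U F -> K \in active U F -> u \notin F ->
  (load (F :|: inc K) u)%:R <= (load F u)%:R + m%:R * rho.
Proof.
move=> s Ka uF; have uFu : F :\ u = F.
  by apply/setP => v; rewrite !inE andb_idl//; apply: contraTneq => ->.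
pose N := inc K :\: F.
have -> : load (F :|: inc K) u = (load F u + \sum_(v in N :\ u) codeg u v)%N.
  rewrite /load uFu (bigID (mem F)) /=; congr (_ + _)%N.
    apply: eq_bigl => v; rewrite !inE; case vF: (v \in F); rewrite ?andbF ?andbT//=.
    by apply: contraTneq vF => ->.
  by apply: eq_bigl => v; rewrite !inE; case: (v \in F); rewrite ?andbF ?andbT.
rewrite natrD lerD2l natr_sum.
apply: (@le_trans _ _ (\sum_(v in N :\ u) rho)).
  by apply: ler_sum => v; rewrite !inE => /andP[vu _]; rewrite codeg_le// eq_sym.
have rho0 : 0 <= rho.
  have [v vK] : exists v, v \in inc K :\ u.
    apply/set0Pn; rewrite -card_gt0.
    have /activeP[KU _] := Ka; have [/subsetP UU _ _] := s.
    have := inc_card (UU _ KU); rewrite (cardsD1 u) => h.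
    by move: m_gt0 h; case: (u \in inc K) => /=; lia.
  have vu : u != v by move: vK; rewrite !inE eq_sym => /andP[].
  exact: le_trans (codeg_le vu).
rewrite sumr_const -[leLHS]mulr_natl ler_wpM2r// ler_nat.
apply: leq_trans (card_new s Ka); apply: subset_leq_card; exact: subD1set.
Qed.

Lemma init_small v : #|[set v]|%:R <= M + m%:R.
Proof. by rewrite cards1 -[1%:R]add0r lerD ?(ltW M_gt0)// ler_nat. Qed.

Lemma open_small W U F K : state W U F -> K \in active U F -> #|F|%:R < M ->
  #|F :|: inc K|%:R <= M + m%:R.
Proof.
move=> s Ka FM; rewrite card_open natrD; apply: lerD; first exact: ltW.
by rewrite ler_nat (card_new s Ka).
Qed.

Lemma goodPn F : ~~ good F -> exists2 u, u \in V0 & L < (load F u)%:R.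
Proof. by move=> /forall_inPn[u uV]; rewrite -ltNge; exists u. Qed.

(** The bounding function is [exp (- mu * Lam1) + BP]. If the exploration dies, [Lam1 = 0] and the
    first term is 1; if a load becomes too large, the second is at least 1; otherwise it goes on
    until [M] vertices are found. The load condition concerns the state after a step, hence
    [L + m * rho]. *)
Lemma Er_extinct_le mu x1 v : v \in V0 -> 0 <= mu -> 0 <= x1 -> m%:R * x1 <= 1 ->
  x1 <= mu * (m%:R * D%:R - m.+1%:R * (L + m%:R * rho)) ->
  mu <= p * (x1 * (1 - m%:R * x1 / 2)) ->
  Er p U0 (fun H => (#|cl H [set v]|%:R < M)%R%:R) <=
    expR (- (mu * (m%:R * D%:R))) + BP U0 [set v].
Proof.
move=> vV mu0 x10 mx1 hx1 hmu.
pose X (H : {set E}) F : R := (#|cl H F|%:R < M)%R%:R.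
have HX H F K : touch K F -> X (K |: H) F = X H (F :|: inc K).
  by move=> tK; rewrite /X cl_add.
have X1 H F : X H F <= 1 by rewrite /X; case: (_ < _).
pose Phi U F := expR (- (mu * (Lam1 U F)%:R)) + BP U F.
have -> : expR (- (mu * (m%:R * D%:R))) + BP U0 [set v] = Phi U0 [set v].
  rewrite /Phi /Lam1; congr (expR (- (mu * _)) + _); rewrite -natrM; congr (_%:R).
  rewrite mulnC -(deg_eq vV) -sum_nat_const; apply: eq_big => K; first by rewrite !inE touch1.
  rewrite !inE => /andP[KU vK]; apply/esym/eqP; rewrite -eqSS -(inc_card KU) (cardsD1 v (inc K)) vK.
  by rewrite add1n.
apply: (Er_explore_le (P := fun F => #|F|%:R <= M + m%:R) HX _ (state_init vV)); last exact: init_small.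
move=> U F s FM; have [MF|FM0] := leP M #|F|%:R.
  left; apply: (@le_trans _ _ 0); last by rewrite addr_ge0// expR_ge0.
  apply: Er_le_cst => H _; rewrite /X ltNge.
  by rewrite (le_trans MF)// ler_nat; apply: subset_leq_card; apply: sub_cl.
have [gF|/goodPn[u uV uL]] := boolP (good F); last first.
  left; apply: (@le_trans _ _ 1); first by apply: Er_le_cst => H _; apply: X1.
  by apply: ler_wpDl; [exact: expR_ge0|exact: (BP_bad s FM uV)].
have [a_nil|[K Ka]] := set_0Vmem (active U F).
  left; apply: (@le_trans _ _ 1); first by apply: Er_le_cst => H _; apply: X1.
  by rewrite /Phi /Lam1 a_nil big_set0 mulr0 oppr0 expR0 lerDl.
right; exists K => //; split; last exact: open_small s Ka FM0.
have h1 := stp_BP s Ka.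
have : stp (fun U F => expR (- (mu * (Lam1 U F)%:R))) U F K <= expR (- (mu * (Lam1 U F)%:R)).
  apply: (stp_lam1 (L := L + m%:R * rho) mu0 x10) => // u uV uF.
  apply: le_trans (load_open s Ka uF) _; rewrite lerD2r.
  by move: gF => /forall_inP/(_ u uV).
move: h1; rewrite /Phi /stp; lra.
Qed.

(** * Two explorations followed by sprinkling *)

Section Phases.
Variables (p2 zeta mu : R).
Hypotheses (p201 : 0 <= p2 <= 1) (zeta_gt0 : 0 < zeta) (mu0 : 0 <= mu)
  (Hmu : expR (- mu) <= 1 - p + p * expR (- (m%:R * (zeta + mu * D%:R)))).
Let q := zeta + mu * D%:R.
Let dM : R := 1 - expR (- (zeta * M)).

Let dM_gt0 : 0 < dM := small_term_gt0 zeta_gt0 M_gt0.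

Lemma one_sub_gfun_ge U F : M <= #|F|%:R -> dM <= 1 - gfun zeta mu U F.
Proof.
move=> MF; rewrite lerD2l lerN2; apply: le_trans (gfun_le _ mu0 _ _) _.
by rewrite ler_expR lerN2 ler_wpM2l// ltW.
Qed.

Lemma one_sub_gfun_ge0 U F : 0 <= 1 - gfun zeta mu U F.
Proof. by rewrite subr_ge0 gfun_le1// ltW. Qed.

Lemma stp_one_sub_gfun a W U F K : 0 <= a -> state W U F -> K \in active U F ->
  stp (fun U F => a * (1 - gfun zeta mu U F)) U F K <= a * (1 - gfun zeta mu U F).
Proof.
move=> a0 s Ka; have := stp_gfun (ltW zeta_gt0) mu0 Hmu s Ka; rewrite /stp.
set y := gfun _ _ U F; set y1 := gfun _ _ _ F; set y2 := gfun _ _ _ _ => h.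
by have := ler_wpM2l a0 h; lra.
Qed.

(* [F1] is what a first exploration has found, and [H2] are the sprinkled edges. *)
Definition avoids F1 (H : {set E}) F : R :=
  Er p2 U0 (fun H2 => ((M <= #|cl H F|%:R) && (cl (H :|: H2) F :&: F1 == set0))%R%:R).

Definition disjoint_giants v2 (H : {set E}) F : R :=
  Er p2 U0 (fun H2 => [&& M <= #|cl H F|%:R, M <= #|cl H [set v2]|%:R &
                          v2 \notin cl (H :|: H2) F]%R%:R).

Lemma Er_avoid U (A : {set E}) : A \subset U -> Er p2 U (fun H => (H :&: A == set0)%:R) = (1 - p2) ^+ #|A|.
Proof.
move=> AU; rewrite (@Er_sub _ _ p2 U A) //.
  rewrite /Er (bigD1 set0) ?sub0set//= set0I eqxx mulr1 cards0 expr0 mul1r subn0.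
  rewrite big1 ?addr0// => H /andP[/setIidPl -> /negbTE ->].
  by rewrite mulr0.
move=> K H /setDP[_ KA]; congr (nat_of_bool (_ == _))%:R.
by apply/setP => B; rewrite !inE; case: eqP => // ->; rewrite (negbTE KA) !andbF.
Qed.

(** An edge touching both sets contributes the product of two intersection sizes, each at most
    [m.+1]. *)
Lemma sum_load_le F F1 : F :&: F1 = set0 ->
  (\sum_(u in F) load F1 u <= m.+1 ^ 2 * #|[set K in U0 | touch K F && touch K F1]|)%N.
Proof.
move=> FF1.
have -> : (\sum_(u in F) load F1 u = \sum_(K in U0) #|inc K :&: F| * #|inc K :&: F1|)%N.
  under eq_bigr do rewrite loadE big_mkcondr.
  rewrite exchange_big; apply: eq_bigr => K KU /=.
  rewrite setIC (_ : F :&: inc K = [set u in F | u \in inc K]); last by apply/setP => u; rewrite !inE.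
  rewrite card_set_sum big_distrl /=; apply: eq_bigr => u uF.
  have uF1 : F1 :\ u = F1.
    apply/setP => v; rewrite !inE andb_idl// => vF1; apply: contraTneq uF => <-.
    by apply/negP => vF; have : v \in F :&: F1 by [rewrite inE vF]; rewrite FF1 inE.
  by rewrite uF1; case: (u \in inc K); rewrite ?mul1n.
rewrite card_set_sum big_distrr /=; apply: leq_sum => K KU; rewrite /touch -!card_gt0.
have h A : (#|inc K :&: A| <= m.+1)%N.
  by rewrite -(inc_card KU); apply: subset_leq_card; apply: subsetIl.
case: posnP => [->|F0]; first by rewrite mul0n.
case: posnP => [->|F10]; first by rewrite muln0.
by rewrite muln1 expnS expn1 leq_mul.
Qed.

(** The exploration from [v] runs until it has [M] vertices. If it meets [F1], the event is
    impossible. If the found vertices have total load at least [wst] with respect to [F1], there are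
    many edges joining the two sets, and the sprinkling misses all of them with probability at most
    [b]. If the total load is smaller, the potential [Om] below is at least 1: it rewards a load
    that falls behind [kap / beta] for each found vertex. *)
Lemma Er_avoids_le F1 (beta kap wst b sig x0 : R) (phi : V -> R) U v :
  let c u := beta * (load F1 u)%:R - kap in
  (forall u, phi u <= 0) -> 0 <= x0 -> 0 <= b -> 0 <= beta -> 0 <= kap ->
  m%:R * x0 <= 2^-1 -> 2 * m%:R * x0 ^+ 2 <= sig ->
  (forall u, u \in V0 -> `|c u + nbr_sum phi u| <= x0) ->
  (forall u, u \in V0 -> phi u <= p * (c u + nbr_sum phi u - sig)) ->
  (forall k, wst <= (m.+1 ^ 2 * k)%:R -> (1 - p2) ^+ k <= b) ->
  U \subset U0 -> v \in V0 ->
  Er p U (avoids F1 ^~ [set v]) <=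
    epot (fun u => - c u) (fun u => - phi u) U [set v] * expR (- (kap * M - beta * wst))
    + b * (q / dM).
Proof.
move=> c phi0 x00 b0 beta0 kap0 mx0 sigx hX hphi hb UU vV.
have HX H F K : touch K F -> avoids F1 (K |: H) F = avoids F1 H (F :|: inc K).
  by move=> tK; rewrite /avoids; apply: eq_Er => H2 _; rewrite -setUA !cl_add.
pose Om U F := epot (fun u => - c u) (fun u => - phi u) U F * expR (- (kap * M - beta * wst)).
pose Phi U F := Om U F + b / dM * (1 - gfun zeta mu U F).
have bd0 : 0 <= b / dM by rewrite divr_ge0// ltW.
have Om0 U' F : 0 <= Om U' F by apply: mulr_ge0; [exact: epot_ge0|exact: expR_ge0].
have s : state set0 U [set v].
  by split; rewrite ?sub1set// => K; rewrite set0D inE.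
suff h : Er p U (avoids F1 ^~ [set v]) <= Phi U [set v].
  apply: le_trans h _; rewrite lerD2l -mulrA ler_wpM2l// [leRHS]mulrC.
  by rewrite ler_wpM2l ?invr_ge0 ?(ltW dM_gt0)// gfun1// ltW.
apply: (Er_explore_le (P := fun=> True) HX _ s) => // {UU s} U' F s _.
have [UU FV _] := s.
have Xle1 H : avoids F1 H F <= 1.
  by rewrite -[leRHS](Er_cst p2 U0); apply: le_Er => // H2 _; case: (_ && _).
have [MF|FM0] := leP M #|F|%:R.
  left; have [FF1|FF1] := eqVneq (F :&: F1) set0; last first.
    apply: (@le_trans _ _ 0); last by rewrite addr_ge0// mulr_ge0 ?one_sub_gfun_ge0.
    apply: Er_le_cst => H _; rewrite /avoids.
    rewrite -[leRHS](Er_cst p2 U0); apply: le_Er => // H2 _.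
    case: eqP => [e|]; last by rewrite andbF.
    move: FF1; rewrite -subset0 -e setSI ?sub_cl//.
  have [wF|wF] := leP wst (\sum_(u in F) load F1 u)%:R.
    apply: (@le_trans _ _ b); last first.
      apply: ler_wpDl => //; rewrite -[leLHS](divfK (lt0r_neq0 dM_gt0)).
      by rewrite ler_wpM2l// one_sub_gfun_ge.
    pose A := [set K in U0 | touch K F && touch K F1].
    have AU : A \subset U0 by apply/subsetP => K; rewrite inE => /andP[].
    apply: (@le_trans _ _ ((1 - p2) ^+ #|A|)); last first.
      apply: hb; apply: le_trans wF _; rewrite ler_nat; exact: sum_load_le.
    apply: Er_le_cst => H _; rewrite -(Er_avoid AU) /avoids; apply: le_Er => // H2 _.
    case: (boolP (_ && _)) => //= /andP[_ /eqP e].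
    suff -> : H2 :&: A == set0 by [].
    rewrite -subset0; apply/subsetP => K; rewrite !inE => /andP[KH2 /and3P[KU tF /touchP[u uK uF1]]].
    have : u \in cl (H :|: H2) F :&: F1.
      rewrite inE uF1 andbT; apply: (subsetP (@cl_closed _ _ _ (H :|: H2) F K _ _)) uK.
        by rewrite inE KH2 orbT.
      exact: touchS (sub_cl _ _ _) tF.
    by rewrite e inE.
  apply: (@le_trans _ _ 1); first by apply: Er_le_cst.
  rewrite /Phi; apply: ler_wpDr; first by rewrite mulr_ge0 ?one_sub_gfun_ge0.
  rewrite /Om /epot -expRD -expR0 ler_expR.
  have : Lam phi U' F <= 0.
    by apply: sumr_le0 => K _; apply: sumr_le0.
  rewrite LamN sumrN sumrB -mulr_sumr sumr_const -natr_sum.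
  have := ler_wpM2l beta0 (ltW wF); have := ler_wpM2l kap0 MF.
  rewrite -[kap *+ _]mulr_natr; lra.
have [a_nil|[K Ka]] := set_0Vmem (active U' F).
  left; apply: (@le_trans _ _ 0); last by rewrite addr_ge0// mulr_ge0 ?one_sub_gfun_ge0.
  apply: Er_le_cst => H HU; rewrite /avoids (active_nil a_nil HU).
  have -> : (M <= #|F|%:R) = false by rewrite leNgt FM0.
  by rewrite Er_cst.
right; exists K => //; split => //.
have h1 := stp_one_sub_gfun bd0 s Ka.
have := stp_epotN phi0 x00 mx0 sigx hX hphi s Ka.
move: h1; rewrite /Phi /Om /stp; set o := expR (- (_ - _)).
set e0 := epot _ _ U' F; set e1 := epot _ _ _ F; set e2 := epot _ _ _ _ => h1 h2.
by have := ler_wpM2r (expR_ge0 _ : 0 <= o) h2; lra.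
Qed.

(** The exploration from [v1] reaches [M] vertices with probability at most [q / dM], up to the bad
    event; then [B] bounds the probability that the one from [v2], run in the unqueried edges only,
    also becomes large and stays apart. *)
Lemma Er_disjoint_giants_le v1 v2 B : v1 \in V0 -> v2 \in V0 -> 0 <= B ->
  (forall U F, state U0 U F -> good F -> M <= #|F|%:R <= M + m%:R ->
     Er p U (avoids F ^~ [set v2]) <= B) ->
  Er p U0 (disjoint_giants v2 ^~ [set v1]) <= B * (q / dM) + BP U0 [set v1].
Proof.
move=> v1V v2V B0 hB.
pose X := disjoint_giants v2.
have HX H F K : touch K F -> X (K |: H) F = X H (F :|: inc K).
  (* On the event, the component of [v2] does not see the edges queried by the first exploration: if
     [K] touched it, [v2] would be joined to [F]. *)
  move=> tK; rewrite /X /disjoint_giants; apply: eq_Er => H2 _; rewrite -setUA !(cl_add _ tK).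
  congr (nat_of_bool (_ && _))%:R; case: (boolP (v2 \in _)); rewrite ?andbF// => v2F.
  suff -> : cl (K |: H) [set v2] = cl H [set v2] by [].
  apply/eqP; rewrite eqEsubset; apply/andP; split; last first.
    exact: clS (subsetUr _ _) (subxx _).
  apply: cl_min; first by rewrite sub1set cl1_id.
  move=> A /setU1P[->|AH]; last exact: cl_closed.
  move=> /touchP[u uK u2]; case/negP: v2F.
  rewrite clE; apply/set0Pn; exists u; apply/setIP; split; last by rewrite inE uK orbT.
  exact: (subsetP (clS inc (subsetUl H H2) (subxx [set v2]))) _ u2.
pose Phi U F := B / dM * (1 - gfun zeta mu U F) + BP U F.
have bd0 : 0 <= B / dM by rewrite divr_ge0// ltW.
suff h : Er p U0 (X^~ [set v1]) <= Phi U0 [set v1].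
  apply: le_trans h _; rewrite lerD2r -mulrA ler_wpM2l// [leRHS]mulrC.
  by rewrite ler_wpM2l ?invr_ge0 ?(ltW dM_gt0)// gfun1// ltW.
apply: (Er_explore_le (P := fun F => #|F|%:R <= M + m%:R) HX _ (state_init v1V)); last exact: init_small.
have Xle1 H F : X H F <= 1.
  by rewrite -[leRHS](Er_cst p2 U0); apply: le_Er => // H2 _; case: [&& _, _ & _].
move=> U F s FM; have [MF|FM0] := leP M #|F|%:R.
  left; have [gF|/goodPn[u uV uL]] := boolP (good F); last first.
    apply: (@le_trans _ _ 1); first exact: Er_le_cst.
    apply: ler_wpDl; last exact: (BP_bad s FM uV).
    by rewrite mulr_ge0 ?one_sub_gfun_ge0.
  apply: (@le_trans _ _ B).
    apply: le_trans (hB _ _ s gF _); last by rewrite MF FM.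
    apply: le_Er => // H _; apply: le_Er => // H2 _.
    case: (boolP [&& _, _ & _]) => //= /and3P[_ -> ]; rewrite clE negbK => /eqP e.
    by rewrite e eqxx.
  apply: ler_wpDr => //; rewrite -[leLHS](divfK (lt0r_neq0 dM_gt0)).
  by rewrite ler_wpM2l// one_sub_gfun_ge.
have [a_nil|[K Ka]] := set_0Vmem (active U F).
  left; apply: (@le_trans _ _ 0); last by rewrite addr_ge0// mulr_ge0 ?one_sub_gfun_ge0.
  apply: Er_le_cst => H HU; rewrite /X /disjoint_giants (active_nil a_nil HU).
  have -> : (M <= #|F|%:R) = false by rewrite leNgt FM0.
  by rewrite Er_cst.
right; exists K => //; split; last exact: open_small s Ka FM0.
have h1 := stp_one_sub_gfun bd0 s Ka.
have := stp_BP s Ka; move: h1; rewrite /Phi /stp; lra.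
Qed.

End Phases.
End Survival.

End Exploration.

Lemma ffact_le a b : (a ^_ b <= a ^ b)%N.
Proof. by elim: b => // b IH; rewrite ffactnSr expnSr leq_mul// leq_subr. Qed.

Lemma ffact_ge a b c : (b <= c)%N -> ((a - c) ^ b <= a ^_ b)%N.
Proof.
elim: b => // b IH bc; rewrite ffactnSr expnSr leq_mul ?IH ?leq_sub2l//; exact: ltnW.
Qed.

Lemma bin_le_expn a b : ('C(a, b) <= a ^ b)%N.
Proof. by apply: leq_trans (ffact_le a b); rewrite -bin_ffact leq_pmulr// fact_gt0. Qed.

(** * The hypergraph on [j]-sets: degrees, codegrees and [j]-components *)

Section Geometry.
Variables (n k j : nat).
Hypotheses (j_gt0 : (0 < j)%N) (jk : (j < k)%N) (kn : (k <= n)%N).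
Implicit Types (u v t : {set 'I_n}) (K A : {set 'I_n}).

Definition jsub K := [set J : {set 'I_n} | (J \subset K) && (#|J| == j)].

Let m := ('C(k, j)).-1.
Let D := 'C(n - j, k - j).

Lemma mem_ksets l A : (A \in ksets n l) = (#|A| == l).
Proof. by rewrite inE. Qed.

Lemma mem_jsub K J : (J \in jsub K) = (J \subset K) && (#|J| == j).
Proof. by rewrite inE. Qed.

Lemma bin_predK : 'C(k, j) = m.+1.
Proof. by rewrite prednK// bin_gt0 ltnW. Qed.

Lemma bin_pred_gt0 : (0 < m)%N.
Proof.
rewrite -ltnS -bin_predK; apply: (@leq_trans 'C(j.+1, j)); first by rewrite binSn.
by rewrite leq_bin2l.
Qed.

Lemma card_jsub K : K \in ksets n k -> #|jsub K| = m.+1.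
Proof. by rewrite inE => /eqP cK; rewrite /jsub cards_draws cK bin_predK. Qed.

Lemma jsub_sub K : jsub K \subset ksets n j.
Proof. by apply/subsetP => u; rewrite !inE => /andP[]. Qed.

Lemma card_ksets l : #|ksets n l| = 'C(n, l).
Proof.
have -> : ksets n l = [set A : {set 'I_n} | (A \subset [set: 'I_n]) && (#|A| == l)].
  by apply/setP => A; rewrite !inE subsetT.
by rewrite cards_draws cardsT card_ord.
Qed.

Definition nsup A := #|[set K in ksets n k | A \subset K]|.

Lemma nsupE A : (#|A| <= k)%N -> nsup A = 'C(n - #|A|, k - #|A|).
Proof.
move=> Ak; have -> : (n - #|A|)%N = #|~: A| by rewrite [RHS]cardsCs setCK card_ord.
rewrite -cards_draws /nsup.
rewrite -(card_in_imset (f := fun K => K :\: A) (D := [set K in ksets n k | A \subset K])); last first.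
  move=> K K'; rewrite !inE => /andP[_ AK] /andP[_ AK'] e.
  by rewrite -(setID K A) -(setID K' A) e (setIidPr AK) (setIidPr AK').
apply: eq_card => B; rewrite [RHS]inE; apply/imsetP/andP => [[K]|[BA /eqP cB]].
  rewrite !inE => /andP[/eqP cK AK] ->; rewrite cardsDS// cK eqxx; split => //.
  by rewrite setDE subsetIr.
have AB : A :&: B = set0.
  by apply/eqP; rewrite setI_eq0 disjoint_sym disjoints_subset.
exists (A :|: B); last by rewrite setDUl setDv set0U; apply/esym/setDidPl; rewrite disjoint_sym -setI_eq0 AB.
rewrite !inE subsetUl andbT cardsU AB cards0 subn0 cB subnKC//.
Qed.

Lemma nsup_gt A : (k < #|A|)%N -> nsup A = 0%N.
Proof.
move=> kA; apply/eqP; rewrite cards_eq0; apply/eqP/setP => K; rewrite !inE.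
apply/negbTE/negP => /andP[/eqP cK /subset_leq_card]; rewrite cK.
by rewrite leqNgt kA.
Qed.

Lemma nsup_bound A : (nsup A * n ^ #|A| <= n ^ k)%N.
Proof.
have [Ak|kA] := leqP #|A| k; last by rewrite nsup_gt.
rewrite nsupE// -{2}(subnK Ak) expnD leq_mul2r; apply/orP; right.
apply: leq_trans (bin_le_expn _ _) _.
case: (k - #|A|)%N => [|l] //; rewrite leq_exp2r//; exact: leq_subr.
Qed.

(** The constant in [n ^ (k - j) <= cgeo * D] for [n >= 2 * k]: the power of 2 comes from
    [n <= 2 * (n - k)], the factorial from the binomial coefficient [D]. *)
Definition cgeo := (2 ^ (k - j) * (k - j)`!)%N.

Lemma expn_le_deg : (2 * k <= n)%N -> (n ^ (k - j) <= cgeo * D)%N.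
Proof.
move=> kn2; rewrite /cgeo -mulnA [((k - j)`! * _)%N]mulnC bin_ffact.
apply: leq_trans (_ : 2 ^ (k - j) * (n - k) ^ (k - j) <= _)%N.
  by rewrite -expnMn; case: (k - j)%N => // l; rewrite leq_exp2r//; lia.
rewrite leq_mul2l; apply/orP; right.
have -> : (n - k = (n - j) - (k - j))%N by lia.
by apply: ffact_ge.
Qed.

Lemma deg_ksets u : u \in ksets n j -> #|[set K in ksets n k | u \in jsub K]| = D.
Proof.
rewrite inE => /eqP cu; rewrite -[RHS]/('C(n - j, k - j)) -cu -nsupE; last by rewrite cu ltnW.
by apply: eq_card => K; rewrite !inE cu eqxx andbT.
Qed.

Lemma deg_ksets_le u : (#|[set K in ksets n k | u \in jsub K]| <= D)%N.
Proof.
have [uj|uj] := boolP (u \in ksets n j); first by rewrite deg_ksets.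
rewrite (_ : [set _ in _ | _] = set0) ?cards0//; apply/setP => K.
by rewrite !inE; move: uj; rewrite inE => /negbTE ->; rewrite !andbF.
Qed.

Local Notation codeg := (codeg jsub (ksets n k)).

Lemma codeg_nsup u v : u \in ksets n j -> v \in ksets n j -> codeg u v = nsup (u :|: v).
Proof.
rewrite !inE => cu cv; apply: eq_card => K.
by rewrite !inE cu cv !andbT subUset.
Qed.

Lemma codeg_out u v : (u \notin ksets n j) || (v \notin ksets n j) -> codeg u v = 0%N.
Proof.
rewrite !inE => h; apply/eqP; rewrite cards_eq0; apply/eqP/setP => K; rewrite !inE.
by case/orP: h => /negbTE ->; rewrite ?andbF.
Qed.

Lemma codegC u v : codeg u v = codeg v u.
Proof. by apply: eq_card => K; rewrite !inE [X in _ && X]andbC. Qed.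

(** The union of [u] and [v] has [j - #|u :&: v|] vertices more than [u], and each of them costs a
    factor [n] in the number of edges. *)
Lemma codeg_bound u v : u \in ksets n j -> v \in ksets n j -> (0 < n)%N ->
  (codeg u v * n ^ (j - #|u :&: v|) <= n ^ (k - j))%N.
Proof.
move=> uj vj n0; rewrite codeg_nsup//.
have := nsup_bound (u :|: v); move: uj vj; rewrite !inE => /eqP cu /eqP cv.
have ij : (#|u :&: v| <= j)%N by rewrite -cu subset_leq_card// subsetIl.
rewrite cardsU cu cv (_ : j + j - _ = j - #|u :&: v| + j)%N; last lia.
have -> : (n ^ k = n ^ (k - j) * n ^ j)%N by rewrite -expnD subnK// ltnW.
by rewrite expnD mulnA leq_mul2r expn_eq0 eqn0Ngt n0.
Qed.

Lemma codeg_bound1 u v : u != v -> (2 * k <= n)%N -> (codeg u v * n <= cgeo * D)%N.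
Proof.
move=> uv kn2; have n0 : (0 < n)%N by lia.
have [h|] := boolP ((u \notin ksets n j) || (v \notin ksets n j)).
  by rewrite codeg_out.
rewrite negb_or !negbK => /andP[uj vj].
apply: leq_trans (expn_le_deg kn2); apply: leq_trans (codeg_bound uj vj n0).
rewrite leq_mul2l; apply/orP; right; rewrite -{1}[n]expn1 leq_pexp2l// subn_gt0.
move: uj vj uv; rewrite !inE => /eqP cu /eqP cv uv; rewrite ltnNge -{1}cu.
apply: contraNN uv => h; have /eqP uI : u :&: v == u by rewrite eqEcard subsetIl.
by rewrite eqEcard cu cv leqnn andbT -uI subsetIr.
Qed.

(** Two edges with at least [j] common vertices contain a common [j]-set, so sequences of edges and
    walks among [j]-sets reach the same sets. *)
Lemma jcompE H J : J \in ksets n j -> jcomp j H J = cl jsub H [set J].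
Proof.
rewrite inE => cJ; apply/eqP; rewrite eqEsubset; apply/andP; split.
  apply/subsetP => J2; rewrite inE => /andP[cJ2 /orP[/eqP <-|]]; first exact: cl1_id.
  move=> /existsP[E1 /existsP[E2 /and5P[E1H _ JE1 J2E2 /connectP[s]]]].
  have : jsub E1 \subset cl jsub H [set J].
    apply: (@cl_closed _ _ jsub H [set J] E1) => //; apply/touchP; exists J.
      by rewrite mem_jsub JE1 cJ.
    exact: cl1_id.
  elim: s E1 {E1H JE1} => [|F s IH] E1 sub /=.
    by move=> _ e; apply: (subsetP sub); rewrite mem_jsub -e J2E2.
  move=> /andP[/and3P[_ FH jEF] Fs]; apply: IH => //.
  apply: (@cl_closed _ _ jsub H [set J] F) => //.
  have [B BI cB] : exists2 B : {set 'I_n}, B \subset E1 :&: F & #|B| == j.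
    have : (0 < #|[set B : {set 'I_n} | (B \subset E1 :&: F) && (#|B| == j)]|)%N.
      by rewrite cards_draws bin_gt0.
    by rewrite card_gt0 => /set0Pn[B]; rewrite inE => /andP[]; exists B.
  apply/touchP; exists B; first by rewrite mem_jsub cB andbT (subset_trans BI)// subsetIr.
  by apply: (subsetP sub); rewrite mem_jsub cB andbT (subset_trans BI)// subsetIl.
apply: cl_min; first by rewrite sub1set inE cJ /jconn eqxx.
move=> K KH /touchP[u]; rewrite mem_jsub => /andP[uK cu]; rewrite inE cu /= => Ju.
apply/subsetP => v; rewrite mem_jsub inE => /andP[vK ->] /=.
apply/orP; right; case/orP: Ju => [/eqP e|/existsP[E1 /existsP[E2 /and5P[E1H E2H JE1 uE2 c]]]].
  by apply/existsP; exists K; apply/existsP; exists K; rewrite KH e uK vK connect0.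
apply/existsP; exists E1; apply/existsP; exists K; rewrite E1H KH JE1 vK /=.
apply: connect_trans c (connect1 _); rewrite /jadj E2H KH /= -(eqP cu).
by apply: subset_leq_card; rewrite subsetI uE2.
Qed.

Lemma hprobE (R : realType) (p : R) (A : {set {set 'I_n}} -> bool) :
  hprob n k p A = Er p (ksets n k) (fun H => (A H)%:R).
Proof.
rewrite /hprob /Er big_mkcondr card_ksets; apply: eq_bigr => H _.
by case: (A H); rewrite ?mulr1 ?mulr0.
Qed.

End Geometry.

(** * Inequalities behind the degree potential *)

Section NumericInequalities.
Variable R : realType.
Implicit Types t x : R.

(** This and the next two lemmas serve the three cases of [deg_super]: the [j]-set is the target, is
    disjoint from it, or meets it partly. There [t] is [deg_tau] and [x] is the inverse of [m]. *)
Lemma drift_self t : 0 < t -> t <= 16^-1 -> (1 + 2 * t) * (1 + t) <= 4.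
Proof.
by move=> t0 t1; have := ler_pM (ltW t0) (ltW t0) t1 t1; lra.
Qed.

Lemma drift_away t x : 0 < t -> t <= 16^-1 -> 0 < x -> x <= 1 -> (1 + t) * (1 + x * 4^-1) <= 2.
Proof.
move=> t0 t1 x0 x1; have := ler_pM (ltW t0) (ltW x0) t1 x1; lra.
Qed.

Lemma drift_hit x : 0 < x -> x <= 1 ->
  (1 + 2 * (x / 16)) * (x / 8 + (1 + x / 16) * (1 - x * (3 / 4))) <= 1.
Proof.
move=> x0 x1; have x2 : 0 < x * x by rewrite mulr_gt0.
have x3 : 0 < x * x * x by rewrite mulr_gt0.
lra.
Qed.

End NumericInequalities.

(** * No [j]-set gets a large load: weights growing towards a target *)

Section DegreePotential.
Variables (R : realType) (n k j : nat).
Hypotheses (j_gt0 : (0 < j)%N) (jk : (j < k)%N) (kn : (2 * k <= n)%N).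
Implicit Types (u v a : {set 'I_n}) (K : {set 'I_n}).

Local Notation inc := (@jsub n j).
Local Notation U0 := (ksets n k).
Local Notation V0 := (ksets n j).
Let m := ('C(k, j)).-1.
Let D := 'C(n - j, k - j).

Let n_gt0 : (0 < n)%N. Proof. by lia. Qed.
Let k_le_n : (k <= n)%N. Proof. by lia. Qed.
Let D_gt0 : (0 < D)%N. Proof. by rewrite bin_gt0; lia. Qed.
Let m_gt0 : (0 < m)%N. Proof. exact: bin_pred_gt0. Qed.

Lemma cgeo_gt0 : (0 < cgeo k j)%N.
Proof. by rewrite /cgeo muln_gt0 expn_gt0 fact_gt0. Qed.

(** Edges meeting the target outside [u] are classified by at most [2 ^+ j] sets [Y], each
    contributing at most [4 * m * cgeo / spread] in units of [D] times the weight [A ^+ #|u :&: a|];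
    the factor 32 makes the total at most 1/8. *)
Definition spread : R := 32 * m%:R * 2 ^+ j * (cgeo k j)%:R.
Let A : R := n%:R / spread.

Lemma spread_ge1 : 1 <= spread.
Proof.
have h1 : (1 : R) <= (cgeo k j)%:R by rewrite ler1n cgeo_gt0.
have h2 : (1 : R) <= 2 ^+ j by rewrite exprn_ege1// ler1n.
have h3 : (1 : R) <= m%:R by rewrite ler1n.
have h4 : (1 : R) <= 32 * m%:R by lra.
by apply: mulr_ege1 => //; apply: mulr_ege1.
Qed.

Hypothesis A_ge8 : 8 <= A.

(* A found set [u] is the more likely to lead to sets lying in a common edge with [a], the
   larger [u :&: a] is: by a factor of order [n] for every common vertex. *)
Definition hit_weight a u : R := if u == a then 4 * A ^+ j.-1 else A ^+ #|u :&: a|.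

Let A_ge1 : 1 <= A. Proof. by move: A_ge8; lra. Qed.
Let A_ge0 : 0 <= A. Proof. by move: A_ge8; lra. Qed.

Lemma hit_weight_ge0 a u : 0 <= hit_weight a u.
Proof. by rewrite /hit_weight; case: ifP => _; rewrite ?mulr_ge0 ?exprn_ge0. Qed.

Lemma card_jsubD1 K u : K \in U0 -> u \in inc K -> #|inc K :\ u| = m.
Proof.
move=> KU uK; apply/eqP; rewrite -eqSS -(card_jsub jk KU) (cardsD1 u (inc K)) uK.
by [].
Qed.

Lemma meet_lt a u : a \in V0 -> u \in V0 -> u != a -> (#|u :&: a| <= j.-1)%N.
Proof.
rewrite !inE => /eqP ca /eqP cu ua; rewrite -ltnS prednK// ltnNge.
apply: contraNN ua => h; rewrite eqEcard ca cu leqnn andbT.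
have /eqP <- : u :&: a == u by rewrite eqEcard subsetIl cu.
exact: subsetIr.
Qed.

(** If [K] meets [a] only inside [u], no neighbour of [u] in [K] is closer to [a]. If moreover [u]
    meets [a], exchanging a common vertex [x] for a vertex [y] of [K] outside [u] gives a neighbour
    lighter by a factor [A]. This one neighbour replaces [m] by [m - 1], and all contraction comes
    from it. *)
Lemma hit_weight_inside a K u : a \in V0 -> u \in V0 -> u != a ->
  K \in U0 -> u \in inc K -> K :&: a \subset u ->
  \sum_(v in inc K :\ u) hit_weight a v <=
    A ^+ #|u :&: a| * (m%:R - (0 < #|u :&: a|)%N%:R + A^-1).
Proof.
move=> aV uV ua KU uK Kau; set r := #|u :&: a|.
have [ca cu] : #|a| = j /\ #|u| = j by move: aV uV; rewrite !inE => /eqP -> /eqP ->.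
have meet v : v \in inc K -> v :&: a \subset u :&: a.
  rewrite inE => /andP[vK _]; rewrite subsetI subsetIr andbT.
  apply: subset_trans Kau; exact: setSI.
have hw v : v \in inc K -> hit_weight a v = A ^+ #|v :&: a|.
  move=> vK; rewrite /hit_weight; case: eqP => // va.
  have := meet _ vK; rewrite va setIid subsetI => /andP[au _].
  by case/eqP: ua; apply/esym/eqP; rewrite eqEcard au ca cu leqnn.
have hle v : v \in inc K -> hit_weight a v <= A ^+ r.
  by move=> vK; rewrite hw// ler_weXn2l// subset_leq_card// meet.
have cK := card_jsubD1 KU uK.
have [r0|r0] := posnP r.
  rewrite subr0 mulrDr -[leLHS]addr0 lerD ?mulr_ge0 ?invr_ge0 ?exprn_ge0//.
  rewrite mulrC mulr_natl -cK -sumr_const; apply: ler_sum => v /setD1P[_]; exact: hle.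
have /set0Pn[x /setIP[xu xa]] : u :&: a != set0 by rewrite -card_gt0.
have [y yKu] : exists y, y \in K :\: u.
  apply/set0Pn; rewrite -card_gt0 cardsDS; last by move: uK; rewrite inE => /andP[].
  by move: KU; rewrite inE => /eqP ->; rewrite cu subn_gt0.
have [yK yu] := setDP yKu.
pose w := y |: u :\ x.
have wK : w \in inc K :\ u.
  rewrite !inE; apply/and3P; split.
  - by apply: contraNneq yu => <-; rewrite !inE eqxx.
  - rewrite subUset sub1set yK /=; apply: subset_trans (subD1set _ _) _.
    by move: uK; rewrite inE => /andP[].
  - rewrite cardsU1 !inE negb_and yu orbT /= add1n.
    by have := cardsD1 x u; rewrite xu cu add1n => ->.
rewrite (bigD1 w)//=.
have h1 : hit_weight a w <= A ^+ r * A^-1.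
  have /setD1P[_ wK'] := wK; rewrite hw//.
  rewrite -{1}(prednK r0) exprSr mulfK ?gt_eqF ?(lt_le_trans _ A_ge1)//.
  rewrite ler_weXn2l// -ltnS prednK// /r (cardsD1 x (u :&: a)) inE xu xa add1n ltnS.
  apply: subset_leq_card; apply/subsetP => z zwa; rewrite in_setD1.
  rewrite (subsetP (meet _ wK'))// andbT.
  move: zwa; rewrite !inE => /andP[/orP[/eqP zy|/andP[]//] _].
  by apply: contraNneq yu => zx; rewrite -zy zx xu.
have h2 : \sum_(v in inc K :\ u | v != w) hit_weight a v <= A ^+ r * (m%:R - 1).
  apply: (@le_trans _ _ (\sum_(v in (inc K :\ u) :\ w) A ^+ r)).
    rewrite (eq_bigl [in (inc K :\ u) :\ w]) => [|v]; last by rewrite [RHS]in_setD1 andbC.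
    by apply: ler_sum => v /setD1P[_ /setD1P[_]]; exact: hle.
  rewrite sumr_const; have := cardsD1 w (inc K :\ u); rewrite wK cK add1n => mE.
  by rewrite mE -natr1 addrK mulr_natr.
by rewrite (_ : true%:R = 1)//; move: h1 h2; lra.
Qed.

Lemma hit_weight_le a K v : a \in V0 -> v \in inc K -> hit_weight a v <= 4 * A ^+ #|K :&: a|.
Proof.
move=> aV; rewrite inE => /andP[vK cv]; rewrite /hit_weight; case: eqP => va.
  rewrite ler_wpM2l// ler_weXn2l//; apply: leq_trans (leq_pred _) _.
  by rewrite -(eqP cv) va subset_leq_card// subsetI -{1}va vK /=.
apply: (@le_trans _ _ (A ^+ #|K :&: a|)).
  by rewrite ler_weXn2l// subset_leq_card// setSI.
by rewrite ler_peMl ?exprn_ge0// ler1n.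
Qed.

Lemma hit_weight_outside a K u : a \in V0 -> u \in V0 ->
  K \in U0 -> u \in inc K ->
  \sum_(v in inc K :\ u) hit_weight a v <=
    4 * m%:R * A ^+ #|u :&: a| * A ^+ #|(K :&: a) :\: u|.
Proof.
move=> aV uV KU uK; rewrite -mulrA -exprD.
have -> : (#|u :&: a| + #|(K :&: a) :\: u| = #|K :&: a|)%N.
  rewrite -(cardsID u (K :&: a)); congr (_ + _)%N; apply: eq_card => x.
  rewrite !inE; move: uK; rewrite inE => /andP[/subsetP/(_ x) h _].
  by case: (x \in u) h; rewrite ?andbF//= => ->; rewrite ?andbT.
rewrite [4 * _]mulrC -mulrA mulr_natl -(card_jsubD1 KU uK) -sumr_const.
by apply: ler_sum => v /setD1P[_]; apply: hit_weight_le.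
Qed.

(** Each vertex of [Y] costs a factor of order [n] in the number of edges and gains only
    [A = n / spread] in weight; as [Y] is nonempty, at least one factor [spread] is left. *)
Lemma nsup_weight u (Y : {set 'I_n}) : u \in V0 -> [disjoint Y & u] -> Y != set0 ->
  A ^+ #|Y| * (nsup k (u :|: Y))%:R <= (cgeo k j)%:R * D%:R / spread.
Proof.
move=> uV Yu Y0; have s1 := spread_ge1; have s0 : 0 < spread by apply: lt_le_trans s1.
have cu : #|u| = j by move: uV; rewrite inE => /eqP.
have cUY : #|u :|: Y| = (#|Y| + j)%N.
  by rewrite cardsU cu (_ : u :&: Y = set0) ?cards0 ?subn0 1?addnC//; apply/eqP; rewrite setI_eq0 disjoint_sym.
have h : (nsup k (u :|: Y) * n ^ #|Y| <= cgeo k j * D)%N.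
  apply: (@leq_trans (n ^ (k - j))%N); last exact: expn_le_deg.
  have := nsup_bound k (u :|: Y); rewrite cUY.
  have -> : (n ^ k = n ^ (k - j) * n ^ j)%N by rewrite -expnD subnK// ltnW.
  by rewrite expnD mulnA leq_mul2r expn_eq0 eqn0Ngt n_gt0.
have {}h : n%:R ^+ #|Y| * (nsup k (u :|: Y))%:R <= (cgeo k j)%:R * D%:R :> R.
  by rewrite -natrX -!natrM ler_nat mulnC.
rewrite /A expr_div_n; apply: (@le_trans _ _ ((cgeo k j)%:R * D%:R / spread ^+ #|Y|)).
  by rewrite mulrAC ler_wpM2r ?invr_ge0 ?exprn_ge0 ?(ltW s0).
rewrite ler_wpM2l ?mulr_ge0// lef_pV2 ?posrE ?exprn_gt0//.
rewrite -{1}[spread]expr1 ler_weXn2l//.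
by rewrite card_gt0.
Qed.

(** Edges are sorted by [Y = (K :&: a) :\: u]. Those with [Y] empty give the main term and
    [A^-1 <= 1/8], all others together at most another 1/8. *)
Lemma nbr_sum_hit_weight a u : a \in V0 -> u \in V0 -> u != a ->
  nbr_sum inc U0 (hit_weight a) u <=
    D%:R * A ^+ #|u :&: a| * (m%:R - (0 < #|u :&: a|)%N%:R + 4^-1).
Proof.
move=> aV uV ua; set r := #|u :&: a|.
pose e : R := m%:R - (0 < r)%N%:R + A^-1.
have s1 := spread_ge1; have s0 : 0 < spread by apply: lt_le_trans s1.
have Ai : 0 <= A^-1 by rewrite invr_ge0.
have e0 : 0 <= A ^+ r * e.
  rewrite mulr_ge0 ?exprn_ge0// /e addr_ge0// subr_ge0.
  by apply: (@le_trans _ _ 1); [case: (0 < r)%N|rewrite ler1n].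
pose S := [set Y in powerset (a :\: u) | Y != set0].
have dA : #|[set K in U0 | u \in inc K]| = D by apply: deg_ksets.
apply: (@le_trans _ _ (\sum_(K in U0 | u \in inc K)
    (A ^+ r * e + \sum_(Y in S | Y \subset K) 4 * m%:R * A ^+ r * A ^+ #|Y|))).
  have pos K : 0 <= \sum_(Y in S | Y \subset K) 4 * m%:R * A ^+ r * A ^+ #|Y|.
    by apply: sumr_ge0 => Y _; rewrite !mulr_ge0 ?exprn_ge0.
  apply: ler_sum => K /andP[KU uK]; have [Kau|Kau] := boolP (K :&: a \subset u).
    by apply: ler_wpDr; [exact: pos|exact: hit_weight_inside].
  apply: ler_wpDl => //; rewrite [leRHS](bigD1 ((K :&: a) :\: u)) /=; last first.
    apply/andP; split; last exact: subset_trans (subsetDl _ _) (subsetIl _ _).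
    by apply/setIdP; split; [rewrite powersetE setSD ?subsetIr|rewrite setD_eq0].
  apply: ler_wpDr; last exact: hit_weight_outside.
  by apply: sumr_ge0 => Y _; rewrite !mulr_ge0 ?exprn_ge0.
rewrite big_split /=.
have -> : \sum_(K in U0 | u \in inc K) A ^+ r * e = D%:R * (A ^+ r * e).
  rewrite (eq_bigl [in [set K in U0 | u \in inc K]]) => [|K]; last by rewrite [RHS]inE.
  by rewrite sumr_const dA mulr_natl.
have cS : #|S|%:R <= 2 ^+ j :> R.
  rewrite -natrX ler_nat; apply: (@leq_trans #|powerset (a :\: u)|).
    by apply: subset_leq_card; apply/subsetP => Y; rewrite inE => /andP[].
  rewrite card_powerset leq_pexp2l//; move: aV; rewrite inE => /eqP <-.
  by apply: subset_leq_card; apply: subsetDl.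
have outer : \sum_(K in U0 | u \in inc K) \sum_(Y in S | Y \subset K) 4 * m%:R * A ^+ r * A ^+ #|Y|
    <= 2 ^+ j * (4 * m%:R * A ^+ r * ((cgeo k j)%:R * D%:R / spread)).
  rewrite (exchange_big_dep [in S]) /=; last by move=> ? ? _ /andP[].
  set B := 4 * m%:R * A ^+ r * (_ / _).
  have B0 : 0 <= B by rewrite !mulr_ge0 ?exprn_ge0// invr_ge0 ltW.
  apply: (@le_trans _ _ (\sum_(Y in S) B)); last by rewrite sumr_const -[leLHS]mulr_natl ler_wpM2r.
  apply: ler_sum => Y YS; have /setIdP[Ysub Y0] := YS.
  have Yu : [disjoint Y & u].
    by move: Ysub; rewrite powersetE subsetD => /andP[].
  rewrite (eq_bigl [in [set K in U0 | u :|: Y \subset K]]) => [|K]; last first.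
    rewrite YS [RHS]inE mem_jsub subUset; move: uV; rewrite inE => ->.
    by rewrite !andbT /= andbA.
  rewrite sumr_const -/(nsup k (u :|: Y)) -[leLHS]mulr_natr -mulrA ler_wpM2l ?mulr_ge0 ?exprn_ge0//.
  exact: nsup_weight.
apply: le_trans (lerD (lexx _) outer) _.
have -> : 2 ^+ j * (4 * m%:R * A ^+ r * ((cgeo k j)%:R * D%:R / spread)) =
    D%:R * A ^+ r * 8^-1.
  have c0 : (cgeo k j)%:R != 0 :> R by rewrite pnatr_eq0 -lt0n cgeo_gt0.
  have m0 : m%:R != 0 :> R by rewrite pnatr_eq0 -lt0n.
  by rewrite /spread; field; rewrite c0 m0 expf_neq0.
have A8 : A^-1 <= 8^-1 by rewrite lef_pV2 ?posrE// (lt_le_trans _ A_ge1).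
have DA : 0 <= D%:R * A ^+ r by rewrite mulr_ge0 ?exprn_ge0.
have := ler_wpM2l DA A8; rewrite /e; lra.
Qed.

(** The neighbours of the target weigh at most [A ^+ j.-1], so the target itself needs only a
    constant multiple of this. Giving it the weight [4 * A ^+ j.-1] instead of [A ^+ j] keeps the
    largest weight of order [A ^+ j.-1]. *)
Lemma nbr_sum_hit_weight_self a : a \in V0 ->
  nbr_sum inc U0 (hit_weight a) a <= D%:R * (m%:R * A ^+ j.-1).
Proof.
move=> aV; have dA : #|[set K in U0 | a \in inc K]| = D by apply: deg_ksets.
rewrite /nbr_sum (eq_bigl [in [set K in U0 | a \in inc K]]) => [|K]; last by rewrite [RHS]inE.
rewrite mulr_natl -dA -sumr_const; apply: ler_sum => K /setIdP[KU aK].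
rewrite mulr_natl -(card_jsubD1 KU aK) -sumr_const; apply: ler_sum => v /setD1P[va vK].
have vV := subsetP (jsub_sub _ _) _ vK.
by rewrite /hit_weight (negbTE va) ler_weXn2l// meet_lt.
Qed.

Lemma nbr_sumZ (x : R) (h : {set 'I_n} -> R) u :
  nbr_sum inc U0 (fun v => x * h v) u = x * nbr_sum inc U0 h u.
Proof.
by rewrite /nbr_sum mulr_sumr; apply: eq_bigr => K _; rewrite mulr_sumr.
Qed.

(** In units of [w = deg_scale * deg_big / A ^+ j.-1]: [deg_tau] is the one for which [drift_hit]
    holds; [deg_big] makes the gain at [u] at most the weight of [u] divided by [8 * m]; [deg_scale]
    makes the largest weight equal to [deg_tau / m], as [stp_epot] requires; and [deg_cost] is 3,
    more than a [j]-set disjoint from the target can contribute. *)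
Definition deg_tau : R := (16 * m%:R)^-1.
Definition deg_big : R := 8 * m%:R * (cgeo k j)%:R.
Definition deg_scale : R := deg_tau / (4 * m%:R * deg_big).
Definition deg_cost : R := 3 * deg_scale * deg_big / A ^+ j.-1.

Local Notation codeg := (codeg inc U0).
Local Notation load := (load inc U0).

(** Summed over the found sets it is a multiple of the load of [a], minus a cost for each found set.
    The set [a] gains nothing, as [load] omits it. *)
Definition deg_gain a u : R :=
  (if u == a then 0 else deg_scale * n%:R * (codeg u a)%:R / D%:R) - deg_cost.

Variable p : R.
Hypotheses (p_gt0 : 0 < p) (p_le1 : p <= 1) (pmD : p * m%:R * D%:R <= 1 + deg_tau).

Definition deg_future a u : R := p * (deg_scale * deg_big / A ^+ j.-1 * hit_weight a u).

Let mR : 1 <= m%:R :> R. Proof. by rewrite ler1n. Qed.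
Let m0R : 0 < m%:R :> R. Proof. by rewrite ltr0n. Qed.
Let DR : 0 < D%:R :> R. Proof. by rewrite ltr0n. Qed.
Let cR : 1 <= (cgeo k j)%:R :> R. Proof. by rewrite ler1n cgeo_gt0. Qed.
Let tau_gt0 : 0 < deg_tau. Proof. by rewrite invr_gt0 mulr_gt0. Qed.
Let tau_le : deg_tau <= 16^-1.
Proof. rewrite lef_pV2 ?posrE ?mulr_gt0//. by move: mR; lra. Qed.
Let big_ge1 : 1 <= deg_big.
Proof. by apply: mulr_ege1 => //; move: mR; lra. Qed.
Let big_gt0 : 0 < deg_big. Proof. exact: lt_le_trans big_ge1. Qed.
Let scale_gt0 : 0 < deg_scale. Proof. by apply: divr_gt0 => //; apply: mulr_gt0 => //; apply: mulr_gt0. Qed.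
Let A_gt0 : 0 < A. Proof. exact: lt_le_trans A_ge1. Qed.
Let Aj_gt0 : 0 < A ^+ j.-1. Proof. by rewrite exprn_gt0. Qed.
Let w := deg_scale * deg_big / A ^+ j.-1.
Let w_gt0 : 0 < w. Proof. by apply: divr_gt0 => //; apply: mulr_gt0. Qed.
Let cost_ge0 : 0 <= deg_cost.
Proof. by apply/ltW/divr_gt0 => //; apply: mulr_gt0 => //; apply: mulr_gt0. Qed.

Lemma scale_bigE : deg_scale * deg_big = deg_tau / (4 * m%:R).
Proof. by rewrite /deg_scale; field; rewrite !gt_eqF. Qed.

Lemma codeg_hit a u : a \in V0 -> u \in V0 -> u != a ->
  deg_scale * n%:R * (codeg u a)%:R / D%:R <= w * (A ^+ #|u :&: a| / (8 * m%:R)).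
Proof.
move=> aV uV ua; set r := #|u :&: a|.
have rj : (r <= j.-1)%N by apply: meet_lt.
have h : n%:R * (codeg u a)%:R * n%:R ^+ (j.-1 - r) <= (cgeo k j)%:R * D%:R :> R.
  rewrite -natrX -!natrM ler_nat.
  apply: (@leq_trans (n ^ (k - j))%N); last exact: expn_le_deg.
  apply: (@leq_trans (codeg u a * n ^ (j - r))%N); last exact: codeg_bound.
  have -> : (j - r = (j.-1 - r).+1)%N by rewrite -subSn// prednK.
  by rewrite expnS mulnA [(n * codeg _ _)%N]mulnC.
have An : A <= n%:R.
  by rewrite /A ler_pdivrMr ?(lt_le_trans _ spread_ge1)// ler_peMr// spread_ge1.
have Ai : A ^+ (j.-1 - r) <= n%:R ^+ (j.-1 - r) by rewrite lerXn2r ?nnegrE.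
have Aj : A ^+ j.-1 = A ^+ r * A ^+ (j.-1 - r) by rewrite -exprD subnKC.
have Ar : 0 < A ^+ r by rewrite exprn_gt0.
have Ajr : 0 < A ^+ (j.-1 - r) by rewrite exprn_gt0.
have -> : w * (A ^+ r / (8 * m%:R)) = deg_scale * (cgeo k j)%:R / A ^+ (j.-1 - r).
  rewrite /w Aj /deg_big; field; rewrite !gt_eqF//.
have h3 : n%:R * (codeg u a)%:R / D%:R <= (cgeo k j)%:R / A ^+ (j.-1 - r).
  rewrite ler_pdivrMr// mulrAC ler_pdivlMr//; apply: le_trans h.
  by rewrite ler_wpM2l// mulr_ge0.
by have := ler_wpM2l (ltW scale_gt0) h3; rewrite !mulrA.
Qed.

(** For [u = a] the constant 4 in the weight suffices. For [u] disjoint from [a] there is no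
    contraction, but the cost makes the left side negative. Otherwise the weights contract by
    [1 - 3 / (4 * m)], which leaves room for the gain and for the factors in [deg_tau]. *)
Lemma deg_super a u : a \in V0 -> u \in V0 ->
  (1 + 2 * deg_tau) * (deg_gain a u + nbr_sum inc U0 (deg_future a) u) <= w * hit_weight a u.
Proof.
move=> aV uV.
have nE : nbr_sum inc U0 (deg_future a) u = w * (p * nbr_sum inc U0 (hit_weight a) u).
  by rewrite /deg_future !nbr_sumZ -/w; ring.
rewrite nE /deg_gain; have t0 := tau_gt0; have t1 := tau_le.
have costE : deg_cost = 3 * w by rewrite /deg_cost /w; ring.
have [->|ua] := eqVneq u a.
  have h := nbr_sum_hit_weight_self aV.
  have h2 : p * nbr_sum inc U0 (hit_weight a) a <= (1 + deg_tau) * A ^+ j.-1.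
    apply: (@le_trans _ _ (p * m%:R * D%:R * A ^+ j.-1)).
      by rewrite -!mulrA ler_wpM2l ?(ltW p_gt0)// mulrCA.
    by rewrite ler_wpM2r// ltW.
  rewrite /hit_weight eqxx.
  apply: (@le_trans _ _ ((1 + 2 * deg_tau) * (w * ((1 + deg_tau) * A ^+ j.-1)))).
    rewrite ler_wpM2l//; first by lra.
    by have := ler_wpM2l (ltW w_gt0) h2; move: cost_ge0; lra.
  by rewrite mulrCA ler_wpM2l ?(ltW w_gt0)// mulrA ler_wpM2r ?(ltW Aj_gt0)// drift_self.
have := codeg_hit aV uV ua; have := nbr_sum_hit_weight aV uV ua.
rewrite /hit_weight (negbTE ua); set r := #|u :&: a|.
set S := nbr_sum _ _ _ _; set f := deg_scale * _ * _ / _ => hS hf.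
have Ar : 0 < A ^+ r by rewrite exprn_gt0.
have m1 : m%:R * m%:R^-1 = 1 :> R by rewrite divff// gt_eqF.
have tauE : deg_tau = m%:R^-1 / 16 by rewrite /deg_tau invfM mulrC.
have mi0 : 0 < m%:R^-1 :> R by rewrite invr_gt0.
have mi1 : m%:R^-1 <= 1 :> R by rewrite invf_le1.
have pS (x : R) : 0 <= x -> S <= D%:R * A ^+ r * x ->
    p * S <= (1 + deg_tau) * m%:R^-1 * x * A ^+ r.
  move=> x0 Sx; apply: (@le_trans _ _ ((p * m%:R * D%:R) * (m%:R^-1 * x * A ^+ r))).
    rewrite (_ : p * m%:R * D%:R * _ = p * (D%:R * A ^+ r * x)); last first.
      by field; rewrite gt_eqF.
    by rewrite ler_wpM2l// ltW.
  have mx0 : 0 <= m%:R^-1 * x * A ^+ r.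
    by apply: mulr_ge0; [apply: mulr_ge0 => //; exact: ltW|exact: ltW].
  by have := ler_wpM2r mx0 pmD; rewrite !mulrA.
have f8 : f <= w * (A ^+ r * (m%:R^-1 / 8)).
  by apply: le_trans hf _; rewrite invfM [8^-1 * _]mulrC.
have [r0|r0] := posnP r.
  have h : p * S <= (1 + deg_tau) * m%:R^-1 * (m%:R + 4^-1) * A ^+ r.
    by apply: pS; [rewrite addr_ge0|move: hS; rewrite r0 subr0].
  move: f8 h; rewrite r0 !expr0 !mulr1 mul1r => f8 h.
  have h2 : p * S <= 2.
    apply: le_trans h _; rewrite -mulrA mulrDr [m%:R^-1 * _]mulrC m1.
    exact: drift_away.
  apply: (@le_trans _ _ 0); last exact: ltW.
  rewrite mulr_ge0_le0//; first by lra.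
  have := ler_wpM2l (ltW w_gt0) h2; rewrite costE.
  have : w * (m%:R^-1 / 8) <= w * 1 by rewrite ler_wpM2l ?(ltW w_gt0)//; lra.
  lra.
have h : p * S <= (1 + deg_tau) * m%:R^-1 * (m%:R - 1 + 4^-1) * A ^+ r.
  by apply: pS; [move: mR; lra|move: hS; rewrite r0].
apply: (@le_trans _ _ ((1 + 2 * deg_tau) * (w * (A ^+ r * (m%:R^-1 / 8)) +
   w * ((1 + deg_tau) * m%:R^-1 * (m%:R - 1 + 4^-1) * A ^+ r)))).
  rewrite ler_wpM2l//; first by lra.
  by have := ler_wpM2l (ltW w_gt0) h; move: cost_ge0; lra.
rewrite -mulrDr mulrCA ler_wpM2l ?(ltW w_gt0)//.
rewrite (_ : _ * (_ + _) = ((1 + 2 * deg_tau) * (m%:R^-1 / 8 + (1 + deg_tau) * (1 - m%:R^-1 * (3 / 4)))) * A ^+ r); last first.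
  rewrite -(_ : m%:R * m%:R^-1 - m%:R^-1 * (3 / 4) = 1 - m%:R^-1 * (3 / 4)) ?m1//; field.
  by rewrite gt_eqF.
by rewrite ler_piMl ?(ltW Ar)// tauE drift_hit.
Qed.

Implicit Types (L M : R) (F U W : {set {set 'I_n}}).

Let p01 : 0 <= p <= 1. Proof. by rewrite ltW. Qed.

Lemma hit_weight_bound a u : a \in V0 -> u \in V0 -> hit_weight a u <= 4 * A ^+ j.-1.
Proof.
move=> aV uV; rewrite /hit_weight; case: eqVneq => // ua.
apply: (@le_trans _ _ (A ^+ j.-1)); first by rewrite ler_weXn2l// meet_lt.
by rewrite ler_peMl ?(ltW Aj_gt0)// ler1n.
Qed.

Lemma deg_future_le a u : a \in V0 -> u \in V0 -> deg_future a u <= p * (deg_tau / m%:R).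
Proof.
move=> aV uV; rewrite ler_wpM2l ?(ltW p_gt0)//.
apply: (@le_trans _ _ (w * (4 * A ^+ j.-1))); first by rewrite ler_wpM2l ?hit_weight_bound// ltW.
by rewrite /w scale_bigE le_eqVlt; apply/orP; left; apply/eqP; field; rewrite !gt_eqF.
Qed.

Lemma deg_future_ge0 a u : 0 <= deg_future a u.
Proof.
apply: mulr_ge0; first exact: ltW.
by apply: mulr_ge0; [exact: ltW|exact: hit_weight_ge0].
Qed.

(** The union bound over the targets [a]. The second factor normalises the term of [a] to be at
    least 1 once its load exceeds [L] with at most [M + m] sets found. *)
Definition degpot (L M : R) (U : {set {set 'I_n}}) F : R :=
  \sum_(a in V0) epot inc (deg_gain a) (deg_future a) U F *
    expR (- (deg_scale * n%:R * L / D%:R - deg_cost * (M + m%:R))).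

Lemma degpot_ge0 L M U F : 0 <= degpot L M U F.
Proof. by apply: sumr_ge0 => a _; apply: mulr_ge0; exact: expR_ge0. Qed.

Lemma stp_degpot L M W U F K : state inc U0 V0 W U F -> K \in active inc U F ->
  stp inc p (degpot L M) U F K <= degpot L M U F.
Proof.
move=> s Ka; rewrite /stp /degpot !mulr_sumr -big_split /=; apply: ler_sum => a aV.
rewrite !mulrA -mulrDl ler_wpM2r ?expR_ge0//.
have sup u : u \in V0 -> p * (1 + 2 * deg_tau) * (deg_gain a u + nbr_sum inc U0 (deg_future a) u)
    <= deg_future a u.
  by move=> uV; rewrite -mulrA ler_wpM2l ?(ltW p_gt0)// deg_super.
have cap u : u \in V0 -> deg_gain a u + nbr_sum inc U0 (deg_future a) u <= deg_tau / m%:R.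
  move=> uV; set x := _ + _.
  have [x0|x0] := leP x 0; first by apply: le_trans x0 _; rewrite divr_ge0 ?ltW.
  have h : p * x <= p * (deg_tau / m%:R).
    apply: le_trans (deg_future_le aV uV); apply: le_trans (sup u uV).
    rewrite -/x -mulrA ler_wpM2l ?(ltW p_gt0)// ler_peMl ?(ltW x0)//.
    by rewrite lerDl mulr_ge0// ltW.
  by move: h; rewrite ler_pM2l.
have t2 : 0 <= deg_tau <= 2^-1 by rewrite ltW//=; move: tau_le; lra.
apply: (stp_epot p01 (card_jsub jk) _ (deg_future_ge0 a) t2 cap sup s Ka).
by move=> ? _; exact: jsub_sub.
Qed.

Lemma degpot_bad L M F U a : F \subset V0 -> #|F|%:R <= M + m%:R -> a \in V0 ->
  L < (load F a)%:R -> 1 <= degpot L M U F.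
Proof.
move=> FV FM aV La.
have L0 : 0 <= Lam inc (deg_future a) U F.
  by apply: sumr_ge0 => K _; apply: sumr_ge0 => u _; apply: deg_future_ge0.
have gainE : \sum_(v in F) deg_gain a v =
    deg_scale * n%:R * (load F a)%:R / D%:R - deg_cost * #|F|%:R.
  rewrite sumrB sumr_const; congr (_ - _); last by rewrite mulr_natr.
  rewrite /load natr_sum mulr_sumr mulr_suml [RHS]big_mkcond [LHS]big_mkcond /=.
  apply: eq_bigr => v _; rewrite in_setD1; case: (v \in F); rewrite ?andbF ?andbT//.
  by case: eqVneq => //= _; rewrite codegC.
have h : deg_scale * n%:R * L / D%:R <= deg_scale * n%:R * (load F a)%:R / D%:R.
  by rewrite ler_wpM2r ?invr_ge0// ler_wpM2l ?(ltW La)// mulr_ge0// ltW.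
have ex0 : 0 <= \sum_(v in F) deg_gain a v + Lam inc (deg_future a) U F +
    - (deg_scale * n%:R * L / D%:R - deg_cost * (M + m%:R)).
  by rewrite gainE; have := ler_wpM2l cost_ge0 FM; lra.
apply: (@le_trans _ _ (epot inc (deg_gain a) (deg_future a) U F *
    expR (- (deg_scale * n%:R * L / D%:R - deg_cost * (M + m%:R))))).
  by rewrite /epot -expRD -[leLHS]expR0 ler_expR.
rewrite /degpot [leRHS](bigD1 a)//= lerDl.
by apply: sumr_ge0 => v _; apply: mulr_ge0; exact: expR_ge0.
Qed.

Lemma degpot_init L M v : v \in V0 ->
  degpot L M U0 [set v] <=
    #|V0|%:R * expR (1 - (deg_scale * n%:R * L / D%:R - deg_cost * (M + m%:R))).
Proof.
move=> vV; rewrite mulr_natl -sumr_const; apply: ler_sum => a aV.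
rewrite -expRD ler_expR lerD2r big_set1.
have dv : #|[set K in U0 | v \in inc K]| = D by apply: deg_ksets.
have t16 := tau_le; have t0 := tau_gt0.
have mi1 : m%:R^-1 <= 1 :> R by rewrite invf_le1.
have hL : Lam inc (deg_future a) U0 [set v] <= (1 + deg_tau) * deg_tau.
  apply: (@le_trans _ _ (D%:R * (m%:R * (p * (deg_tau / m%:R))))).
    rewrite mulr_natl -dv -sumr_const.
    rewrite /Lam (eq_bigl [in [set K in U0 | v \in inc K]]) => [|K]; last by rewrite [LHS]in_set [RHS]in_set touch1.
    apply: ler_sum => K /setIdP[KU vK]; rewrite mulr_natl -[X in _ *+ X](card_jsubD1 KU vK) -sumr_const.
    apply: ler_sum => u /setD1P[_ uK]; apply: deg_future_le => //.
    exact: subsetP (jsub_sub _ _) _ uK.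
  have -> : D%:R * (m%:R * (p * (deg_tau / m%:R))) = (p * m%:R * D%:R) * (deg_tau * m%:R^-1) by ring.
  have h : deg_tau * m%:R^-1 <= deg_tau * 1 by rewrite ler_wpM2l// ltW.
  apply: (@le_trans _ _ ((1 + deg_tau) * (deg_tau * m%:R^-1))).
    by rewrite ler_wpM2r// mulr_ge0 ?invr_ge0// ltW.
  by rewrite ler_wpM2l; [|lra|lra].
have hg : deg_gain a v <= deg_tau.
  rewrite /deg_gain; apply: (@le_trans _ _ (w * A ^+ j.-1)); last first.
    rewrite divfK ?gt_eqF// scale_bigE ler_pdivrMr ?mulr_gt0//.
    by rewrite ler_peMr ?(ltW t0)//; move: mR; lra.
  have wA : 0 <= w * A ^+ j.-1 by rewrite mulr_ge0 ?ltW.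
  case: eqVneq => va; first by move: cost_ge0 wA; lra.
  have := codeg_hit aV vV va => h.
  have h2 : w * (A ^+ #|v :&: a| / (8 * m%:R)) <= w * A ^+ j.-1.
    rewrite ler_wpM2l ?(ltW w_gt0)// ler_pdivrMr ?mulr_gt0//.
    apply: (@le_trans _ _ (A ^+ j.-1)); first by rewrite ler_weXn2l// meet_lt.
    by rewrite ler_peMr ?(ltW Aj_gt0)//; move: mR; lra.
  by move: cost_ge0 h h2; lra.
have := ler_pM (ltW t0) (ltW t0) t16 t16; move: hL hg; lra.
Qed.

End DegreePotential.

(** * Mixing of the exploration by changing one vertex at a time *)

Section Mixing.
Variables (R : realType) (n k j : nat).
Hypotheses (j_gt0 : (0 < j)%N) (jk : (j < k)%N) (kn : (2 * k <= n)%N).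
Implicit Types (u v t : {set 'I_n}) (K : {set 'I_n}).

Local Notation inc := (@jsub n j).
Local Notation U0 := (ksets n k).
Local Notation V0 := (ksets n j).
Let m := ('C(k, j)).-1.
Let D := 'C(n - j, k - j).

Let n_gt0 : (0 < n)%N. Proof. by lia. Qed.
Let k_le_n : (k <= n)%N. Proof. by lia. Qed.
Let D_gt0 : (0 < D)%N. Proof. by rewrite bin_gt0; lia. Qed.
Let m_gt0 : (0 < m)%N. Proof. exact: bin_pred_gt0. Qed.
Let nR : 0 < n%:R :> R. Proof. by rewrite ltr0n. Qed.
Let mR : 0 < m%:R :> R. Proof. by rewrite ltr0n. Qed.
Let DR : 0 < D%:R :> R. Proof. by rewrite ltr0n. Qed.

Lemma nbr_sum_cst u : u \in V0 -> nbr_sum inc U0 (fun=> 1 : R) u = D%:R * m%:R.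
Proof.
move=> uV; have dv : #|[set K in U0 | u \in inc K]| = D by apply: deg_ksets.
rewrite /nbr_sum (eq_bigl [in [set K in U0 | u \in inc K]]) => [|K]; last by rewrite [RHS]in_set.
rewrite (eq_bigr (fun=> m%:R)) => [|K /setIdP[KU uK]]; last by rewrite sumr_const (card_jsubD1 jk KU uK).
by rewrite sumr_const dv mulr_natl.
Qed.

Lemma card_far u l : u \in V0 -> (#|[set t in V0 | #|t :\: u| == l]| <= 2 ^ j * n ^ l)%N.
Proof.
rewrite inE => /eqP cu; set S := [set t in V0 | _].
pose f t := (t :&: u, t :\: u).
rewrite -(card_in_imset (f := f) (D := S)); last first.
  by move=> t t' _ _ [e1 e2]; rewrite -(setID t u) e1 e2 setID.
apply: (@leq_trans #|setX (powerset u) (ksets n l)|).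
  apply: subset_leq_card; apply/subsetP => _ /imsetP[t /setIdP[_ tl] ->].
  by rewrite in_setX powersetE subsetIr mem_ksets.
by rewrite cardsX card_powerset cu card_ksets leq_mul2l bin_le_expn orbT.
Qed.

Variables (w : {set 'I_n} -> R) (L : R).
Hypotheses (w_ge0 : forall u, 0 <= w u) (w_le : forall u, u \in V0 -> w u <= L).

(* Up to a constant, the mean of [w] over the [j]-sets differing from [u] in [l] vertices.  The
   mean of [far_mean l] over the neighbours of [u] is at least a multiple of [far_mean l.+1 u],
   and together the [far_mean l u] dominate the mean of [w] over all [j]-sets: the exploration
   forgets where it started. *)
Definition far_mean l u : R := \sum_(t in V0 | #|t :\: u| == l) w t / n%:R ^+ l.

Lemma far_mean_ge0 l u : 0 <= far_mean l u.
Proof. by apply: sumr_ge0 => t _; rewrite divr_ge0// exprn_ge0. Qed.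

Lemma far_mean_le l u : u \in V0 -> far_mean l u <= 2 ^+ j * L.
Proof.
move=> uV; have nl : 0 < n%:R ^+ l :> R by rewrite exprn_gt0.
have L0 : 0 <= L by apply: le_trans (w_le uV).
apply: (@le_trans _ _ (\sum_(t in [set t in V0 | #|t :\: u| == l]) (L / n%:R ^+ l))).
  rewrite /far_mean [leRHS](eq_bigl (fun t => (t \in V0) && (#|t :\: u| == l))) => [|t]; last by rewrite [LHS]in_set.
  by apply: ler_sum => t /andP[tV _]; rewrite ler_wpM2r ?invr_ge0 ?(ltW nl)// w_le.
rewrite sumr_const -[leLHS]mulr_natl mulrCA [leRHS]mulrC ler_wpM2l// ler_pdivrMr//.
by rewrite -!natrX -natrM ler_nat card_far.
Qed.

Lemma far_mean0 u : u \in V0 -> far_mean 0 u = w u.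
Proof.
move=> uV; rewrite /far_mean (big_pred1 u) => [|t]; first by rewrite expr0 divr1.
apply/andP/eqP => [[tV]|->]; last by rewrite setDv cards0.
rewrite cards_eq0 setD_eq0 => tu; apply/eqP; rewrite eqEcard tu.
by move: tV uV; rewrite !inE => /eqP -> /eqP ->; rewrite leqnn.
Qed.

Lemma far_mean_sum u : u \in V0 -> (\sum_(t in V0) w t) / n%:R ^+ j <= \sum_(l < j.+1) far_mean l u.
Proof.
move=> uV; rewrite mulr_suml /far_mean (exchange_big_dep [in V0])/=; last by move=> ? ? _ /andP[].
apply: ler_sum => t tV.
have tj : (#|t :\: u| < j.+1)%N.
  by rewrite ltnS; move: tV; rewrite inE => /eqP <-; apply: subset_leq_card; exact: subsetDl.
rewrite (bigD1 (Ordinal tj)) /=; last by rewrite tV eqxx.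
apply: ler_wpDr; first by apply: sumr_ge0 => l _; rewrite divr_ge0// exprn_ge0.
rewrite ler_wpM2l// lef_pV2 ?posrE ?exprn_gt0// ler_weXn2l// ler1n//.
Qed.

Lemma nsup_step u y : u \in V0 -> y \notin u -> (D <= nsup k (y |: u) * n)%N.
Proof.
rewrite inE => /eqP cu yu; rewrite nsupE; last by rewrite cardsU1 yu cu.
rewrite cardsU1 yu cu add1n.
have := mul_bin_diag (n - j).-1.+1 (k - j).-1; rewrite /=.
have e1 : ((n - j).-1.+1 = n - j)%N by rewrite prednK// subn_gt0; lia.
have e2 : ((k - j).-1.+1 = k - j)%N by rewrite prednK// subn_gt0.
rewrite e1 e2 -!subnS => e.
apply: (@leq_trans ((k - j) * D)); first by rewrite leq_pmull// subn_gt0.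
by rewrite /D -e mulnC leq_mul2l leq_subr orbT.
Qed.

(** If [t] differs from [u] in [l.+1] vertices, exchanging some [x] of [u] outside [t] for some [y]
    of [t] outside [u] gives a neighbour differing in [l] vertices. At least [D / n] edges contain
    [u] and [y], and this [n] is the one by which the normalisations differ. *)
Lemma nbr_sum_far_mean l u : u \in V0 ->
  D%:R * far_mean l.+1 u <= nbr_sum inc U0 (far_mean l) u.
Proof.
move=> uV; have cu : #|u| = j by move: uV; rewrite inE => /eqP.
pose c i t v : R := if #|t :\: v| == i then w t / n%:R ^+ i else 0.
have c0 i t v : 0 <= c i t v by rewrite /c; case: ifP => // _; rewrite divr_ge0// exprn_ge0.
have fE i v : far_mean i v = \sum_(t in V0) c i t v by rewrite /far_mean big_mkcondr.
have -> : nbr_sum inc U0 (far_mean l) u =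
    \sum_(t in V0) \sum_(K in U0 | u \in inc K) \sum_(v in inc K :\ u) c l t v.
  rewrite [RHS]exchange_big; apply: eq_bigr => K _; rewrite [RHS]exchange_big.
  by apply: eq_bigr => v _; rewrite fE.
rewrite fE mulr_sumr; apply: ler_sum => t tV; rewrite {1}/c.
have s0 : 0 <= \sum_(K in U0 | u \in inc K) \sum_(v in inc K :\ u) c l t v.
  by apply: sumr_ge0 => K _; apply: sumr_ge0 => v _.
case: ifP => [/eqP tu|_]; last by rewrite mulr0.
have ct : #|t| = j by move: tV; rewrite inE => /eqP.
have /set0Pn[y /setDP[yt yu]] : t :\: u != set0 by rewrite -card_gt0 tu.
have /set0Pn[x /setDP[xu xt]] : u :\: t != set0.
  rewrite -card_gt0; have := cardsID t u; have := cardsID u t.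
  by rewrite [u :&: t]setIC tu ct cu => <-; lia.
pose v := y |: u :\ x.
have xy : x != y by apply: contraNneq xt => ->.
have cv : #|v| = j.
  rewrite cardsU1 !inE negb_and yu orbT add1n.
  by have := cardsD1 x u; rewrite xu cu add1n => ->.
have tv : #|t :\: v| = l.
  apply/eqP; rewrite -eqSS -tu (cardsD1 y (t :\: u)) inE yt yu add1n eqSS; apply/eqP.
  apply: eq_card => z; rewrite !inE; have [->|zy] //= := eqVneq z y.
  by rewrite negb_and negbK; have [->|zx] //= := eqVneq z x; rewrite (negbTE xt) !andbF.
have vu : v != u by apply: contraNneq yu => <-; rewrite !inE eqxx.
apply: (@le_trans _ _ (\sum_(K in [set K in U0 | y |: u \subset K]) w t / n%:R ^+ l)).
  rewrite sumr_const -/(nsup k (y |: u)) -[leRHS]mulr_natl exprSr.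
  rewrite (_ : D%:R * _ = D%:R / n%:R * (w t / n%:R ^+ l)); last first.
    by field; rewrite expf_neq0 gt_eqF.
  rewrite ler_wpM2r ?divr_ge0 ?exprn_ge0// ler_pdivrMr// -natrM ler_nat.
  exact: nsup_step.
rewrite big_mkcond [leRHS]big_mkcond /=; apply: ler_sum => K _.
rewrite in_set; case: ifP => [/andP[KU]|_]; last by case: ifP => // _; apply: sumr_ge0.
rewrite subUset sub1set => /andP[yK uK].
rewrite KU mem_jsub uK cu eqxx /= (bigD1 v) /=; last first.
  rewrite in_setD1 vu mem_jsub cv eqxx andbT subUset sub1set yK /=.
  exact: subset_trans (subD1set _ _) uK.
by rewrite {1}/c tv eqxx lerDl; apply: sumr_ge0.
Qed.

Variable c : R.
Hypothesis c01 : 0 <= c <= 1.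

(** The ratio [c / 2] is half of what one step of the exploration passes on, so that after a step
    every [far_mean] is present with at least twice its coefficient; the initial 1/2 does the same
    for [l = 0], which is fed by [w u]. *)
Definition far_coef l : R := 2^-1 * (c / 2) ^+ l.

Definition far_value u : R := \sum_(l < j.+1) far_coef l * far_mean l u.

Lemma far_coef_ge0 l : 0 <= far_coef l.
Proof. by move: c01 => /andP[c0 _]; rewrite mulr_ge0 ?invr_ge0// exprn_ge0// divr_ge0. Qed.

Lemma far_coef_dec l i : (l <= i)%N -> far_coef i <= far_coef l.
Proof.
move: c01 => /andP[c0 c1] li; rewrite ler_wpM2l ?invr_ge0// ler_wiXn2l ?divr_ge0//; lra.
Qed.

Lemma far_value_ge0 u : 0 <= far_value u.
Proof. by apply: sumr_ge0 => l _; rewrite mulr_ge0 ?far_coef_ge0 ?far_mean_ge0. Qed.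

Lemma far_value_le u : u \in V0 -> far_value u <= j.+1%:R * 2 ^+ j * L.
Proof.
move=> uV; rewrite -mulrA mulr_natl -[X in _ *+ X]card_ord -sumr_const.
apply: ler_sum => l _; apply: le_trans (far_mean_le l uV).
rewrite ler_piMl ?far_mean_ge0//; apply: le_trans (far_coef_dec (leq0n _)) _.
by rewrite /far_coef expr0; lra.
Qed.

(** By the choice of coefficients [w u + p * nbr_sum far_value u] is at least twice [far_value u].
    Of the surplus, the smallest coefficient times the mean of [w] is kept: a lower bound that does
    not depend on [u]. *)
Lemma far_value_drift (p : R) u : u \in V0 -> 0 <= p -> c <= p * D%:R ->
  far_coef j * ((\sum_(t in V0) w t) / n%:R ^+ j) <=
    w u + p * nbr_sum inc U0 far_value u - far_value u.
Proof.
move=> uV p0 cpD; have [c0 c1] := andP c01.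
have nE : nbr_sum inc U0 far_value u = \sum_(l < j.+1) far_coef l * nbr_sum inc U0 (far_mean l) u.
  rewrite /nbr_sum; under [RHS]eq_bigr do rewrite mulr_sumr.
  rewrite [RHS]exchange_big; apply: eq_bigr => K _; under [RHS]eq_bigr do rewrite mulr_sumr.
  by rewrite [RHS]exchange_big; apply: eq_bigr.
have h1 : \sum_(l < j.+1) 2 * far_coef l.+1 * far_mean l.+1 u <= p * nbr_sum inc U0 far_value u.
  rewrite nE mulr_sumr; apply: ler_sum => l _.
  have -> : 2 * far_coef l.+1 = far_coef l * c by rewrite /far_coef exprSr; field.
  rewrite mulrCA -mulrA ler_wpM2l ?far_coef_ge0//.
  apply: (@le_trans _ _ (p * (D%:R * far_mean l.+1 u))).
    by rewrite mulrA ler_wpM2r ?far_mean_ge0.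
  by rewrite ler_wpM2l// nbr_sum_far_mean.
have h2 : \sum_(l < j.+1) 2 * far_coef l * far_mean l u <= w u + p * nbr_sum inc U0 far_value u.
  rewrite big_ord_recl /=; apply: lerD.
    by rewrite far_mean0// /far_coef expr0; lra.
  apply: le_trans h1; rewrite [leRHS]big_ord_recr /=; apply: ler_wpDr => //.
  apply: mulr_ge0; last exact: far_mean_ge0.
  by apply: mulr_ge0 => //; exact: far_coef_ge0.
have h3 : far_coef j * \sum_(l < j.+1) far_mean l u <= far_value u.
  rewrite mulr_sumr; apply: ler_sum => l _.
  by rewrite ler_wpM2r ?far_mean_ge0// far_coef_dec// -ltnS.
have h4 := ler_wpM2l (far_coef_ge0 j) (far_mean_sum uV).
have h5 : \sum_(l < j.+1) 2 * far_coef l * far_mean l u = 2 * far_value u.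
  by rewrite /far_value mulr_sumr; apply: eq_bigr => l _; rewrite mulrA.
by move: h2; rewrite h5; lra.
Qed.

End Mixing.

(** * The second exploration collects its share of the load of the first *)

Section SecondExploration.
Variables (R : realType) (n k j : nat).
Hypotheses (j_gt0 : (0 < j)%N) (jk : (j < k)%N) (kn : (2 * k <= n)%N).

Local Notation inc := (@jsub n j).
Local Notation U0 := (ksets n k).
Local Notation V0 := (ksets n j).
Local Notation load := (load inc U0).
Let m := ('C(k, j)).-1.
Let D := 'C(n - j, k - j).

Let n_gt0 : (0 < n)%N. Proof. by lia. Qed.
Let D_gt0 : (0 < D)%N. Proof. by rewrite bin_gt0; lia. Qed.
Let m_gt0 : (0 < m)%N. Proof. exact: bin_pred_gt0. Qed.

Lemma sum_load (F : {set {set 'I_n}}) : F \subset V0 ->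
  (\sum_(u in V0) load F u = #|F| * (m * D))%N.
Proof.
move=> /subsetP FV.
rewrite -sum_nat_const /load.
rewrite (exchange_big_dep [in F]) /=; last by move=> ? ? _ /setD1P[].
apply: eq_bigr => v vF; have vV := FV _ vF.
have dv : #|[set K in U0 | v \in inc K]| = D by apply: deg_ksets.
rewrite (eq_bigl [in V0 :\ v]) => [|u]; last by rewrite !in_setD1 vF andbT andbC eq_sym.
rewrite (eq_bigr (fun u => codeg inc U0 v u)) => [|u _]; last exact: codegC.
rewrite -/(load V0 v) loadE.
rewrite (eq_bigl [in [set K in U0 | v \in inc K]]) => [|K]; last by rewrite [RHS]in_set.
rewrite (eq_bigr (fun=> m)) => [|K /setIdP[KU vK]]; last first.
  rewrite /m -(card_jsubD1 jk KU vK); apply: eq_card => u; rewrite !in_setI in_setD1.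
  rewrite in_setD1 andbC -andbA; case: (boolP (u \in inc K)) => [uK|]; rewrite ?andbF// !andbT.
  by rewrite (subsetP (jsub_sub _ _) _ uK) andbT.
by rewrite sum_nat_const dv mulnC.
Qed.

(** Here [(2 * m)^-1] is a lower bound for [p * D]. In units of [mix_scale], [mix_const] bounds the
    increments of the potential, and [mix_scale] is chosen so that [8 * m * mix_scale * mix_const ^+
    2 = mix_coef]: the second-order error is then a quarter of the drift. *)
Definition mix_coef : R := far_coef (2 * m%:R)^-1 j.
Definition mix_const (Q : R) : R := Q * (1 + 2 * (j.+1%:R * 2 ^+ j)) + 1.
Definition mix_scale (Q : R) : R := mix_coef / (8 * m%:R * mix_const Q ^+ 2).

Let mR : 1 <= m%:R :> R. Proof. by rewrite ler1n. Qed.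
Let m0R : 0 < m%:R :> R. Proof. by rewrite ltr0n. Qed.
Let DR : 0 < D%:R :> R. Proof. by rewrite ltr0n. Qed.
Let nR : 0 < n%:R :> R. Proof. by rewrite ltr0n. Qed.
Let c01 : 0 <= ((2 * m%:R)^-1 : R) <= 1.
Proof.
rewrite invr_ge0 mulr_ge0//= invf_le1 ?mulr_gt0//.
by move: mR; lra.
Qed.

Lemma mix_coef_gt0 : 0 < mix_coef.
Proof. by rewrite mulr_gt0 ?invr_gt0// exprn_gt0// divr_gt0// invr_gt0 mulr_gt0. Qed.

Lemma mix_coef_le : mix_coef <= 2^-1.
Proof.
have h : far_coef (2 * m%:R)^-1 j <= far_coef (2 * m%:R)^-1 0 :> R by apply: far_coef_dec.
by move: h; rewrite /mix_coef {2}/far_coef expr0 mulr1.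
Qed.

Lemma mix_const_ge1 (Q : R) : 0 <= Q -> 1 <= mix_const Q.
Proof.
by move=> Q0; rewrite /mix_const -[leLHS]add0r lerD2r mulr_ge0.
Qed.

Lemma mix_scale_gt0 (Q : R) : 0 <= Q -> 0 < mix_scale Q.
Proof.
move=> Q0; have := mix_const_ge1 Q0 => c1.
apply: divr_gt0; first exact: mix_coef_gt0.
by apply: mulr_gt0; [exact: mulr_gt0|rewrite exprn_gt0// (lt_le_trans _ c1)].
Qed.

(** An application of [Er_avoids_le] with weight [w], the load with respect to [F1]. Its total over
    all [j]-sets is [#|F1| * (m * D)], so by mixing the drift is at least [a * W] wherever the
    exploration is. The constant [Q] compares the largest load with this mean. *)
Lemma Er_avoids_mixing (p p2 zeta mu M L Q e b : R) (F1 : {set {set 'I_n}})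
    (U : {set {set 'I_n}}) (v : {set 'I_n}) :
  0 < p -> p <= 1 -> 0 <= p2 <= 1 -> 0 < zeta -> 0 <= mu ->
  expR (- mu) <= 1 - p + p * expR (- (m%:R * (zeta + mu * D%:R))) ->
  0 < M -> F1 \subset V0 -> M <= #|F1|%:R ->
  (forall u, u \in V0 -> (load F1 u)%:R <= L) ->
  0 <= Q -> L <= Q * (M * m%:R * D%:R / n%:R ^+ j) -> 0 <= e <= 1 ->
  p * m%:R * D%:R <= 1 + e -> 2^-1 <= p * m%:R * D%:R ->
  e * (Q * (j.+1%:R * 2 ^+ j)) <= mix_coef / 2 -> 0 <= b ->
  (forall l, mix_coef / 8 * M * (M * m%:R * D%:R / n%:R ^+ j) <= (m.+1 ^ 2 * l)%:R ->
     (1 - p2) ^+ l <= b) ->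
  U \subset U0 -> v \in V0 ->
  Er p U (avoids inc U0 M p2 F1 ^~ [set v]) <=
    expR (1 - mix_scale Q * mix_coef / 8 * M) +
    b * ((zeta + mu * D%:R) / (1 - expR (- (zeta * M)))).
Proof.
move=> p0 p1 p201 z0 mu0 Hmu M0 FV FM hL Q0 LQ /andP[e0 e1] pmD pmD2 eQ b0 hb UU vV.
set W := M * m%:R * D%:R / n%:R ^+ j in LQ hb.
have W0 : 0 < W by rewrite divr_gt0 ?exprn_gt0// !mulr_gt0.
set CG : R := j.+1%:R * 2 ^+ j in eQ *.
have CG0 : 0 <= CG by rewrite mulr_ge0// exprn_ge0.
have L0 : 0 <= L by apply: le_trans (hL _ vV).
set io := mix_scale Q; have io0 : 0 < io := mix_scale_gt0 Q0.
set a := mix_coef in eQ hb *; have a0 : 0 < a := mix_coef_gt0.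
have a1 : a <= 2^-1 := mix_coef_le.
set C4 := mix_const Q; have C41 : 1 <= C4 := mix_const_ge1 Q0.
have C40 : 0 < C4 by apply: lt_le_trans C41.
have ioE : 8 * m%:R * (io * C4 ^+ 2) = a.
  by rewrite /io /mix_scale -/a -/C4; field; rewrite !gt_eqF.
have ioC0 : 0 <= io * C4 := mulr_ge0 (ltW io0) (ltW C40).
have ioC : m%:R * (io * C4) <= 16^-1.
  have : m%:R * (io * C4) <= m%:R * (io * C4) * C4 by rewrite ler_peMr// mulr_ge0.
  by move: ioE; rewrite expr2; lra.
have ioC1 : io * C4 <= 16^-1.
  by apply: le_trans ioC; rewrite ler_peMl.
have io1 : io <= 16^-1 by apply: le_trans ioC1; rewrite ler_peMr// ltW.
pose w u : R := (load F1 u)%:R.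
pose G := far_value j w (2 * m%:R)^-1.
pose be := io / W.
have be0 : 0 < be by rewrite divr_gt0.
have beW : be * W = io by rewrite /be divfK// gt_eqF.
(* Half of the drift [io * a] is lost because [p * m * D] may be [1 + e]; the other half is divided
   equally between the threshold [kap] and the error [sig]. *)
pose ka := io * a / 4.
have ka0 : 0 <= ka by apply/ltW/divr_gt0 => //; apply: mulr_gt0.
have w0 u : 0 <= w u by [].
have G0 u : 0 <= G u by apply: far_value_ge0.
have GL u : u \in V0 -> G u <= CG * L by move=> uV; apply: (far_value_le j_gt0 jk kn w0 hL c01).
(* [stp_epotN] wants a nonpositive [phi], so the upper bound [CG * L] of [G] is subtracted. The
   shift is multiplied by [p * m * D] in one step, which costs [e * (CG * L)]. *)
pose phi u : R := if u \in V0 then be * (p * (G u - CG * L)) else 0.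
have phi0 u : phi u <= 0.
  rewrite /phi; case: ifP => // uV; rewrite mulr_ge0_le0 ?(ltW be0)//.
  by rewrite mulr_ge0_le0 ?(ltW p0)// subr_le0 GL.
have nphi u : u \in V0 -> nbr_sum inc U0 phi u =
    be * (p * (nbr_sum inc U0 G u - CG * L * (D%:R * m%:R))).
  move=> uV; rewrite -(nbr_sum_cst R jk uV) -!nbr_sumZ.
  rewrite -[X in be * (p * X)]/(_ + _) -nbr_sumN.
  rewrite /nbr_sum -big_split !mulr_sumr; apply: eq_bigr => K _.
  rewrite -big_split !mulr_sumr; apply: eq_bigr => t /setD1P[_ tK].
  by rewrite /phi (subsetP (jsub_sub _ _) _ tK) mulr1.
have SG0 u : 0 <= nbr_sum inc U0 G u by apply: sumr_ge0 => K _; apply: sumr_ge0.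
have SGL u : u \in V0 -> nbr_sum inc U0 G u <= CG * L * (D%:R * m%:R).
  move=> uV; rewrite -(nbr_sum_cst R jk uV) -nbr_sumZ.
  apply: ler_sum => K _; apply: ler_sum => t /setD1P[_ tK]; rewrite mulr1 GL//.
  exact: subsetP (jsub_sub _ _) _ tK.
have drift u : u \in V0 -> a * W <= w u + p * nbr_sum inc U0 G u - G u.
  move=> uV; have cpD : (2 * m%:R)^-1 <= p * D%:R.
    rewrite -[leLHS]mul1r ler_pdivrMr ?mulr_gt0//.
    by move: pmD2; rewrite -(ler_pM2l (_ : 0 < 2))//; lra.
  apply: le_trans (far_value_drift j_gt0 jk kn w0 c01 uV (ltW p0) cpD).
  rewrite -/a ler_wpM2l ?(ltW a0)// /W ler_wpM2r ?invr_ge0 ?exprn_ge0//.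
  rewrite /w -natr_sum sum_load// natrM -mulrA natrM ler_wpM2r// mulr_ge0//.
have beL : be * L <= io * Q.
  have := ler_wpM2l (ltW be0) LQ; move: beW; nra.
have CGL : 0 <= CG * L := mulr_ge0 CG0 L0.
have pmD0 : 0 <= p * m%:R * D%:R by move: pmD2; lra.
pose x0 := io * C4.
have bound u : u \in V0 -> `|be * w u - ka + nbr_sum inc U0 phi u| <= x0.
  move=> uV; rewrite nphi//.
  set S := nbr_sum inc U0 G u; have S0 : 0 <= S := SG0 u; have SL : S <= CG * L * (D%:R * m%:R) := SGL u uV.
  have bw : be * w u <= io * Q.
    by apply: le_trans beL; rewrite ler_wpM2l ?(ltW be0)// hL.
  have bw0 : 0 <= be * w u by rewrite mulr_ge0// ltW.
  have lo : be * (p * (S - CG * L * (D%:R * m%:R))) <= 0.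
    by rewrite mulr_ge0_le0 ?(ltW be0)// mulr_ge0_le0 ?(ltW p0)// subr_le0.
  have hi : - (2 * (io * Q * CG)) <= be * (p * (S - CG * L * (D%:R * m%:R))).
    have h1 : be * (p * (0 - CG * L * (D%:R * m%:R))) <= be * (p * (S - CG * L * (D%:R * m%:R))).
      by rewrite !ler_wpM2l ?(ltW be0) ?(ltW p0)// lerD2r.
    apply: le_trans h1.
    have -> : be * (p * (0 - CG * L * (D%:R * m%:R))) = - ((be * L * CG) * (p * m%:R * D%:R)) by ring.
    rewrite lerN2; apply: (@le_trans _ _ ((io * Q * CG) * 2)); last by rewrite mulrC.
    have t0 : 0 <= be * L * CG := mulr_ge0 (mulr_ge0 (ltW be0) L0) CG0.
    apply: ler_pM; [exact: t0|exact: pmD0| |].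
      by rewrite ler_wpM2r.
    by move: pmD e1; lra.
  have kaio : ka <= io.
    by rewrite /ka; have := ler_wpM2l (ltW io0) a1; move: io0; lra.
  have x0E : x0 = io * Q + 2 * (io * Q * CG) + io by rewrite /x0 /C4 /mix_const -/CG; ring.
  have t1 : 0 <= io * Q * CG := mulr_ge0 (mulr_ge0 (ltW io0) Q0) CG0.
  rewrite ler_norml x0E; apply/andP; split; move: bw bw0 lo hi kaio ka0; lra.
have sup u : u \in V0 -> phi u <= p * (be * w u - ka + nbr_sum inc U0 phi u - ka).
  move=> uV; rewrite nphi// /phi uV.
  set S := nbr_sum inc U0 G u.
  suff : be * (G u - CG * L) <= be * w u - ka + be * (p * (S - CG * L * (D%:R * m%:R))) - ka.
    by move=> /(ler_wpM2l (ltW p0)); rewrite mulrCA.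
  have h1 := ler_wpM2l (ltW be0) (drift u uV); rewrite -/S in h1.
  have h2 : be * (CG * L) * (p * m%:R * D%:R) <= be * (CG * L) * (1 + e).
    by rewrite ler_wpM2l//; exact: mulr_ge0 (ltW be0) CGL.
  have h3 : be * (CG * L) * e <= io * a / 2.
    apply: (@le_trans _ _ (io * (e * (Q * CG)))); last first.
      by rewrite -mulrA ler_wpM2l// ltW.
    have -> : be * (CG * L) * e = (be * L) * (CG * e) by ring.
    have -> : io * (e * (Q * CG)) = (io * Q) * (CG * e) by ring.
    by rewrite ler_wpM2r// mulr_ge0.
  have h4 : be * (a * W) = io * a by rewrite mulrCA beW mulrC.
  rewrite /ka; move: h1 h2 h3 h4; lra.
have mx : m%:R * x0 <= 2^-1 by rewrite /x0; move: ioC; lra.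
have sx : 2 * m%:R * x0 ^+ 2 <= ka.
  rewrite /x0 /ka exprMn expr2.
  have -> : 2 * m%:R * (io * io * C4 ^+ 2) = io * (8 * m%:R * (io * C4 ^+ 2)) / 4 by field.
  by rewrite ioE.
have x00 : 0 <= x0 := ioC0.
have p01 : 0 <= p <= 1 by rewrite ltW.
have hb' l : a / 8 * M * W <= (m.+1 ^ 2 * l)%:R -> (1 - p2) ^+ l <= b by apply: hb.
have key := @Er_avoids_le R _ _ inc U0 V0 m D p p01 (card_jsub jk) (fun K _ => jsub_sub j K)
  (deg_ksets_le jk) M M0 p2 zeta mu p201 z0 mu0 Hmu F1 be ka _ b ka x0 phi U v phi0 x00 b0
  (ltW be0) ka0 mx sx bound sup hb' UU vV.
apply: le_trans key _; rewrite lerD2r -expRD ler_expR.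
rewrite big_set1.
(* The total load asked for uses half of [ka * M]; the other half is the exponent. *)
have -> : ka * M - be * (a / 8 * M * W) = io * a / 8 * M.
  by rewrite /ka -beW; field.
rewrite lerD2r LamN.
have wv : 0 <= be * w v by rewrite mulr_ge0// ltW.
have lamL : - Lam inc phi U [set v] <= 2 * (io * Q * CG).
  rewrite -LamN.
  have dv : #|[set K in U0 | v \in inc K]| = D by apply: deg_ksets.
  apply: (@le_trans _ _ (D%:R * (m%:R * (be * (p * (CG * L)))))).
    rewrite /Lam; apply: (@le_trans _ _ (\sum_(K in [set K in U0 | v \in inc K])
       (m%:R * (be * (p * (CG * L)))))); last by rewrite sumr_const dv [leRHS]mulr_natl.
    have pos : 0 <= be * (p * (CG * L)) := mulr_ge0 (ltW be0) (mulr_ge0 (ltW p0) CGL).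
    rewrite big_mkcond [leRHS]big_mkcond /=; apply: ler_sum => K _.
    rewrite in_set touch1 [in leRHS]in_set; case: ifP => [/andP[KU vK]|_]; last first.
      by case: ifP => // _; exact: mulr_ge0 (ler0n _ _) pos.
    have KU0 := subsetP UU _ KU; rewrite KU0 vK /=.
    rewrite mulr_natl -[X in _ *+ X](card_jsubD1 jk KU0 vK) -sumr_const.
    apply: ler_sum => t /setD1P[_ tK].
    rewrite /phi (subsetP (jsub_sub _ _) _ tK) -mulrN ler_wpM2l ?(ltW be0)//.
    by rewrite -mulrN ler_wpM2l ?(ltW p0)// opprB lerBlDr lerDl.
  have -> : D%:R * (m%:R * (be * (p * (CG * L)))) = (be * L * CG) * (p * m%:R * D%:R) by ring.
  rewrite [leRHS]mulrC; apply: ler_pM; [exact: mulr_ge0 (mulr_ge0 (ltW be0) L0) CG0|exact: pmD0| |].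
    by rewrite ler_wpM2r.
  by move: pmD e1; lra.
have x0E : x0 = io * Q + 2 * (io * Q * CG) + io by rewrite /x0 /C4 /mix_const -/CG; ring.
have t1 : 0 <= io * Q := mulr_ge0 (ltW io0) Q0.
have kaio : ka <= io.
  by rewrite /ka; have := ler_wpM2l (ltW io0) a1; move: io0; lra.
have x016 : x0 <= 16^-1 := ioC1.
rewrite -/(w v); move: wv lamL x0E t1 kaio x016 io1; lra.
Qed.

End SecondExploration.

(** * A single giant from first and second moments *)

Section GiantFromMoments.
Variables (R : realType) (V E : finType) (inc : E -> {set V}).
Variables (U0 : {set E}) (V0 : {set V}).
Hypothesis inc_sub : forall K, K \in U0 -> inc K \subset V0.
Implicit Types (H : {set E}) (v : V).

Local Notation cl := (cl inc).

Definition num_large (M : R) H : R := \sum_(v in V0) (M <= #|cl H [set v]|%:R)%R%:R.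

Definition mass_large (M : R) H : R :=
  \sum_(v in V0) #|cl H [set v]|%:R * (M <= #|cl H [set v]|%:R)%R%:R.

Definition num_split (M : R) H1 H2 : R := \sum_(v1 in V0) \sum_(v2 in V0)
  [&& M <= #|cl H1 [set v1]|%:R, M <= #|cl H1 [set v2]|%:R &
      v2 \notin cl (H1 :|: H2) [set v1]]%R%:R.

Definition large_set (M : R) H := [set v in V0 | M <= #|cl H [set v]|%:R].

Lemma num_largeE M H : num_large M H = #|large_set M H|%:R.
Proof. by rewrite /large_set card_set_sum natr_sum. Qed.

Lemma num_splitE M H1 H2 : num_split M H1 H2 =
  \sum_(v1 in large_set M H1) #|large_set M H1 :\: cl (H1 :|: H2) [set v1]|%:R.
Proof.
rewrite /num_split [RHS]big_mkcond [LHS]big_mkcond /=; apply: eq_bigr => v1 _.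
rewrite in_set; case: (v1 \in V0) => //=.
case: (boolP (M <= #|cl H1 [set v1]|%:R)) => _ /=; last by apply: big1.
have -> : large_set M H1 :\: cl (H1 :|: H2) [set v1] =
    [set v in V0 | (M <= #|cl H1 [set v]|%:R) && (v \notin cl (H1 :|: H2) [set v1])].
  by apply/setP => v; rewrite in_setD !in_set andbC andbA.
by rewrite card_set_sum natr_sum.
Qed.

Lemma sqr_num_large_split M H1 H2 : num_large M H1 ^+ 2 =
  \sum_(v1 in large_set M H1) #|large_set M H1 :&: cl (H1 :|: H2) [set v1]|%:R
  + num_split M H1 H2.
Proof.
rewrite num_splitE -big_split num_largeE expr2 /= mulr_natl -sumr_const.
by apply: eq_bigr => v1 _; rewrite -natrD cardsID.
Qed.

Lemma large_setS M0 M H1 H : M0 <= M -> H1 \subset H -> large_set M H1 \subset large_set M0 H.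
Proof.
move=> MM HH; apply/subsetP => v; rewrite !in_set => /andP[-> h] /=.
apply: le_trans MM (le_trans h _); rewrite ler_nat; apply: subset_leq_card.
exact: clS.
Qed.

(** Two vertices that are large in [H1] either lie in a common component after sprinkling, and are
    counted by [mass_large], or form a split pair. *)
Lemma sqr_num_large_le M0 M H1 H2 : M0 <= M ->
  num_large M H1 ^+ 2 <= mass_large M0 (H1 :|: H2) + num_split M H1 H2.
Proof.
move=> MM; rewrite (sqr_num_large_split _ _ H2) lerD2r /mass_large.
have sub := large_setS MM (subsetUl H1 H2).
rewrite big_mkcond [leRHS]big_mkcond /=; apply: ler_sum => v _.
case: ifP => [/(subsetP sub)|_]; last by case: ifP => // _; rewrite mulr_ge0.
rewrite in_set => /andP[-> ->]; rewrite mulr1 ler_nat; apply: subset_leq_card.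
exact: subsetIr.
Qed.

(** Each of the [X1] vertices large in [H1] shares its component with at most [c1] of them, [c1]
    being the largest size, so [X1 ^+ 2] is at most [X1 * c1] plus the split pairs, and
    [c1 >= (1 - 3 * t) * a]. The large vertices number at most [(1 + 2 * t) * a] in all, which
    leaves [5 * t * a] for any other large component. *)
Lemma giant_of_moments (M0 M a t : R) H1 H2 :
  H1 \subset U0 -> H2 \subset U0 ->
  M0 <= M -> 2 * M0 <= a -> 0 < a -> 0 < t <= 10^-1 ->
  `|num_large M H1 - a| <= t * a ->
  num_large M0 (H1 :|: H2) - num_large M H1 <= t ^+ 2 * a ->
  num_split M H1 H2 <= t ^+ 2 * a ^+ 2 ->
  exists2 v0, v0 \in V0 & [/\ forall v, v \in V0 ->
      (#|cl (H1 :|: H2) [set v]| <= #|cl (H1 :|: H2) [set v0]|)%N,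
    `| #|cl (H1 :|: H2) [set v0]|%:R - a| <= 3 * t * a &
    forall v, v \in V0 -> cl (H1 :|: H2) [set v] != cl (H1 :|: H2) [set v0] ->
      #|cl (H1 :|: H2) [set v]|%:R <= M0 \/ #|cl (H1 :|: H2) [set v]|%:R <= 5 * t * a].
Proof.
move=> H1U H2U MM M0a a0 /andP[t0 t10]; rewrite ler_distl => /andP[X1lo X1hi] XX Z.
set H := H1 :|: H2 in XX Z *; set X1 := num_large M H1 in X1lo X1hi XX.
have ta : t * a <= a / 10 by rewrite mulrC ler_wpM2l// ltW.
have X10 : 0 < X1 by lra.
have /set0Pn[u uL] : large_set M H1 != set0.
  by rewrite -card_gt0 -(ltr_nat R) -num_largeE.
have uV : u \in V0 by move: uL; rewrite in_set => /andP[].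
pose v0 := [arg max_(v > u in V0) #|cl H [set v]|].
have [v0V v0max] : v0 \in V0 /\ forall v, v \in V0 -> (#|cl H [set v]| <= #|cl H [set v0]|)%N.
  by rewrite /v0; case: arg_maxnP.
set c1 : R := #|cl H [set v0]|%:R.
have tt : t ^+ 2 <= t / 10 by rewrite expr2 ler_wpM2l// ltW.
have t2a : t ^+ 2 * a <= t * a / 10.
  by rewrite [leRHS]mulrAC ler_wpM2r// ltW.
have c1lo : (1 - 3 * t) * a <= c1.
  have h1 : X1 ^+ 2 <= X1 * c1 + t ^+ 2 * a ^+ 2.
    rewrite (sqr_num_large_split _ _ H2); apply: lerD => //.
    rewrite [in leRHS]/X1 num_largeE mulr_natl -sumr_const; apply: ler_sum => v vL.
    rewrite ler_nat; apply: leq_trans (v0max v _); last by move: vL; rewrite in_set => /andP[].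
    by apply: subset_leq_card; exact: subsetIr.
  rewrite leNgt; apply/negP => c1lt.
  have h2 : X1 * c1 <= X1 * ((1 - 3 * t) * a) by rewrite ler_wpM2l// ltW.
  have h3 : 0 <= t * a by rewrite mulr_ge0// ltW.
  have h4 : (2 * (t * a)) * X1 <= (X1 - (1 - 3 * t) * a) * X1.
    by rewrite ler_wpM2r ?(ltW X10)//; lra.
  have h5 : t ^+ 2 * a ^+ 2 <= (t * a) * (a / 10).
    have -> : t ^+ 2 * a ^+ 2 = (t * a) * (t * a) by ring.
    by rewrite ler_wpM2l.
  have h6 : (t * a) * (9 / 10 * a) <= (t * a) * X1 by rewrite ler_wpM2l//; lra.
  have h7 : 0 < t * a * a by rewrite !mulr_gt0.
  by move: h1 h2 h4 h5 h6 h7; rewrite expr2; lra.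
have cX v : M0 <= #|cl H [set v]|%:R -> v \in V0 -> cl H [set v] \subset large_set M0 H.
  move=> Mv vV; apply/subsetP => w wv; rewrite in_set (cl1_eq wv) Mv andbT.
  have HU : H \subset U0 by rewrite subUset H1U H2U.
  have : cl H [set v] \subset V0.
    apply: cl_min; first by rewrite sub1set.
    by move=> K KH _; apply: inc_sub; apply: (subsetP HU).
  by move=> /subsetP; apply.
have c1M0 : M0 <= c1 by lra.
have Xhi : #|large_set M0 H|%:R <= (1 + 2 * t) * a.
  by rewrite -num_largeE; lra.
exists v0 => //; split => //.
  have c1hi : c1 <= (1 + 2 * t) * a.
    by apply: le_trans Xhi; rewrite ler_nat; apply: subset_leq_card; exact: cX.
  by rewrite ler_distl; apply/andP; split; lra.
move=> v vV vv0; have [Mv|Mv] := leP M0 #|cl H [set v]|%:R; last by left; rewrite ltW.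
right; have dis : cl H [set v] :&: cl H [set v0] = set0.
  apply/eqP; apply: contraNT vv0 => /set0Pn[w /setIP[wv wv0]].
  by rewrite -(cl1_eq wv) (cl1_eq wv0).
have := Xhi; have : (#|cl H [set v]| + #|cl H [set v0]| <= #|large_set M0 H|)%N.
  have := cardsUI (cl H [set v]) (cl H [set v0]); rewrite dis cards0 addn0 => <-.
  by apply: subset_leq_card; rewrite subUset !cX.
by rewrite -(ler_nat R) natrD -/c1; lra.
Qed.

Variables (p p1 p2 M0 M theta g t : R) (P : {set E} -> bool).
Hypotheses (p01 : 0 <= p <= 1) (p101 : 0 <= p1 <= 1) (p201 : 0 <= p2 <= 1)
  (pE : 1 - p = (1 - p1) * (1 - p2)).
Let a : R := theta * #|V0|%:R.
Hypotheses (MM : M0 <= M) (a_gt0 : 0 < a) (t_gt0 : 0 < t) (t_le1 : t <= 1) (g_ge0 : 0 <= g).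
Hypothesis HP : forall H1 H2, H1 \subset U0 -> H2 \subset U0 ->
  `|num_large M H1 - a| <= t * a ->
  num_large M0 (H1 :|: H2) - num_large M H1 <= t ^+ 2 * a ->
  num_split M H1 H2 <= t ^+ 2 * a ^+ 2 -> P (H1 :|: H2).
Hypothesis survival : forall v, v \in V0 ->
  (1 - 6 * g) * theta <= Er p1 U0 (fun H => (M <= #|cl H [set v]|%:R)%R%:R).
Hypothesis large_prob : forall v, v \in V0 ->
  Er p U0 (fun H => (M0 <= #|cl H [set v]|%:R)%R%:R) <= (1 + 5 * g) * theta.
Hypothesis giant_mass : forall v, v \in V0 ->
  Er p U0 (fun H => #|cl H [set v]|%:R * (M0 <= #|cl H [set v]|%:R)%R%:R)
    <= (1 + 12 * g) * theta ^+ 2 * #|V0|%:R.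
Hypothesis split_prob : forall v1 v2, v1 \in V0 -> v2 \in V0 ->
  Er p1 U0 (disjoint_giants inc U0 M p2 v2 ^~ [set v1]) <= 7 * g * theta ^+ 2.

Let EE (F : {set E} -> {set E} -> R) := Er p1 U0 (fun H1 => Er p2 U0 (F H1)).

Let EE_le F G : (forall H1 H2, H1 \subset U0 -> H2 \subset U0 -> F H1 H2 <= G H1 H2) ->
  EE F <= EE G.
Proof. by move=> FG; apply: le_Er => // H1 H1U; apply: le_Er => // H2 H2U; apply: FG. Qed.

Let EE_D F G : EE (fun H1 H2 => F H1 H2 + G H1 H2) = EE F + EE G.
Proof. by rewrite /EE -ErD; apply: eq_Er => H1 _; rewrite ErD. Qed.

Let EE_Z x F : EE (fun H1 H2 => x * F H1 H2) = x * EE F.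
Proof. by rewrite /EE -ErZ; apply: eq_Er => H1 _; rewrite ErZ. Qed.

Let EE_cst x : EE (fun _ _ => x) = x.
Proof. by rewrite -[RHS](Er_cst p1 U0); apply: eq_Er => H1 _; exact: Er_cst. Qed.

Let EE_union f : EE (fun H1 H2 => f (H1 :|: H2)) = Er p U0 f.
Proof. by rewrite (Er_union _ _ pE). Qed.

(** Markov's inequality for [Q], which dominates the sum of three nonnegative deviations: the
    squared error of [num_large], the split pairs and the vertices that become large only in the
    union. As [Q] is linear in quantities with known bounds on the mean, the leading terms cancel,
    [1 + 1 - 3 + 1 = 0], and the errors add up to [12 + 14 + 18 + 5 = 49]. *)
Lemma prob_giant : 1 - 49 * g / t ^+ 2 <= Er p U0 (fun H => (P H)%:R).
Proof.
pose Q H1 H2 : R := ((mass_large M0 (H1 :|: H2) + 2 * num_split M H1 H2 + a ^+ 2) / a ^+ 2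
   - 2 * num_large M H1 / a) + (num_large M0 (H1 :|: H2) - num_large M H1) / a.
have a2 : 0 < a ^+ 2 by rewrite exprn_gt0.
have t2 : 0 < t ^+ 2 by rewrite exprn_gt0.
have Z0 H1 H2 : 0 <= num_split M H1 H2 by apply: sumr_ge0 => ? _; apply: sumr_ge0.
have XX H1 H2 : num_large M H1 <= num_large M0 (H1 :|: H2).
  rewrite !num_largeE ler_nat; apply: subset_leq_card; apply: large_setS => //.
  exact: subsetUl.
have pw H1 H2 : H1 \subset U0 -> H2 \subset U0 -> 1 - Q H1 H2 / t ^+ 2 <= (P (H1 :|: H2))%:R.
  move=> H1U H2U; have sq := sqr_num_large_le H1 H2 MM.
  have QE : (num_large M H1 - a) ^+ 2 / a ^+ 2 + num_split M H1 H2 / a ^+ 2 +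
      (num_large M0 (H1 :|: H2) - num_large M H1) / a <= Q H1 H2.
    rewrite /Q lerD2r -mulrDl.
    have -> : 2 * num_large M H1 / a = 2 * num_large M H1 * a / a ^+ 2 by field; rewrite gt_eqF.
    by rewrite -mulrBl ler_wpM2r ?invr_ge0 ?(ltW a2)//; lra.
  have q1 : 0 <= (num_large M H1 - a) ^+ 2 / a ^+ 2 by rewrite divr_ge0 ?sqr_ge0.
  have q2 : 0 <= num_split M H1 H2 / a ^+ 2 by rewrite divr_ge0 ?Z0 ?(ltW a2).
  have q3 : 0 <= (num_large M0 (H1 :|: H2) - num_large M H1) / a.
    by rewrite divr_ge0 ?subr_ge0 ?XX ?(ltW a_gt0).
  have Q0 : 0 <= Q H1 H2 by lra.
  case: (boolP (P _)) => [_|nP].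
    by rewrite lerBlDr lerDl divr_ge0 ?(ltW t2).
  rewrite subr_le0 ler_pdivlMr// mul1r leNgt; apply: contraNN nP => Qt.
  apply: HP => //.
  - have : (num_large M H1 - a) ^+ 2 <= (t * a) ^+ 2.
      by rewrite exprMn -ler_pdivrMr//; lra.
    rewrite -[X in X <= _]real_normK ?num_real// ler_pXn2r// nnegrE//.
    by rewrite mulr_ge0 ?ltW.
  - by rewrite -ler_pdivrMr//; lra.
  - by rewrite -ler_pdivrMr//; lra.
have EX1 : (1 - 6 * g) * a <= EE (fun H1 _ => num_large M H1).
  rewrite /EE (@eq_Er _ _ _ _ _ (num_large M)) => [|H1 _]; last exact: Er_cst.
  rewrite /num_large Er_sum.
  have -> : (1 - 6 * g) * a = #|V0|%:R * ((1 - 6 * g) * theta) by rewrite /a; ring.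
  by rewrite [leLHS]mulr_natl -sumr_const; apply: ler_sum => v; apply: survival.
have EX : EE (fun H1 H2 => num_large M0 (H1 :|: H2)) <= (1 + 5 * g) * a.
  rewrite (EE_union (num_large M0)) /num_large Er_sum.
  have -> : (1 + 5 * g) * a = #|V0|%:R * ((1 + 5 * g) * theta) by rewrite /a; ring.
  by rewrite [leRHS]mulr_natl -sumr_const; apply: ler_sum => v; apply: large_prob.
have EY : EE (fun H1 H2 => mass_large M0 (H1 :|: H2)) <= (1 + 12 * g) * a ^+ 2.
  rewrite (EE_union (mass_large M0)) /mass_large Er_sum.
  have -> : (1 + 12 * g) * a ^+ 2 = #|V0|%:R * ((1 + 12 * g) * theta ^+ 2 * #|V0|%:R) by rewrite /a; ring.
  by rewrite [leRHS]mulr_natl -sumr_const; apply: ler_sum => v; apply: giant_mass.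
have EZ : EE (num_split M) <= 7 * g * a ^+ 2.
  rewrite /EE (@eq_Er _ _ _ _ _ (fun H1 => \sum_(v1 in V0) \sum_(v2 in V0)
     disjoint_giants inc U0 M p2 v2 H1 [set v1])) => [|H1 _]; last first.
    by rewrite /num_split Er_sum; apply: eq_bigr => v1 _; rewrite Er_sum.
  rewrite Er_sum.
  have -> : 7 * g * a ^+ 2 = #|V0|%:R * (#|V0|%:R * (7 * g * theta ^+ 2)) by rewrite /a; ring.
  rewrite [leRHS]mulr_natl -sumr_const; apply: ler_sum => v1 v1V; rewrite Er_sum.
  by rewrite [leRHS]mulr_natl -sumr_const; apply: ler_sum => v2 v2V; apply: split_prob.
have EQ : EE Q <= 49 * g.
  have -> : EE Q = EE (fun H1 H2 => (a ^+ 2)^-1 * mass_large M0 (H1 :|: H2) +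
     ((2 / a ^+ 2) * num_split M H1 H2 + (1 + ((- 3 / a) * num_large M H1 +
       a^-1 * num_large M0 (H1 :|: H2))))).
    apply: eq_Er => H1 _; apply: eq_Er => H2 _; rewrite /Q.
    by field; rewrite gt_eqF.
  rewrite !EE_D !EE_Z EE_cst.
  have ai : 0 <= a^-1 by rewrite invr_ge0 ltW.
  have a2i : 0 <= (a ^+ 2)^-1 by rewrite invr_ge0 ltW.
  have h1 := ler_wpM2l a2i EY; have h2 := ler_wpM2l a2i EZ.
  have h3 := ler_wpM2l ai EX1; have h4 := ler_wpM2l ai EX.
  have e1 x : (a ^+ 2)^-1 * (x * a ^+ 2) = x by rewrite mulrC mulfK// gt_eqF.
  have e2 x : a^-1 * (x * a) = x by rewrite mulrC mulfK// gt_eqF.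
  by move: h1 h2 h3 h4; rewrite !e1 !e2; lra.
apply: (@le_trans _ _ (1 - EE Q / t ^+ 2)).
  by rewrite lerD2l lerN2 ler_wpM2r ?invr_ge0 ?(ltW t2).
rewrite -(EE_union (fun H => (P H)%:R)).
apply: (@le_trans _ _ (EE (fun H1 H2 => 1 + (- (t ^+ 2)^-1) * Q H1 H2))).
  rewrite (EE_D (fun _ _ => 1) (fun H1 H2 => - (t ^+ 2)^-1 * Q H1 H2)) EE_cst (EE_Z _ Q).
  by rewrite mulNr [(t ^+ 2)^-1 * _]mulrC.
apply: EE_le => H1 H2 H1U H2U; apply: le_trans (pw H1 H2 H1U H2U).
by rewrite mulNr [(t ^+ 2)^-1 * _]mulrC.
Qed.

End GiantFromMoments.

Lemma bin_diff_le n j s : (j <= n)%N -> (0 < s)%N ->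
  ('C(n, s) <= 'C(n - j, s) + j * 'C(n.-1, s.-1))%N.
Proof.
move=> jn s0; elim: j jn => [|j IH] jn; first by rewrite subn0 addn0.
apply: leq_trans (IH (ltnW jn)) _; rewrite mulSn addnA leq_add2r.
case: s s0 {IH} => // s _; have -> : (n - j = (n - j.+1).+1)%N by lia.
by rewrite binS leq_add2l leq_bin2l//; lia.
Qed.

(** The threshold [p0] is normalised by [C(n, k - j)], while a [j]-set has degree [C(n - j, k - j)].
    The relative difference is at most [j * (k - j) / n], to be compared with [e]. *)
Lemma bin_ratio n j s : (j <= n)%N -> (0 < s)%N ->
  (n * 'C(n, s) <= n * 'C(n - j, s) + j * s * 'C(n, s))%N.
Proof.
move=> jn s0; have h : (n * 'C(n, s) <= n * ('C(n - j, s) + j * 'C(n.-1, s.-1)))%N.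
  by rewrite leq_mul2l bin_diff_le// orbT.
apply: leq_trans h _; rewrite mulnDr leq_add2l mulnCA -mulnA leq_mul2l; apply/orP; right.
by have := mul_bin_diag n s.-1; rewrite prednK// => ->.
Qed.

(** * The equations for [mu] near criticality *)

Section Numerics.
Variable R : realType.
Implicit Types (e g m D p : R).

(** With [x = e / 8 + e ^+ 2 / 32] the claim becomes [(1 - e) * (x + 2 * x ^+ 2) <= e / 8]: the
    factor [1 - e] saves about [e ^+ 2 / 8], more than the quadratic terms cost. *)
Lemma subcritical_drift e m D p : 0 < e -> e <= 1 -> 1 <= m -> 0 < D -> 0 <= p ->
  p * m * D <= 1 - e ->
  1 - p + p * expR (m * (e ^+ 2 / (32 * m) + e / (8 * m * D) * D)) <= expR (e / (8 * m * D)).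
Proof.
move=> e0 e1 m1 D0 p0 pmD; have m0 : 0 < m by lra.
have -> : m * (e ^+ 2 / (32 * m) + e / (8 * m * D) * D) = e / 8 + e ^+ 2 / 32.
  by field; rewrite !gt_eqF.
set x := e / 8 + e ^+ 2 / 32; set mu := e / (8 * m * D).
have mD : 0 < m * D by rewrite mulr_gt0.
have e2 : e ^+ 2 <= e by rewrite expr2 ler_piMl// ltW.
have e20 : 0 <= e ^+ 2 := sqr_ge0 e.
have x2 : x <= 2^-1 by rewrite /x; lra.
apply: le_trans (expR_ge1Dx mu).
suff : p * (expR x - 1) <= mu by lra.
have h := expR_le2 x2; have x0 : 0 <= x by rewrite /x; lra.
apply: (@le_trans _ _ (p * (x + 2 * x ^+ 2))); first by rewrite ler_wpM2l//; lra.
have xe : x <= e * (5 / 32) by rewrite /x; lra.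
have xx : x ^+ 2 <= e ^+ 2 * (25 / 1024).
  have : x ^+ 2 <= (e * (5 / 32)) ^+ 2 by rewrite lerXn2r// nnegrE mulr_ge0// ltW.
  by rewrite exprMn; lra.
have y0 : 0 <= x + 2 * x ^+ 2 by rewrite addr_ge0// mulr_ge0// sqr_ge0.
rewrite -(ler_pM2r mD) (_ : mu * (m * D) = e / 8); last by rewrite /mu; field; rewrite !gt_eqF.
rewrite (_ : _ * (m * D) = (p * m * D) * (x + 2 * x ^+ 2)); last by ring.
apply: le_trans (ler_wpM2r y0 pmD) _.
have e3 : 0 <= e * e ^+ 2 by rewrite mulr_ge0// ltW.
have h5 : (1 - e) * (x + 2 * x ^+ 2) <= (1 - e) * (e / 8 + e ^+ 2 * (1 / 32 + 50 / 1024)).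
  have xE : x = e / 8 + e ^+ 2 / 32 by [].
  by rewrite ler_wpM2l; [|lra|move: xx xE; lra].
apply: le_trans h5 _; lra.
Qed.

Lemma exp_inv_le g : 0 < g -> expR (- g^-1) <= g.
Proof.
move=> g0; have h := @expR_ge1Dx R g^-1.
rewrite expRN -[leRHS]invrK lef_pV2 ?posrE ?expR_gt0 ?invr_gt0//; lra.
Qed.

(** With [x = m * D * mu = 2 * e * (1 + g)], the second-order balance [e * x - x ^+ 2 / 2] equals
    [- 2 * g * (1 + g) * e ^+ 2]. This margin of order [g * e ^+ 2] pays for
    [m * zeta = g * e ^+ 2 / 4], for the cubic terms by [18 * e <= g], and for the square of [mu] by
    [9 <= g * D]. *)
Lemma supercritical_drift e g m D p : 0 < e -> 0 < g -> g <= 25^-1 -> 18 * e <= g ->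
  1 <= m -> 9 <= g * D -> 0 <= p -> p * m * D <= 1 + e ->
  expR (- ((1 + g) * (2 * e / m) / D)) <=
    1 - p + p * expR (- (m * (g / (4 * m) * e ^+ 2 + (1 + g) * (2 * e / m) / D * D))).
Proof.
move=> e0 g0 g1 eg m1 gD p0 pmD; have m0 : 0 < m by lra.
have D0 : 0 < D by rewrite -(pmulr_rgt0 _ g0); lra.
have mD : 0 < m * D by rewrite mulr_gt0.
set mu := (1 + g) * _ / D.
pose x := 2 * e * (1 + g); pose y := g / 4 * e ^+ 2.
have -> : m * (g / (4 * m) * e ^+ 2 + mu * D) = x + y.
  by rewrite /mu /x /y; field; rewrite !gt_eqF.
have muE : mu * (m * D) = x by rewrite /mu /x; field; rewrite !gt_eqF.
have ge : 0 <= g * e by rewrite mulr_ge0 ?ltW.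
have x0 : 0 <= x by rewrite /x; lra.
have gge : g * e <= 25^-1 * e by rewrite ler_wpM2r// ltW.
have xe : x <= e * (52 / 25) by rewrite /x; lra.
have y0 : 0 <= y by rewrite mulr_ge0 ?sqr_ge0// divr_ge0// ltW.
have e1 : e <= 1 by lra.
have e2 : 0 < e ^+ 2 by rewrite exprn_gt0.
have ge2 : 0 < g * e ^+ 2 by rewrite mulr_gt0.
have yE : y = g * e ^+ 2 / 4 by rewrite /y; ring.
have ye : y <= e * (1 / 100).
  have : e ^+ 2 <= e by rewrite expr2 ler_piMl// ltW.
  by move=> h; have := ler_pM (ltW g0) (ltW e2) g1 h; rewrite yE; lra.
set z := x + y; have z0 : 0 <= z by rewrite addr_ge0.
have ze : z <= 3 * e by rewrite /z; lra.
have mu0 : 0 <= mu by rewrite !mulr_ge0 ?invr_ge0 ?addr_ge0// ltW.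
suff : p * (1 - expR (- z)) <= 1 - expR (- mu) by lra.
have h1 := expRN_ge z0; have h2 := expRN_le mu0.
apply: (@le_trans _ _ (mu - mu ^+ 2 / 2)); last by lra.
have f0 : 0 <= 1 - expR (- z) by rewrite subr_ge0 -expR0 ler_expR oppr_le0.
rewrite -(ler_pM2r mD).
have -> : (mu - mu ^+ 2 / 2) * (m * D) = x - x * mu / 2 by rewrite -muE; ring.
rewrite (_ : _ * (m * D) = (p * m * D) * (1 - expR (- z))); last by ring.
apply: le_trans (ler_wpM2r f0 pmD) _.
have z3 : z ^+ 3 <= 27 * e ^+ 3.
  have : z ^+ 3 <= (3 * e) ^+ 3 by rewrite lerXn2r// nnegrE mulr_ge0// ltW.
  by rewrite exprMn; lra.
have e3 : 18 * e ^+ 3 <= g * e ^+ 2.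
  have := ler_wpM2r (ltW e2) eg; rewrite (_ : 18 * e * e ^+ 2 = 18 * e ^+ 3)//; ring.
have xz : x ^+ 2 <= z ^+ 2 by rewrite lerXn2r ?nnegrE// /z lerDl.
have hf : 1 - expR (- z) <= x + y - x ^+ 2 / 2 + 9 / 2 * e ^+ 3.
  have zE : z = x + y by [].
  by move: zE h1 xz z3; lra.
have e1f : (1 + e) * (1 - expR (- z)) <= (1 + e) * (x + y - x ^+ 2 / 2 + 9 / 2 * e ^+ 3).
  by rewrite ler_wpM2l//; lra.
apply: le_trans e1f _.
have xmu : x * mu <= g * e ^+ 2.
  have h3 : x * mu * (m * D) <= 9 * e ^+ 2.
    rewrite -mulrA muE; have : x * x <= (3 * e) * (3 * e) by rewrite ler_pM//; lra.
    by rewrite expr2; lra.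
  rewrite -(ler_pM2r mD); apply: le_trans h3 _.
  have : 9 * e ^+ 2 <= (g * D) * e ^+ 2 by rewrite ler_wpM2r ?(ltW e2)//.
  have : g * D * e ^+ 2 <= g * D * e ^+ 2 * m.
    by rewrite ler_peMr// !mulr_ge0 ?(ltW e2)// ltW.
  lra.
have x2 : x ^+ 2 = 4 * e ^+ 2 * (1 + g) ^+ 2 by rewrite /x; ring.
have ex : e * x = 2 * e ^+ 2 * (1 + g) by rewrite /x; ring.
have ey : e * y <= y by rewrite ler_piMl.
have ex2 : 0 <= e * x ^+ 2 by rewrite mulr_ge0 ?sqr_ge0// ltW.
have e4 : e * e ^+ 3 <= e ^+ 3 by rewrite ler_piMl// exprn_ge0// ltW.
have gg : 0 <= g ^+ 2 * e ^+ 2 by rewrite mulr_ge0// sqr_ge0.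
by move: x2 ex yE; lra.
Qed.

(** To first order the product is 1 plus [(1 - 2 * g) - g - (1 - 4 * g) = g] times [e], which leaves
    [g * e] for the products. *)
Lemma survival_drift e g kap q : 0 < e -> 0 < g -> g <= 25^-1 -> e <= g ->
  0 <= kap -> kap <= g * e -> 1 + (1 - 2 * g) * e <= q ->
  1 <= q * (1 - kap) * (1 - (1 - 4 * g) * e).
Proof.
move=> e0 g0 g1 eg k0 kg hq.
have ge : 0 <= g * e by rewrite mulr_ge0 ?ltW.
have gge : g * e <= 25^-1 * e by rewrite ler_wpM2r// ltW.
have ee : 0 <= e * e by rewrite mulr_ge0 ?ltW.
have ege : e * e <= g * e by rewrite ler_wpM2r// ltW.
set B := (1 - 4 * g) * e.
have B0 : 0 <= B by rewrite /B; lra.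
have B1 : B <= e by rewrite /B; lra.
have e1 : e <= 25^-1 by lra.
apply: (@le_trans _ _ ((1 + (1 - 2 * g) * e) * ((1 - g * e) * (1 - B)))); last first.
  rewrite -mulrA; apply: ler_pM => //.
  - by lra.
  - by rewrite mulr_ge0//; lra.
  - by rewrite ler_wpM2r//; lra.
set A := (1 - 2 * g) * e.
have A0 : 0 <= A by rewrite /A; lra.
have A1 : A <= e by rewrite /A; lra.
have h1 : 1 - (g * e + B) <= (1 - g * e) * (1 - B) by have := mulr_ge0 ge B0; lra.
apply: (@le_trans _ _ ((1 + A) * (1 - (g * e + B)))); last by rewrite ler_wpM2l//; lra.
have h2 : A * (g * e + B) <= e * e.
  by apply: ler_pM => //; [lra|rewrite /B; lra].
by rewrite /A /B in h2 *; lra.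
Qed.

End Numerics.

Lemma leq_bin n j : (0 < j < n)%N -> (n <= 'C(n, j))%N.
Proof.
elim: n j => [|n IH] [|j]//= jn; rewrite binS.
have [jn'|jn'] := ltnP j.+1 n.
  have := IH j.+1 jn'; have : (0 < 'C(n, j))%N by rewrite bin_gt0; lia.
  by lia.
have -> : j = n.-1 by lia.
case: n {IH} jn jn' => // n _ _; rewrite binn -bin_sub//= subSnn bin1; lia.
Qed.

(** * The supercritical case for a fixed large [n] *)

Section Supercritical.
Variables (R : realType) (n k j : nat).
Hypotheses (j_gt0 : (0 < j)%N) (jk : (j < k)%N) (kn : (2 * k <= n)%N).

Local Notation inc := (@jsub n j).
Local Notation U0 := (ksets n k).
Local Notation V0 := (ksets n j).
Let m := ('C(k, j)).-1.
Let D := 'C(n - j, k - j).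
Let T := 'C(n, k - j).
Let N := 'C(n, j).

(** In the exponent of [degpot] the first term pays the cost of [M] found sets; of the 2 added, one
    pays for the [m] sets beyond [M] and one is the exponent that remains. The constant [bin_const]
    satisfies [n ^ j <= bin_const * C(n, j)], and [mix_ratio] plays the role of [Q] in
    [Er_avoids_mixing]. *)
Definition load_const : R := 3 * deg_big R k j * spread R k j ^+ j.-1 + 2.
Definition bin_const : R := (2 ^ j * j`!)%:R.
Definition mix_ratio : R := load_const * bin_const.

Variables e g : R.
Let lam : R := g / (4 * load_const).
Let theta : R := 2 * e / m%:R.
Let x : R := n%:R * e.
Let y : R := e ^+ 3 * N%:R.

(* [n] is large and [e] is small, compared with constants depending on [g], [k] and [j]. *)
Record super_regime : Prop := SuperRegime {
  sr_A : 8 <= n%:R / spread R k j;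
  sr_e : 0 < e;
  sr_g : 0 < g;
  sr_g_le : g <= 25^-1;
  sr_e_le : 18 * e <= g;
  sr_tau : e <= deg_tau R k j;
  sr_mix : e * (mix_ratio * (j.+1%:R * 2 ^+ j)) <= mix_coef R k j / 2;
  sr_x1 : 4 * m%:R * (cgeo k j)%:R <= g * x;
  sr_x2 : 9 * (cgeo k j)%:R <= g * x;
  sr_x3 : 2 * (j * (k - j))%:R <= g * x;
  sr_x4 : 3 * deg_big R k j * m%:R <= lam * x;
  sr_y1 : 4 * m%:R / g ^+ 2 <= lam * y;
  sr_y2 : 1750 * m%:R ^+ 2 / g ^+ 5 <= y;
  sr_y3 : 16 * bin_const * m.+1%:R ^+ 2 / (g ^+ 2 * mix_coef R k j * lam ^+ 2) <= y;
  sr_z1 : n%:R ^+ j * expR (1 - deg_scale R k j * lam * x) <= g * theta ^+ 2;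
  sr_z2 : expR (1 - mix_scale k j mix_ratio * mix_coef R k j / 8 * lam * x) <= g * theta ^+ 2
}.

Hypothesis Hs : super_regime.

Lemma super_e_gt0 : 0 < e. Proof. exact: sr_e Hs. Qed.
Lemma super_g_gt0 : 0 < g. Proof. exact: sr_g Hs. Qed.
Lemma super_g_le : g <= 25^-1. Proof. exact: sr_g_le Hs. Qed.

Lemma super_n_gt0 : (0 < n)%N. Proof. by lia. Qed.
Lemma super_k_le_n : (k <= n)%N. Proof. by lia. Qed.
Lemma super_D_gt0 : (0 < D)%N. Proof. by rewrite bin_gt0; lia. Qed.
Lemma super_T_gt0 : (0 < T)%N. Proof. by rewrite bin_gt0; lia. Qed.
Lemma super_N_gt0 : (0 < N)%N. Proof. by rewrite bin_gt0; lia. Qed.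
Lemma super_m_gt0 : (0 < m)%N. Proof. exact: bin_pred_gt0. Qed.
#[local] Hint Extern 0 (is_true (Order.le _ _)) => solve [apply/ltW; trivial] : core.
#[local] Hint Resolve super_e_gt0 super_g_gt0 super_g_le super_k_le_n super_n_gt0 super_D_gt0 super_T_gt0 super_N_gt0 super_m_gt0 : core.
Lemma super_mR : 1 <= m%:R :> R. Proof. by rewrite ler1n. Qed.
Lemma super_m0R : 0 < m%:R :> R. Proof. by rewrite ltr0n. Qed.
Lemma super_DR : 0 < D%:R :> R. Proof. by rewrite ltr0n. Qed.
Lemma super_TR : 0 < T%:R :> R. Proof. by rewrite ltr0n. Qed.
Lemma super_NR : 0 < N%:R :> R. Proof. by rewrite ltr0n. Qed.
Lemma super_nR : 0 < n%:R :> R. Proof. by rewrite ltr0n. Qed.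
Lemma super_cR : 1 <= (cgeo k j)%:R :> R. Proof. by rewrite ler1n cgeo_gt0. Qed.
#[local] Hint Resolve super_mR super_m0R super_DR super_TR super_NR super_nR : core.
Lemma super_e_le1 : e <= 18^-1 * 25^-1. Proof. by move: (sr_e_le Hs) super_g_le; lra. Qed.
Lemma super_theta_gt0 : 0 < theta. Proof. by apply: divr_gt0 => //; apply: mulr_gt0. Qed.
#[local] Hint Resolve super_theta_gt0 : core.
Lemma super_theta_le : theta <= 2 * e.
Proof. by rewrite /theta ler_pdivrMr// ler_peMr ?super_mR// mulr_ge0// ltW. Qed.
Lemma super_x_gt0 : 0 < x. Proof. exact: mulr_gt0. Qed.
Lemma super_y_gt0 : 0 < y. Proof. by apply: mulr_gt0 => //; rewrite exprn_gt0. Qed.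

#[local] Hint Resolve super_x_gt0 super_y_gt0 : core.
Lemma super_deg_big_gt0 : 0 < deg_big R k j.
Proof. by apply: mulr_gt0; [apply: mulr_gt0|exact: lt_le_trans super_cR]. Qed.
#[local] Hint Resolve super_deg_big_gt0 : core.
Lemma super_spread1 : 1 <= spread R k j. Proof. exact: spread_ge1. Qed.
Lemma super_load_const_ge2 : 2 <= load_const.
Proof.
rewrite /load_const -[leLHS]add0r lerD2r; apply/ltW/mulr_gt0; first exact: mulr_gt0.
by rewrite exprn_gt0// (lt_le_trans _ super_spread1).
Qed.
Lemma super_load_const_gt0 : 0 < load_const. Proof. exact: lt_le_trans super_load_const_ge2. Qed.
#[local] Hint Resolve super_load_const_gt0 : core.
Lemma super_lam_gt0 : 0 < lam. Proof. by apply: divr_gt0 => //; apply: mulr_gt0. Qed.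
#[local] Hint Resolve super_lam_gt0 : core.
Lemma super_lamE : load_const * lam = g / 4. Proof. by rewrite /lam; field; rewrite gt_eqF. Qed.

Definition super_p : R := (1 + e) * p0 k j n.
(** The first round gives up a fraction [g] of the surplus. At least [g * e * p0] is left for the
    sprinkling probability [super_p2], which solves the equation in [Er_union]. *)
Definition super_p1 : R := (1 + (1 - g) * e) * p0 k j n.
Definition super_p2 : R := (super_p - super_p1) / (1 - super_p1).

Lemma p0E : p0 k j n = (m%:R * T%:R)^-1 :> R.
Proof.
by rewrite /p0 invfM (bin_predK jk) -natr1 addrK.
Qed.
Lemma p0_gt0 : 0 < p0 k j n :> R. Proof. by rewrite p0E invr_gt0 mulr_gt0. Qed.

#[local] Hint Resolve p0_gt0 : core.
Lemma super_ratioT : T%:R * (1 - (j * (k - j))%:R / n%:R) <= D%:R :> R.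
Proof.
have := @bin_ratio n j (k - j) _ _; rewrite -/T -/D => h.
have {}h : (n * T <= n * D + j * (k - j) * T)%N by apply: h; [lia|rewrite subn_gt0].
move: h; rewrite -(ler_nat R) natrD !natrM => h.
rewrite -(ler_pM2l super_nR).
have -> : n%:R * (T%:R * (1 - j%:R * (k - j)%:R / n%:R)) = n%:R * T%:R - j%:R * (k - j)%:R * T%:R :> R.
  by field; rewrite gt_eqF.
by rewrite lerBlDr.
Qed.

Lemma super_DT : D%:R <= T%:R :> R.
Proof. by rewrite ler_nat; apply: leq_bin2l; exact: leq_subr. Qed.

Lemma super_jk_n : (j * (k - j))%:R / n%:R <= g * e / 2 :> R.
Proof.
rewrite ler_pdivrMr//; move: (sr_x3 Hs); rewrite /x; lra.
Qed.

Lemma mean_nbr_le (q : R) : 0 <= q -> q * p0 k j n * m%:R * D%:R <= q.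
Proof.
move=> q0; rewrite p0E.
have -> : q * (m%:R * T%:R)^-1 * m%:R * D%:R = q * (D%:R / T%:R) by field; rewrite !gt_eqF.
by rewrite ler_piMr// ler_pdivrMr// mul1r super_DT.
Qed.

Lemma super_pmD_ge (q : R) : 0 <= q -> q * (1 - g * e / 2) <= q * p0 k j n * m%:R * D%:R.
Proof.
move=> q0; rewrite p0E.
have -> : q * (m%:R * T%:R)^-1 * m%:R * D%:R = q * (D%:R / T%:R) by field; rewrite !gt_eqF.
rewrite ler_wpM2l// ler_pdivlMr//; apply: le_trans super_ratioT; rewrite mulrC ler_wpM2l ?(ltW super_TR)//.
by have := super_jk_n; lra.
Qed.

Lemma super_ge_small : 0 < g * e /\ g * e <= 25^-1 * e.
Proof. by split; [exact: mulr_gt0|rewrite ler_wpM2r// ltW]. Qed.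

Lemma super_p1_le : super_p1 <= super_p.
Proof. by rewrite /super_p1 /super_p ler_wpM2r ?(ltW p0_gt0)//; have [] := super_ge_small; lra. Qed.

Lemma super_p1_gt0 : 0 < super_p1.
Proof. by rewrite /super_p1 mulr_gt0//; have [] := super_ge_small; move: super_e_gt0; lra. Qed.

#[local] Hint Resolve super_p1_le super_p1_gt0 : core.
Lemma super_n_le_cD : n%:R <= (cgeo k j)%:R * D%:R :> R.
Proof.
rewrite -natrM ler_nat; apply: (@leq_trans (n ^ (k - j))%N); last by apply: expn_le_deg.
by rewrite -{1}[n]expn1 leq_pexp2l// subn_gt0.
Qed.

Lemma super_gD : 9 <= g * D%:R.
Proof.
have c0 : 0 < (cgeo k j)%:R :> R by apply: lt_le_trans super_cR.
rewrite -(ler_pM2r c0); apply: le_trans (sr_x2 Hs) _.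
rewrite -mulrA ler_wpM2l// [leRHS]mulrC.
apply: le_trans super_n_le_cD; rewrite /x ler_piMr//; move: super_e_le1; lra.
Qed.

Lemma super_D_ge : 225 <= D%:R :> R.
Proof. by have := super_gD; have := ler_wpM2r (ltW super_DR) super_g_le; lra. Qed.

Lemma super_p0_small : p0 k j n <= 4^-1 :> R.
Proof.
rewrite p0E lef_pV2 ?posrE ?mulr_gt0//.
apply: (@le_trans _ _ (1 * T%:R)); last by rewrite ler_wpM2r.
by have := super_DT; have := super_D_ge; lra.
Qed.

Lemma super_p_small : super_p <= 2^-1.
Proof.
rewrite /super_p; have : (1 + e) * p0 k j n <= (1 + e) * 4^-1.
  by rewrite ler_wpM2l ?super_p0_small//; move: super_e_gt0; lra.
by move: super_e_le1; lra.
Qed.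

Lemma super_p01 : 0 <= super_p <= 1.
Proof. by apply/andP; split; move: super_p1_gt0 super_p1_le super_p_small; lra. Qed.
Lemma super_p_gt0 : 0 < super_p. Proof. exact: lt_le_trans super_p1_gt0 super_p1_le. Qed.
Lemma super_p101 : 0 <= super_p1 <= 1.
Proof. by apply/andP; split; move: super_p1_gt0 super_p1_le super_p_small; lra. Qed.

Lemma super_p1_lt1 : 0 < 1 - super_p1. Proof. by move: super_p1_le super_p_small; lra. Qed.

#[local] Hint Resolve super_p_gt0 super_p1_lt1 : core.
Lemma super_pE : 1 - super_p = (1 - super_p1) * (1 - super_p2).
Proof. by rewrite /super_p2; field; rewrite gt_eqF. Qed.

Lemma super_p201 : 0 <= super_p2 <= 1.
Proof.
apply/andP; split; first by rewrite divr_ge0 ?(ltW super_p1_lt1)// subr_ge0.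
by rewrite ler_pdivrMr// mul1r lerD2r; case/andP: super_p01.
Qed.

Lemma super_p2_ge : g * e * p0 k j n <= super_p2.
Proof.
rewrite ler_pdivlMr//; apply: (@le_trans _ _ (g * e * p0 k j n * 1)).
  rewrite ler_wpM2l//; last by move: super_p1_gt0; lra.
  by apply/ltW/mulr_gt0 => //; apply: mulr_gt0.
by rewrite mulr1 /super_p /super_p1; lra.
Qed.

Lemma super_pmD : super_p * m%:R * D%:R <= 1 + e.
Proof. by apply: mean_nbr_le; move: super_e_gt0; lra. Qed.

Lemma super_p1mD : super_p1 * m%:R * D%:R <= 1 + e.
Proof.
apply: le_trans super_pmD; rewrite ler_wpM2r ?(ltW super_DR)// ler_wpM2r ?(ltW super_m0R)//.
Qed.

Lemma super_p1mD_ge : 1 + (1 - 2 * g) * e <= super_p1 * m%:R * D%:R.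
Proof.
have [ge0 ge1] := super_ge_small.
have q0 : 0 <= 1 + (1 - g) * e by move: super_e_gt0 ge0 ge1; lra.
apply: le_trans (super_pmD_ge q0).
have h : (1 + (1 - g) * e) * (g * e) <= 2 * (g * e).
  by rewrite ler_wpM2r ?(ltW ge0)//; move: super_e_le1 super_e_gt0 ge0 ge1; lra.
by move: h; lra.
Qed.

(* [M0], of order [e ^- 2], separates the large components of [H^k(n,p)] from the others, while
   in [H^k(n,p1)] large means at least [M], a small fraction of the size of the giant. *)
Let zeta : R := g / (4 * m%:R) * e ^+ 2.
Let mu : R := (1 + g) * theta / D%:R.
Let q : R := zeta + mu * D%:R.
Let M0 : R := (g * zeta)^-1.
Let M : R := lam * e * N%:R.

Lemma super_e2_gt0 : 0 < e ^+ 2. Proof. by rewrite exprn_gt0. Qed.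
#[local] Hint Resolve super_e2_gt0 : core.
Lemma super_zeta_gt0 : 0 < zeta.
Proof. by apply: mulr_gt0 => //; apply: divr_gt0 => //; apply: mulr_gt0. Qed.
#[local] Hint Resolve super_zeta_gt0 : core.
Lemma super_mu_ge0 : 0 <= mu.
Proof.
apply: divr_ge0 => //; apply: mulr_ge0; last exact: ltW.
by move: super_g_gt0; lra.
Qed.
#[local] Hint Resolve super_mu_ge0 : core.
Lemma super_M0_gt0 : 0 < M0. Proof. by rewrite invr_gt0 mulr_gt0. Qed.
#[local] Hint Resolve super_M0_gt0 : core.
Lemma super_zM0 : zeta * M0 = g^-1. Proof. by rewrite /M0; field; rewrite !gt_eqF. Qed.

Lemma super_Hmu : expR (- mu) <= 1 - super_p + super_p * expR (- (m%:R * (zeta + mu * D%:R))).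
Proof.
exact: (supercritical_drift super_e_gt0 super_g_gt0 super_g_le (sr_e_le Hs) super_mR super_gD (ltW super_p_gt0) super_pmD).
Qed.

(** The right side decreases in the probability, so the same [zeta] and [mu] serve in the first
    round. *)
Lemma super_Hmu1 : expR (- mu) <= 1 - super_p1 + super_p1 * expR (- (m%:R * (zeta + mu * D%:R))).
Proof.
apply: le_trans super_Hmu _; set E := expR _.
have : E <= 1.
  rewrite /E -[leRHS]expR0 ler_expR oppr_le0 mulr_ge0// addr_ge0 ?(ltW super_zeta_gt0)//.
  by rewrite mulr_ge0.
by move=> E1; have := mulr_ge0 (_ : 0 <= super_p - super_p1) (_ : 0 <= 1 - E); rewrite !subr_ge0 => /(_ super_p1_le E1); lra.
Qed.

Lemma super_q_le : q <= (1 + 2 * g) * theta.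
Proof.
rewrite /q /mu divfK ?gt_eqF// mulrDl [leRHS]mulrDl mul1r.
have : zeta <= g * theta.
  rewrite /zeta /theta.
  have -> : g * (2 * e / m%:R) = g / (4 * m%:R) * (8 * e) by field; rewrite gt_eqF.
  rewrite ler_wpM2l ?divr_ge0 ?mulr_ge0 ?(ltW super_g_gt0)// expr2 ler_wpM2r ?(ltW super_e_gt0)//.
  by move: super_e_le1; lra.
by lra.
Qed.

Lemma super_q_gt0 : 0 < q.
Proof. by apply: ltr_wpDr => //; apply: mulr_ge0. Qed.

#[local] Hint Resolve super_q_gt0 : core.
Lemma super_dM0 : 1 - g <= 1 - expR (- (zeta * M0)).
Proof. by rewrite lerD2l lerN2 super_zM0 exp_inv_le. Qed.

Lemma super_ratio_le (d : R) : 1 - g <= d -> q / d <= (1 + 5 * g) * theta.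
Proof.
move=> gd; have d0 : 0 < d by move: gd super_g_le; lra.
rewrite ler_pdivrMr//; apply: le_trans super_q_le _.
apply: (@le_trans _ _ ((1 + 5 * g) * theta * (1 - g))); last first.
  rewrite ler_wpM2l// mulr_ge0 ?(ltW super_theta_gt0)//; move: super_g_gt0; lra.
rewrite mulrAC ler_wpM2r ?(ltW super_theta_gt0)//.
have := ler_wpM2l (ltW super_g_gt0) super_g_le; move: super_g_gt0; lra.
Qed.

Lemma super_inc_sub0 K : K \in U0 -> inc K \subset V0. Proof. by move=> _; exact: jsub_sub. Qed.

Lemma super_large (U : {set {set 'I_n}}) v : U \subset U0 -> v \in V0 ->
  Er super_p U (fun H => (M0 <= #|cl inc H [set v]|%:R)%R%:R) <= (1 + 5 * g) * theta.
Proof.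
move=> UU vV; apply: le_trans (super_ratio_le super_dM0).
exact: (Er_large1_le super_p01 (card_jsub jk) super_inc_sub0 (deg_ksets_le jk) (ltW super_zeta_gt0) super_mu_ge0 super_Hmu).
Qed.

Lemma super_m_le_M0 : m%:R <= M0.
Proof.
rewrite /M0 /zeta.
have -> : (g * (g / (4 * m%:R) * e ^+ 2))^-1 = m%:R * (4 / (g * e) ^+ 2).
  by field; rewrite !gt_eqF.
rewrite ler_peMr// ler_pdivlMr ?exprn_gt0//; last exact: mulr_gt0.
have [ge0 ge1] := super_ge_small; rewrite mul1r expr2.
have ge2 : g * e <= 1 by move: super_e_le1 ge1; lra.
by have := ler_pM (ltW ge0) (ltW ge0) ge2 ge2; lra.
Qed.

Lemma super_ratioM0 : 2 * M0 * ((1 + 5 * g) * theta) <= 20 * (g ^+ 2 * e)^-1.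
Proof.
have -> : 2 * M0 * ((1 + 5 * g) * theta) = (16 * (1 + 5 * g)) * (g ^+ 2 * e)^-1.
  by rewrite /M0 /zeta /theta; field; rewrite !gt_eqF.
rewrite ler_wpM2r ?invr_ge0 ?mulr_ge0 ?exprn_ge0//.
by move: super_g_le; lra.
Qed.

Lemma super_expo_ratio (c C : R) : 0 <= c -> (c * g + 1) * (1 + 2 * g) * 8 <= C ->
  (c + g^-1) / zeta * q <= C * (g ^+ 2 * e)^-1.
Proof.
move=> c0 cC; apply: (@le_trans _ _ ((c + g^-1) / zeta * ((1 + 2 * g) * theta))).
  by rewrite ler_wpM2l ?super_q_le// divr_ge0// addr_ge0// invr_ge0.
have -> : (c + g^-1) / zeta * ((1 + 2 * g) * theta) =
    (c * g + 1) * (1 + 2 * g) * 8 * (g ^+ 2 * e)^-1.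
  by rewrite /zeta /theta; field; rewrite !gt_eqF.
by rewrite ler_wpM2r ?invr_ge0 ?mulr_ge0 ?exprn_ge0//.
Qed.

Lemma super_small_le : (1 + zeta * M0) / zeta * q <= 9 * (g ^+ 2 * e)^-1.
Proof.
rewrite super_zM0; apply: super_expo_ratio => //.
have := ler_pM (ltW super_g_gt0) (ltW super_g_gt0) super_g_le super_g_le.
by move: super_g_le; lra.
Qed.

Lemma super_explored_le : (1 + zeta * (M0 + m%:R)) / zeta * q <= 18 * (g ^+ 2 * e)^-1.
Proof.
apply: (@le_trans _ _ (2 * ((2^-1 + g^-1) / zeta * q))).
  rewrite mulrA ler_wpM2r// mulrA ler_wpM2r ?invr_ge0// mulrDr super_zM0.
  have : zeta * m%:R <= zeta * M0 by rewrite ler_wpM2l// super_m_le_M0.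
  by rewrite super_zM0; lra.
have -> : 18 * (g ^+ 2 * e)^-1 = 2 * (9 * (g ^+ 2 * e)^-1) by ring.
rewrite ler_pM2l//; apply: super_expo_ratio => //.
have := ler_pM (ltW super_g_gt0) (ltW super_g_gt0) super_g_le super_g_le.
by move: super_g_le; lra.
Qed.

(** Absorbs the error terms of [super_giant], whose coefficients add up to [20 + 19 + 342 = 381]. It
    holds because [e ^+ 3 * N] is large. *)
Lemma super_extra_le : 400 * (g ^+ 4 * e)^-1 <= g * theta ^+ 2 * N%:R.
Proof.
have y1 : 100 * m%:R ^+ 2 / g ^+ 5 <= y.
  by apply: le_trans (sr_y2 Hs); rewrite ler_wpM2r ?invr_ge0 ?exprn_ge0// ler_wpM2r ?exprn_ge0//; lra.
have -> : 400 * (g ^+ 4 * e)^-1 = 4 * g / (m%:R ^+ 2 * e) * (100 * m%:R ^+ 2 / g ^+ 5).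
  by field; rewrite !gt_eqF.
have -> : g * theta ^+ 2 * N%:R = 4 * g / (m%:R ^+ 2 * e) * y.
  by rewrite /theta /y; field; rewrite !gt_eqF.
by rewrite ler_wpM2l// divr_ge0// mulr_ge0// exprn_ge0.
Qed.

(** The main term is [a * N * (q / d)]: a large component occurs with probability about [theta] and
    then contains, on average, about [theta * N] further vertices that are large. All else is of
    order [e^-1]. *)
Lemma super_giant v : v \in V0 ->
  Er super_p U0 (fun H => #|cl inc H [set v]|%:R * (M0 <= #|cl inc H [set v]|%:R)%R%:R) <=
  (1 + 12 * g) * theta ^+ 2 * N%:R.
Proof.
move=> vV; pose b := (1 + zeta * M0) / zeta * q; pose a := (1 + 5 * g) * theta.
have b0 : 0 <= b.
  by apply: mulr_ge0 => //; apply: divr_ge0 => //; apply: addr_ge0 => //; apply: mulr_ge0.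
have a0 : 0 <= a by apply: mulr_ge0 => //; move: super_g_gt0; lra.
have small (U' : {set {set 'I_n}}) v0 : U' \subset U0 -> v0 \in V0 ->
    Er super_p U' (fun H => #|cl inc H [set v0]|%:R * (#|cl inc H [set v0]|%:R < M0)%R%:R) <= b.
  move=> UU vV'.
  exact: (Er_small1_le super_p01 (card_jsub jk) super_inc_sub0 (deg_ksets_le jk) (ltW super_zeta_gt0) super_mu_ge0 super_Hmu).
have large v0 (vV' : v0 \in V0) (U : {set {set 'I_n}}) (UU : U \subset U0) :
    Er super_p U (fun H => (M0 <= #|cl inc H [set v0]|%:R)%R%:R) <= a := super_large UU vV'.
apply: le_trans (Er_giant_le super_p01 (card_jsub jk) super_inc_sub0 (deg_ksets_le jk)
  (ltW super_zeta_gt0) super_mu_ge0 super_Hmu super_zeta_gt0 super_M0_gt0 super_m_gt0 vV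
  a0 b0 (ltW super_e_gt0) super_pmD large small) _.
rewrite card_ksets -/m -/D -/q -/N.
set d := 1 - expR _; have d1 : 1 - g <= d := super_dM0.
have qd := super_ratio_le d1; rewrite -/a in qd.
pose w := (g ^+ 2 * e)^-1; have w0 : 0 < w by rewrite invr_gt0 mulr_gt0// exprn_gt0.
have -> : ((M0 + m%:R + a * N%:R) / d +
    super_p * m.+1%:R * b * (e * D%:R * ((1 + zeta * (M0 + m%:R)) / zeta))) * q +
    super_p * m.+1%:R * b * D%:R =
  (M0 + m%:R) * (q / d) + a * N%:R * (q / d) +
    super_p * m.+1%:R * D%:R * b * (1 + e * ((1 + zeta * (M0 + m%:R)) / zeta * q)).
  by ring.
have h1 : (M0 + m%:R) * (q / d) <= 20 * w.
  apply: le_trans super_ratioM0; rewrite -/a; apply: ler_pM => //.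
  - by apply: addr_ge0.
  - by apply: divr_ge0 => //; move: d1 super_g_le; lra.
  - by have := super_m_le_M0; lra.
have h2 : a * N%:R * (q / d) <= (1 + 11 * g) * theta ^+ 2 * N%:R.
  apply: (@le_trans _ _ (a * N%:R * a)); first by rewrite ler_wpM2l// mulr_ge0.
  have -> : a * N%:R * a = (1 + 5 * g) ^+ 2 * (theta ^+ 2 * N%:R) by rewrite /a; ring.
  rewrite -[leRHS]mulrA ler_wpM2r ?mulr_ge0 ?exprn_ge0//.
  have := ler_wpM2l (ltW super_g_gt0) super_g_le; rewrite -expr2.
  by have -> : (1 + 5 * g) ^+ 2 = 1 + 10 * g + 25 * g ^+ 2 by [ring]; lra.
have P0 : 0 <= super_p * m.+1%:R * D%:R by apply: mulr_ge0 => //; apply: mulr_ge0.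
have P1 : super_p * m.+1%:R * D%:R <= 2 + 9^-1.
  apply: (@le_trans _ _ (2 * (super_p * m%:R * D%:R))); last first.
    by have := super_pmD; move: super_e_le1; lra.
  have -> : 2 * (super_p * m%:R * D%:R) = super_p * (2 * m%:R) * D%:R by ring.
  rewrite ler_wpM2r// ler_wpM2l// -natr1; have := super_mR; lra.
have h3 : super_p * m.+1%:R * D%:R * b <= 19 * w.
  have := ler_pM P0 b0 P1 super_small_le; rewrite -/w; move: w0; lra.
have h4 : 0 <= e * ((1 + zeta * (M0 + m%:R)) / zeta * q) <= 18 / g ^+ 2.
  apply/andP; split.
    apply: mulr_ge0 => //; apply: mulr_ge0 => //; apply: divr_ge0 => //.
    by apply: addr_ge0 => //; apply: mulr_ge0 => //; apply: addr_ge0.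
  apply: (@le_trans _ _ (e * (18 * w))); first by rewrite ler_wpM2l// super_explored_le.
  by rewrite /w le_eqVlt; apply/orP; left; apply/eqP; field; rewrite !gt_eqF.
have g2 : 1 <= (g ^+ 2)^-1.
  rewrite invf_ge1 ?exprn_gt0// expr2.
  have := ler_pM (ltW super_g_gt0) (ltW super_g_gt0) super_g_le super_g_le; lra.
have h5 : super_p * m.+1%:R * D%:R * b * (1 + e * ((1 + zeta * (M0 + m%:R)) / zeta * q))
    <= 19 * w * (1 + 18 / g ^+ 2).
  case/andP: h4 => h40 h41; apply: ler_pM => //; [exact: mulr_ge0|exact: addr_ge0|by rewrite lerD2l].
have h6 : 20 * w + 19 * w * (1 + 18 / g ^+ 2) <= g * theta ^+ 2 * N%:R.
  apply: le_trans super_extra_le.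
  have -> : 400 * (g ^+ 4 * e)^-1 = 400 * (w * (g ^+ 2)^-1).
    by rewrite /w; field; rewrite !gt_eqF.
  have := ler_wpM2l (ltW w0) g2; set u := w * _; rewrite mulr1 => wu.
  have -> : 19 * w * (1 + 18 / g ^+ 2) = 19 * w + 342 * u by rewrite /u; ring.
  by lra.
have -> : (1 + 12 * g) * theta ^+ 2 * N%:R = (1 + 11 * g) * theta ^+ 2 * N%:R + g * theta ^+ 2 * N%:R by ring.
by move: h1 h2 h5 h6; set t1 := (_ * (q / d)); set t2 := (_ * (q / d)); set t3 := _ * (1 + e * _); set t4 := 19 * w * _; lra.
Qed.

Lemma super_N_le : N%:R <= n%:R ^+ j :> R.
Proof. by rewrite -natrX ler_nat bin_le_expn. Qed.

(** In units of [deg_scale * lam * x], the load threshold gives [load_const], the cost of [M] sets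
    takes at most [load_const - 2], and that of the last [m] sets at most 1. The remaining unit
    beats the number of targets by [sr_z1]. *)
Lemma super_degpot p' v : 0 < p' -> p' * m%:R * D%:R <= 1 + e -> v \in V0 ->
  degpot k j p' (load_const * lam * e * D%:R) M U0 [set v] <= g * theta ^+ 2.
Proof.
move=> p0 pmD vV.
have sp0 : 0 < spread R k j by apply: lt_le_trans super_spread1.
have A1 : 1 <= n%:R / spread R k j by have := sr_A Hs; lra.
have sc0 : 0 < deg_scale R k j.
  rewrite /deg_scale /deg_tau; apply: divr_gt0; last by apply: mulr_gt0 => //; apply: mulr_gt0.
  by rewrite invr_gt0; apply: mulr_gt0.
apply: le_trans (degpot_init j_gt0 jk kn (sr_A Hs) p0 _ _ _ vV) _.
  by apply: le_trans pmD _; rewrite lerD2l (sr_tau Hs).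
rewrite card_ksets -/m -/D -/N; apply: le_trans (sr_z1 Hs); apply: ler_pM; rewrite ?expR_ge0 ?super_N_le//.
rewrite ler_expR lerD2l lerN2.
have -> : deg_scale R k j * n%:R * (load_const * lam * e * D%:R) / D%:R =
    deg_scale R k j * lam * x * load_const by rewrite /x; field; rewrite gt_eqF.
have cM : deg_cost R n k j * M <= deg_scale R k j * lam * x * (load_const - 2).
  have -> : deg_cost R n k j * M = deg_scale R k j * lam * e * (load_const - 2) / n%:R ^+ j.-1 * N%:R.
    by rewrite /deg_cost /load_const /M addrK expr_div_n; field; rewrite !gt_eqF ?exprn_gt0.
  have -> : deg_scale R k j * lam * x * (load_const - 2) =
      deg_scale R k j * lam * e * (load_const - 2) / n%:R ^+ j.-1 * n%:R ^+ j.
    have -> : n%:R ^+ j = n%:R * n%:R ^+ j.-1 :> R by rewrite -exprS prednK.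
    by rewrite /x; field; rewrite !gt_eqF ?exprn_gt0.
  rewrite ler_wpM2l ?super_N_le// divr_ge0 ?exprn_ge0// mulr_ge0//; last first.
    by have := super_load_const_ge2; lra.
  by apply: mulr_ge0 => //; apply: mulr_ge0 => //; exact: ltW.
have cm : deg_cost R n k j * m%:R <= deg_scale R k j * lam * x.
  rewrite -mulrA; apply: (@le_trans _ _ (deg_scale R k j * (3 * deg_big R k j * m%:R))); last first.
    by rewrite ler_wpM2l ?(ltW sc0) ?(sr_x4 Hs).
  have -> : deg_scale R k j * (3 * deg_big R k j * m%:R) = 3 * deg_scale R k j * deg_big R k j * m%:R.
    by ring.
  rewrite ler_wpM2r// /deg_cost ler_pdivrMr ?exprn_gt0 ?ler_peMr ?exprn_ege1//.
  - by apply: mulr_ge0 => //; apply: mulr_ge0 => //; exact: ltW.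
  - exact: lt_le_trans A1.
have -> : deg_cost R n k j * (M + m%:R) = deg_cost R n k j * M + deg_cost R n k j * m%:R by ring.
move: cM cm; rewrite mulrBr; set S := deg_scale _ _ _ * _ * _.
set c1 := _ * M; set c2 := _ * m%:R; set c3 := S * load_const; lra.
Qed.

Lemma super_mean_half : 2^-1 <= super_p1 * m%:R * D%:R.
Proof.
have [ge0 ge1] := super_ge_small.
by apply: le_trans super_p1mD_ge; move: super_e_gt0 ge1; lra.
Qed.

Lemma super_M_gt0 : 0 < M.
Proof. by apply: mulr_gt0 => //; apply: mulr_gt0. Qed.

Lemma super_degpot_bad (p' : R) (U F : {set {set 'I_n}}) u : 0 < p' -> state inc U0 V0 U0 U F ->
  #|F|%:R <= M + m%:R -> u \in V0 -> load_const * lam * e * D%:R < (load inc U0 F u)%:R ->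
  1 <= degpot k j p' (load_const * lam * e * D%:R) M U F.
Proof.
move=> p0 st; apply: degpot_bad => //; first exact: sr_A Hs.
by case: st.
Qed.

Lemma super_codeg (u v : {set 'I_n}) : u != v ->
  (codeg inc U0 u v)%:R <= (cgeo k j)%:R * D%:R / n%:R :> R.
Proof.
move=> uv; rewrite ler_pdivlMr// -!natrM ler_nat.
exact: codeg_bound1.
Qed.

Lemma super_survival v : v \in V0 ->
  (1 - 6 * g) * theta <= Er super_p1 U0 (fun H => (M <= #|cl inc H [set v]|%:R)%R%:R).
Proof.
move=> vV; pose eta := load_const * lam * e; pose rho : R := (cgeo k j)%:R * D%:R / n%:R.
pose kap := m.+1%:R * (eta + m%:R * ((cgeo k j)%:R / n%:R)) / m%:R.
(* A little below [theta], so that [m * x1 / 2 = (1 - 4 * g) * e], the last factor in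
   [survival_drift]. *)
pose x1 := (1 - 4 * g) * theta.
have [ge0 ge1] := super_ge_small.
have eta0 : 0 <= eta by apply: mulr_ge0 => //; apply: mulr_ge0.
have etaE : eta = g * e / 4 by rewrite /eta super_lamE; ring.
have mc : m%:R * ((cgeo k j)%:R / n%:R) <= g * e / 4.
  by rewrite mulrA ler_pdivrMr//; have := sr_x1 Hs; rewrite /x; lra.
have kap0 : 0 <= kap.
  by rewrite divr_ge0// mulr_ge0// addr_ge0// mulr_ge0// divr_ge0.
have kap1 : kap <= g * e.
  rewrite ler_pdivrMr// [leRHS]mulrC; apply: (@le_trans _ _ (2 * m%:R * (g * e / 2))); last by lra.
  apply: ler_pM => //.
  - by rewrite addr_ge0// mulr_ge0// divr_ge0.
  - by rewrite -natr1; have := super_mR; lra.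
  - by move: mc; rewrite etaE; lra.
have kapl : 0 < 1 - kap by move: super_e_le1; lra.
have x10 : 0 < x1 by apply: mulr_gt0 => //; move: super_g_le; lra.
have mx1 : m%:R * x1 = (1 - 4 * g) * (2 * e).
  by rewrite /x1 /theta; field; rewrite gt_eqF.
(* Makes the inequality [h2] between [x1] and [mu1] an equality. *)
pose mu1 := x1 / (m%:R * D%:R * (1 - kap)).
have mD0 : 0 < m%:R * D%:R :> R by apply: mulr_gt0.
have mDk0 : 0 < m%:R * D%:R * (1 - kap) by apply: mulr_gt0.
have mu10 : 0 <= mu1 by apply: divr_ge0; apply: ltW.
have drift := survival_drift super_e_gt0 super_g_gt0 super_g_le _ kap0 kap1 super_p1mD_ge.
have {}drift : 1 <= super_p1 * m%:R * D%:R * (1 - kap) * (1 - (1 - 4 * g) * e).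
  by apply: drift; have := sr_e_le Hs; move: super_e_gt0; lra.
have h1 : m%:R * x1 <= 1.
  rewrite mx1; have := ler_wpM2r (ltW super_e_gt0) (_ : 1 - 4 * g <= 1).
  by move: super_e_le1 super_g_gt0 => ? ? /(_ _); lra.
have h2 : x1 <= mu1 * (m%:R * D%:R - m.+1%:R * (eta * D%:R + m%:R * rho)).
  rewrite le_eqVlt; apply/orP; left; apply/eqP.
  have -> : m%:R * D%:R - m.+1%:R * (eta * D%:R + m%:R * rho) = m%:R * D%:R * (1 - kap).
    by rewrite /kap /rho; field; rewrite !gt_eqF.
  by rewrite /mu1 divfK// gt_eqF.
have h3 : mu1 <= super_p1 * (x1 * (1 - m%:R * x1 / 2)).
  rewrite ler_pdivrMr// mx1.
  have -> : super_p1 * (x1 * (1 - (1 - 4 * g) * (2 * e) / 2)) * (m%:R * D%:R * (1 - kap)) =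
    x1 * (super_p1 * m%:R * D%:R * (1 - kap) * (1 - (1 - 4 * g) * e)) by field.
  by rewrite ler_peMr// ltW.
have stepP (U F : {set {set 'I_n}}) K : state inc U0 V0 U0 U F -> K \in active inc U F ->
    stp inc super_p1 (degpot k j super_p1 (eta * D%:R) M) U F K <=
    degpot k j super_p1 (eta * D%:R) M U F.
  apply: stp_degpot => //; first exact: sr_A Hs.
    by case/andP: super_p101.
  by apply: le_trans super_p1mD _; rewrite lerD2l (sr_tau Hs).
have ext := Er_extinct_le super_p101 (card_jsub jk) super_inc_sub0 (deg_ksets jk)
  (@degpot_ge0 R n k j super_p1 (eta * D%:R) M) stepP
  (fun U F u => @super_degpot_bad super_p1 U F u super_p1_gt0) super_codeg super_m_gt0
  super_M_gt0 vV mu10 (ltW x10) h1 h2 h3.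
have -> : Er super_p1 U0 (fun H => (M <= #|cl inc H [set v]|%:R)%R%:R) =
    1 - Er super_p1 U0 (fun H => (#|cl inc H [set v]|%:R < M)%R%:R).
  rewrite -[X in X - _](Er_cst super_p1 U0) -mulN1r -ErZ -ErD; apply: eq_Er => H _.
  by rewrite leNgt; case: (_ < _) => /=; ring.
have dp := super_degpot super_p1_gt0 super_p1mD vV; rewrite -/eta in dp.
have h4 : x1 <= mu1 * (m%:R * D%:R).
  have -> : mu1 * (m%:R * D%:R) = x1 / (1 - kap) by rewrite /mu1; field; rewrite !gt_eqF.
  rewrite ler_pdivlMr// ler_piMr ?(ltW x10)//.
  by lra.
have h5 : expR (- (mu1 * (m%:R * D%:R))) <= 1 - x1 + x1 ^+ 2 / 2.
  by apply: le_trans (expRN_le (ltW x10)); rewrite ler_expR lerN2.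
have h6 : theta ^+ 2 <= 9^-1 * (g * theta).
  rewrite expr2 [leRHS]mulrA ler_wpM2r//.
  by have := super_theta_le; have := sr_e_le Hs; lra.
have h7 : x1 ^+ 2 <= theta ^+ 2.
  have xt : x1 <= theta by rewrite /x1 ler_piMl//; move: super_g_gt0; lra.
  by rewrite ler_sqr ?nnegrE// ltW.
have h8 : g * theta ^+ 2 <= 25^-1 * theta ^+ 2 by rewrite ler_wpM2r ?exprn_ge0.
by move: ext dp h5 h6 h7 h8; rewrite /x1; set E1 := Er _ _ _; set E2 := expR _; set E3 := degpot _ _ _ _ _ _ _; have : 0 < g * theta by [apply: mulr_gt0]; set t := theta ^+ 2; lra.
Qed.

Lemma super_M0_le_M : M0 <= M.
Proof.
have -> : M0 = 4 * m%:R / g ^+ 2 / e ^+ 2 by rewrite /M0 /zeta; field; rewrite !gt_eqF.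
have -> : M = lam * y / e ^+ 2 by rewrite /M /y; field; rewrite gt_eqF.
by rewrite ler_wpM2r ?invr_ge0 ?(sr_y1 Hs).
Qed.

Lemma super_ratioM : q / (1 - expR (- (zeta * M))) <= (1 + 5 * g) * theta.
Proof.
apply: super_ratio_le; apply: le_trans super_dM0 _.
by rewrite lerD2l lerN2 ler_expR lerN2 ler_wpM2l// super_M0_le_M.
Qed.

Lemma expn_le_bin : n%:R ^+ j <= bin_const * N%:R :> R.
Proof.
rewrite /bin_const -natrM -natrX ler_nat -mulnA [(j`! * _)%N]mulnC bin_ffact.
have : (n ^ j <= 2 ^ j * (n - j) ^ j)%N by rewrite -expnMn leq_exp2r//; lia.
by move=> h; apply: leq_trans h _; apply: leq_mul => //; apply: ffact_ge.
Qed.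

Lemma super_n_le_N : n%:R <= N%:R :> R.
Proof. by rewrite ler_nat; apply: leq_bin; lia. Qed.

Lemma bin_const_gt0 : 0 < bin_const.
Proof. by rewrite /bin_const ltr0n muln_gt0 expn_gt0 fact_gt0. Qed.

(** Two sets of size [M] with a fair share of common edges have about [e ^+ 2 * N * D] of them, and
    [super_p2] is at least of order [g * e / D]. The expected number of sprinkled ones, of order
    [e ^+ 3 * N], is therefore at least [g^-1]. *)
Lemma super_retain l :
  mix_coef R k j / 8 * M * (M * m%:R * D%:R / n%:R ^+ j) <= (m.+1 ^ 2 * l)%:R ->
  (1 - super_p2) ^+ l <= g.
Proof.
move=> hl; apply: le_trans (exp_inv_le super_g_gt0).
have [p20 p21] := andP super_p201.
apply: (@le_trans _ _ (expR (- super_p2) ^+ l)).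
  by rewrite lerXn2r ?nnegrE ?expR_ge0 ?subr_ge0// expR_ge1Dx.
rewrite -expRM_natr ler_expR mulNr lerN2.
have c0 : 0 < mix_coef R k j by apply: mix_coef_gt0.
have b0 := bin_const_gt0.
have m1 : 0 < m.+1%:R :> R by rewrite ltr0n.
have nj : 0 < n%:R ^+ j :> R by rewrite exprn_gt0.
have DT2 : 2^-1 <= D%:R / T%:R :> R.
  rewrite ler_pdivlMr//; apply: le_trans super_ratioT; rewrite mulrC ler_wpM2l//.
  by have := super_jk_n; have [ge0 ge1] := super_ge_small; move: super_e_le1; lra.
have Nn : bin_const^-1 <= N%:R / n%:R ^+ j.
  by rewrite ler_pdivlMr// mulrC ler_pdivrMr// mulrC expn_le_bin.
have l1 : mix_coef R k j / 8 * M * (M * m%:R * D%:R / n%:R ^+ j) / m.+1%:R ^+ 2 <= l%:R.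
  by rewrite ler_pdivrMr ?exprn_gt0// [leRHS]mulrC -[m.+1%:R ^+ 2]natrX -[leRHS]natrM.
apply: (@le_trans _ _ (g * e * p0 k j n *
    (mix_coef R k j / 8 * M * (M * m%:R * D%:R / n%:R ^+ j) / m.+1%:R ^+ 2))); last first.
  apply: ler_pM => //.
  - by apply: mulr_ge0 => //; apply: mulr_ge0.
  - apply/ltW/divr_gt0; last by rewrite exprn_gt0.
    have M0' := super_M_gt0; apply: mulr_gt0.
      by apply: mulr_gt0 => //; apply: divr_gt0.
    by apply: divr_gt0 => //; apply: mulr_gt0 => //; apply: mulr_gt0.
  - exact: super_p2_ge.
have G0 : 0 < g * mix_coef R k j * lam ^+ 2.
  by apply: mulr_gt0; [exact: mulr_gt0|rewrite exprn_gt0].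
rewrite p0E.
have -> : g * e * (m%:R * T%:R)^-1 *
    (mix_coef R k j / 8 * M * (M * m%:R * D%:R / n%:R ^+ j) / m.+1%:R ^+ 2) =
    g * mix_coef R k j * lam ^+ 2 / (8 * m.+1%:R ^+ 2) * y * ((D%:R / T%:R) * (N%:R / n%:R ^+ j)).
  by rewrite /M /y; field; rewrite !gt_eqF ?exprn_gt0.
apply: (@le_trans _ _ (g * mix_coef R k j * lam ^+ 2 / (8 * m.+1%:R ^+ 2) * y * (2^-1 / bin_const))).
  have -> : g * mix_coef R k j * lam ^+ 2 / (8 * m.+1%:R ^+ 2) * y * (2^-1 / bin_const) =
    g * mix_coef R k j * lam ^+ 2 / (16 * bin_const * m.+1%:R ^+ 2) * y.
    by field; rewrite !gt_eqF ?exprn_gt0.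
  have -> : g^-1 = g * mix_coef R k j * lam ^+ 2 / (16 * bin_const * m.+1%:R ^+ 2) *
      (16 * bin_const * m.+1%:R ^+ 2 / (g ^+ 2 * mix_coef R k j * lam ^+ 2)).
    by field; rewrite !gt_eqF ?exprn_gt0.
  rewrite ler_wpM2l ?(sr_y3 Hs)//; apply/ltW/divr_gt0 => //.
  by apply: mulr_gt0; [exact: mulr_gt0|rewrite exprn_gt0].
rewrite ler_wpM2l//; last by apply: ler_pM => //; rewrite invr_ge0 ltW.
by apply/ltW/mulr_gt0 => //; apply/divr_gt0 => //; apply: mulr_gt0 => //; rewrite exprn_gt0.
Qed.

(** For the second exploration [B] adds the probability of collecting too little load and that of
    surviving while the sprinkling fails. It is multiplied by the survival probability from [v1],
    and the failure of the load bound is added; the factors 3 and 2 for bounded terms give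
    [3 * 2 + 1 = 7]. *)
Lemma super_split v1 v2 : v1 \in V0 -> v2 \in V0 ->
  Er super_p1 U0 (disjoint_giants inc U0 M super_p2 v2 ^~ [set v1]) <= 7 * g * theta ^+ 2.
Proof.
move=> v1V v2V; pose L := load_const * lam * e * D%:R.
pose B := g * theta ^+ 2 + g * ((1 + 5 * g) * theta).
have c0 : 0 < mix_coef R k j by apply: mix_coef_gt0.
have b0 := bin_const_gt0.
have nj : 0 < n%:R ^+ j :> R by rewrite exprn_gt0.
have Q0 : 0 < mix_ratio by apply: mulr_gt0.
have t2 : 0 <= theta ^+ 2 by rewrite exprn_ge0.
have B0 : 0 <= B.
  apply: addr_ge0; apply: mulr_ge0 => //; apply: mulr_ge0 => //.
  by move: super_g_gt0; lra.
have avoid (U F : {set {set 'I_n}}) : state inc U0 V0 U0 U F -> good inc U0 V0 L F ->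
    (M <= #|F|%:R) && (#|F|%:R <= M + m%:R) ->
    Er super_p1 U (avoids inc U0 M super_p2 F ^~ [set v2]) <= B.
  move=> st gd /andP[MF FM]; case: (st) => UU [FV _].
  have p1le1 : super_p1 <= 1 by case/andP: super_p101.
  have gd' u : u \in V0 -> (load inc U0 F u)%:R <= L by move=> uV; exact: (forall_inP gd).
  have LQ : L <= mix_ratio * (M * m%:R * D%:R / n%:R ^+ j).
    have -> : mix_ratio * (M * m%:R * D%:R / n%:R ^+ j) =
        L * (m%:R * (bin_const * N%:R / n%:R ^+ j)).
      by rewrite /mix_ratio /M /L; field; rewrite gt_eqF.
    rewrite ler_peMr; first by [].
      by apply/ltW/mulr_gt0 => //; apply: mulr_gt0 => //; apply: mulr_gt0.
    by rewrite -[leLHS]mulr1; apply: ler_pM => //; rewrite ler_pdivlMr// mul1r expn_le_bin.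
  have e01 : 0 <= e <= 1 by apply/andP; split => //; move: super_e_le1; lra.
  have := Er_avoids_mixing j_gt0 jk kn super_p1_gt0 p1le1 super_p201 super_zeta_gt0
    super_mu_ge0 super_Hmu1 super_M_gt0 FV MF gd' (ltW Q0) LQ e01 super_p1mD super_mean_half
    (sr_mix Hs) (ltW super_g_gt0) super_retain UU v2V.
  move=> h; apply: le_trans h _; apply: lerD; last by rewrite ler_wpM2l// super_ratioM.
  apply: le_trans (sr_z2 Hs); rewrite ler_expR lerD2l lerN2 -[leLHS]mulrA ler_wpM2l//.
    by apply/ltW/divr_gt0 => //; apply: mulr_gt0 => //; apply: mix_scale_gt0 => //; exact: ltW.
  have -> : lam * x = lam * e * n%:R by rewrite /x; ring.
  by rewrite ler_wpM2l ?super_n_le_N//; apply/ltW/mulr_gt0.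
have stepP (U F : {set {set 'I_n}}) K : state inc U0 V0 U0 U F -> K \in active inc U F ->
    stp inc super_p1 (degpot k j super_p1 L M) U F K <= degpot k j super_p1 L M U F.
  apply: stp_degpot => //; first exact: sr_A Hs.
    by case/andP: super_p101.
  by apply: le_trans super_p1mD _; rewrite lerD2l (sr_tau Hs).
apply: le_trans (Er_disjoint_giants_le super_p101 (card_jsub jk) super_inc_sub0 (deg_ksets_le jk)
  (@degpot_ge0 R n k j super_p1 L M) stepP
  (fun U F u => @super_degpot_bad super_p1 U F u super_p1_gt0) super_m_gt0
  super_M_gt0 super_p201 super_zeta_gt0 super_mu_ge0 super_Hmu1 v1V v2V B0 avoid) _.
have dp := super_degpot super_p1_gt0 super_p1mD v1V; rewrite -/L in dp.
have h1 : B * (q / (1 - expR (- (zeta * M)))) <= B * ((1 + 5 * g) * theta).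
  by rewrite ler_wpM2l// super_ratioM.
apply: le_trans (lerD h1 dp) _.
have -> : B * ((1 + 5 * g) * theta) + g * theta ^+ 2 =
    ((theta + (1 + 5 * g)) * (1 + 5 * g) + 1) * (g * theta ^+ 2) by rewrite /B; ring.
rewrite -[leRHS]mulrA ler_wpM2r ?mulr_ge0//.
have g5 : 0 <= 1 + 5 * g <= 2 by apply/andP; split; move: super_g_gt0 super_g_le; lra.
have [g50 g52] := andP g5.
have t1 : 0 <= theta + (1 + 5 * g) <= 3.
  by apply/andP; split; [exact: addr_ge0|move: super_theta_le super_e_le1; lra].
by case/andP: t1 => t10 t11; have := ler_pM t10 g50 t11 g52; lra.
Qed.

Lemma super_two_M0_le : 2 * M0 <= theta * N%:R.
Proof.
have -> : 2 * M0 = 2 / (m%:R * e ^+ 2) * (4 * m%:R ^+ 2 / g ^+ 2).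
  by rewrite /M0 /zeta; field; rewrite !gt_eqF.
have -> : theta * N%:R = 2 / (m%:R * e ^+ 2) * y by rewrite /theta /y; field; rewrite !gt_eqF.
have g5 : (g ^+ 2)^-1 <= (g ^+ 5)^-1.
  rewrite lef_pV2 ?posrE ?exprn_gt0// ler_wiXn2l//.
  by move: super_g_le; lra.
rewrite ler_wpM2l//; first by apply/ltW/divr_gt0 => //; apply: mulr_gt0.
apply: le_trans (sr_y2 Hs); apply: ler_pM => //.
- by rewrite invr_ge0 exprn_ge0.
- by rewrite ler_wpM2r ?exprn_ge0//; lra.
Qed.

(** A component other than the giant has size at most [M0], of order [e ^- 2], or at most
    [5 * t * theta * N]; since [theta <= 2 * e], the latter explains the condition
    [10 * t <= gamma]. *)
Lemma super_giant_component (gamma t : R) : 0 < t <= 10^-1 -> 10 * t <= gamma ->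
  4 * m%:R / g ^+ 2 <= gamma * y ->
  1 - 49 * g / t ^+ 2 <= hprob n k ((1 + e) * p0 k j n)
    (fun H => [exists J0 : {set 'I_n},
       [&& #|J0| == j,
           [forall J : {set 'I_n}, (#|J| == j) ==> (#|jcomp j H J| <= #|jcomp j H J0|)%N],
           `| #|jcomp j H J0|%:R - 2 * e / ('C(k, j)%:R - 1) * 'C(n, j)%:R |
             <= gamma * (2 * e / ('C(k, j)%:R - 1) * 'C(n, j)%:R) &
           [forall J : {set 'I_n}, ((#|J| == j) && (jcomp j H J != jcomp j H J0)) ==>
              (#|jcomp j H J|%:R <= gamma * e * n%:R ^+ j)]]]).
Proof.
move=> t01 tg gy; have [t0 t1] := andP t01.
have aE : theta * #|V0|%:R = 2 * e / ('C(k, j)%:R - 1) * 'C(n, j)%:R.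
  have -> : 'C(k, j)%:R - 1 = m%:R :> R by rewrite (bin_predK jk) -natr1 addrK.
  by rewrite card_ksets.
have a0 : 0 < theta * #|V0|%:R by rewrite card_ksets mulr_gt0.
have kV (J : {set 'I_n}) : (J \in V0) = (#|J| == j) by rewrite inE.
have Nn : e * N%:R <= e * n%:R ^+ j by rewrite ler_wpM2l ?super_N_le.
rewrite hprobE; apply: (prob_giant super_p101 super_p201 super_pE super_M0_le_M a0 t0).
- move=> H1 H2 HU1 HU2 h1 h2 h3.
  have M2 : 2 * M0 <= theta * #|V0|%:R by rewrite card_ksets super_two_M0_le.
  have [v0 v0V [mx cl0 oth]] :=
    giant_of_moments super_inc_sub0 HU1 HU2 super_M0_le_M M2 a0 t01 h1 h2 h3.
  have cE (J : {set 'I_n}) : #|J| == j -> jcomp j (H1 :|: H2) J = cl inc (H1 :|: H2) [set J].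
    by move=> Jj; rewrite jcompE// kV.
  have v0j : #|v0| == j by rewrite -kV.
  apply/existsP; exists v0; rewrite v0j /= (cE _ v0j); apply/and3P; split.
  + by apply/forallP => J; apply/implyP => Jj; rewrite cE// mx// kV.
  + rewrite -aE; apply: le_trans cl0 _; rewrite ler_wpM2r ?(ltW a0)//; lra.
  + apply/forallP => J; apply/implyP => /andP[Jj]; rewrite cE// => Jn.
    have [|h|h] := oth J _ Jn; first by rewrite kV.
      apply: le_trans h _; rewrite -[leRHS]mulrA; apply: (@le_trans _ _ (gamma * (e * N%:R))); last first.
        by rewrite ler_wpM2l//; lra.
      have -> : M0 = 4 * m%:R / g ^+ 2 / e ^+ 2 by rewrite /M0 /zeta; field; rewrite !gt_eqF.
      by rewrite ler_pdivrMr//; apply: le_trans gy _; rewrite /y le_eqVlt; apply/orP; left; apply/eqP; ring.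
    apply: le_trans h _; rewrite -[leRHS]mulrA; apply: (@le_trans _ _ (gamma * (e * N%:R))); last first.
      by rewrite ler_wpM2l//; lra.
    apply: (@le_trans _ _ (10 * t * (e * N%:R))); last first.
      by rewrite ler_wpM2r// mulr_ge0.
    have -> : 10 * t * (e * N%:R) = 5 * t * (2 * e * N%:R) by ring.
    rewrite ler_wpM2l//; first by apply: mulr_ge0 => //; exact: ltW.
    by rewrite card_ksets ler_wpM2r// super_theta_le.
- by move=> v vV; apply: super_survival.
- by move=> v vV; apply: super_large.
- by move=> v vV; rewrite card_ksets; apply: super_giant.
- by move=> v1 v2 v1V v2V; apply: super_split.
Qed.

End Supercritical.

(** * The subcritical case for a fixed large [n] *)

Section Subcritical.
Variables (R : realType) (n k j : nat).
Hypotheses (j_gt0 : (0 < j)%N) (jk : (j < k)%N) (kn : (2 * k <= n)%N).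

Local Notation inc := (@jsub n j).
Local Notation U0 := (ksets n k).
Local Notation V0 := (ksets n j).
Let m := ('C(k, j)).-1.
Let D := 'C(n - j, k - j).

Lemma p0_le1 : 0 < (p0 k j n : R) <= 1.
Proof.
have h : (0 < m * 'C(n, k - j))%N by rewrite muln_gt0 bin_pred_gt0//= bin_gt0; lia.
by rewrite p0E// -natrM invr_gt0 ltr0n h invf_le1 ?ltr0n// ler1n.
Qed.

Variable e : R.
Hypotheses (e_gt0 : 0 < e) (e_le1 : e <= 1).

Lemma sub_p01 : 0 <= (1 - e) * p0 k j n <= 1.
Proof.
have /andP[p0 p1] := p0_le1.
by rewrite mulr_ge0 ?subr_ge0 ?(ltW p0)// mulr_ile1 ?subr_ge0 ?(ltW p0)// gerBl ltW.
Qed.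

(** Markov's inequality for the exponential moment. The initial exponent [zeta + mu * D] is at most
    [1/32 + 1/8], and is rounded up to 1. *)
Lemma sub_large_component (J : {set 'I_n}) (T : R) : J \in V0 ->
  Er ((1 - e) * p0 k j n) U0 (fun H => (T < #|cl inc H [set J]|%:R)%R%:R) <=
  expR (1 - e ^+ 2 / (32 * m%:R) * T).
Proof.
move=> JV; pose p : R := (1 - e) * p0 k j n.
have m1 : 1 <= m%:R :> R by rewrite ler1n bin_pred_gt0.
have m0 : 0 < m%:R :> R by apply: lt_le_trans m1.
have D0 : 0 < D%:R :> R by rewrite ltr0n bin_gt0; lia.
pose zeta := e ^+ 2 / (32 * m%:R); pose mu := e / (8 * m%:R * D%:R).
have zeta0 : 0 <= zeta by rewrite divr_ge0 ?exprn_ge0 ?mulr_ge0 ?(ltW e_gt0) ?(ltW m0).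
have mu0 : 0 <= mu by rewrite divr_ge0 ?mulr_ge0 ?(ltW e_gt0).
have /andP[pge0 _] := sub_p01.
have pmD : p * m%:R * D%:R <= 1 - e by apply: mean_nbr_le => //; rewrite subr_ge0.
have Hmu := subcritical_drift e_gt0 e_le1 m1 D0 pge0 pmD.
have sub0 K : K \in U0 -> inc K \subset V0 by move=> _; exact: jsub_sub.
have := Er_inv_gfun sub_p01 (card_jsub jk) sub0 (deg_ksets_le jk) zeta0 mu0 Hmu (state_init inc U0 JV).
rewrite /gfun expRN invrK cards1 mulr1 => h.
apply: (@le_trans _ _ (expR (- (zeta * T)) * expR 1)); last by rewrite -expRD addrC.
apply: (@le_trans _ _ (expR (- (zeta * T)) *
    Er p U0 (fun H => expR (zeta * #|cl inc H [set J]|%:R)))).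
  rewrite -ErZ; apply: le_Er; first exact: sub_p01.
  move=> H _; rewrite -expRD; case: ltP => hT; last exact: expR_ge0.
  by rewrite -[leLHS]expR0 ler_expR addrC -mulrBr mulr_ge0 ?subr_ge0 ?(ltW hT).
rewrite ler_wpM2l ?expR_ge0//; apply: le_trans h _; rewrite ler_expR.
have act : (#|active inc U0 [set J]| <= D)%N.
  apply: leq_trans (deg_ksets_le jk J); apply/subset_leq_card/subsetP => K.
  by rewrite !inE touch1 !inE.
have z1 : zeta <= 32^-1.
  rewrite /zeta ler_pdivrMr ?mulr_gt0// mulrA mulVf// mul1r; apply: le_trans m1.
  by rewrite exprn_ile1 ?(ltW e_gt0).
have m8 : mu * D%:R <= 8^-1.
  have -> : mu * D%:R = e / (8 * m%:R) by rewrite /mu; field; rewrite !gt_eqF.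
  by rewrite ler_pdivrMr ?mulr_gt0// mulrA mulVf// mul1r; apply: le_trans m1.
have : mu * #|active inc U0 [set J]|%:R <= mu * D%:R by rewrite ler_wpM2l// ler_nat.
lra.
Qed.

(** The factor [j.+1] makes the exponent equal to [j.+1 * ln n], so that the union bound over at
    most [n ^ j] sets leaves [expR 1 / n]. *)
Lemma sub_components : 1 - expR 1 / n%:R <= hprob n k ((1 - e) * p0 k j n)
  (fun H => [forall J : {set 'I_n}, (#|J| == j) ==>
     (#|jcomp j H J|%:R <= 32 * m%:R * j.+1%:R * e ^- 2 * ln (n%:R : R))]).
Proof.
rewrite hprobE; set T := _ * ln _; set p := _ * p0 k j n.
have m0 : 0 < m%:R :> R by rewrite ltr0n bin_pred_gt0.
have n0 : 0 < n%:R :> R by rewrite ltr0n; lia.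
have zT : e ^+ 2 / (32 * m%:R) * T = j.+1%:R * ln n%:R.
  by rewrite /T; field; rewrite !gt_eqF.
pose bad H : R := \sum_(J in V0) (T < #|cl inc H [set J]|%:R)%R%:R.
have : Er p U0 (fun H => 1 + -1 * bad H) <= Er p U0 (fun H => [forall J : {set 'I_n}, (#|J| == j) ==>
     (#|jcomp j H J|%:R <= T)]%:R).
  apply: le_Er; first exact: sub_p01.
  move=> H _; rewrite mulN1r; have bad0 : 0 <= bad H by apply: sumr_ge0.
  case: (boolP [forall _, _]) => [_|]; first by rewrite gerBl.
  rewrite negb_forall => /existsP[J]; rewrite negb_imply -ltNge => /andP[Jj].
  have JV : J \in V0 by rewrite inE.
  rewrite jcompE// => hJ; rewrite subr_le0 /bad (bigD1 J)//= hJ lerDl.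
  exact: sumr_ge0.
rewrite ErD ErZ Er_cst mulN1r => h; apply: le_trans h; rewrite lerD2l lerN2 /bad Er_sum.
have h J : J \in V0 -> Er p U0 (fun H => (T < #|cl inc H [set J]|%:R)%R%:R) <=
    expR 1 / n%:R ^+ j.+1.
  move=> JV; apply: le_trans (sub_large_component T JV) _.
  by rewrite zT expRD expRN expRM_natl lnK// posrE.
apply: le_trans (ler_sum _ h) _; rewrite sumr_const card_ksets -[leLHS]mulr_natl.
have -> : expR 1 / n%:R = n%:R ^+ j * (expR 1 / n%:R ^+ j.+1) :> R.
  by rewrite exprS; field; rewrite gt_eqF ?exprn_gt0//=; rewrite gt_eqF.
rewrite ler_wpM2r ?divr_ge0 ?expR_ge0 ?exprn_ge0//.
by rewrite -natrX ler_nat bin_le_expn.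
Qed.

End Subcritical.

Local Open Scope classical_set_scope.
Local Open Scope ring_scope.

(** * Passage to the limit *)

Section Asymptotics.
Variables (R : realType) (k j : nat) (eps : nat -> R).
Hypotheses (j_gt0 : (0 < j)%N) (jk : (j < k)%N).

Lemma hprob_le1 n (p : R) A : 0 <= p <= 1 -> hprob n k p A <= 1.
Proof.
move=> p01; rewrite hprobE -[leRHS](Er_cst p (ksets n k)); apply: le_Er => // H _.
by case: (A H).
Qed.

Lemma whpP (P : nat -> R) : (\forall n \near \oo, P n <= 1) ->
  (forall d, 0 < d -> \forall n \near \oo, 1 - d <= P n) -> whp P.
Proof.
move=> P1 Pd; apply/cvgrPdist_le => d d0; near=> n.
have h1 : P n <= 1 by near: n.
have h2 : 1 - d <= P n by near: n; exact: Pd.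
by rewrite ger0_norm; lra.
Unshelve. all: by end_near.
Qed.

Hypothesis eps_gt0 : forall n, 0 < eps n.
Hypothesis eps_cvg0 : (eps @ \oo --> (0 : R))%classic.
Hypothesis eps3_cvgy : ((fun n => eps n ^+ 3 * n%:R ^+ j) @ \oo --> +oo)%classic.
Hypothesis eps2_ge : forall A : R, \forall n \near \oo, A <= eps n ^+ 2 * n%:R.

Lemma eps_near (a : R) : 0 < a -> \forall n \near \oo, eps n <= a.
Proof. by move=> a0; exact: (@cvgr_le R nat \oo _ eps 0 eps_cvg0 a a0). Qed.

Lemma neps_near (A : R) : \forall n \near \oo, A <= n%:R * eps n.
Proof.
near=> n; have h : A <= eps n ^+ 2 * n%:R by near: n; exact: eps2_ge.
apply: le_trans h _; rewrite mulrC ler_wpM2l// expr2 ler_piMl ?(ltW (eps_gt0 n))//.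
by near: n; exact: eps_near.
Unshelve. all: by end_near.
Qed.

Lemma leqn_near N : \forall n \near \oo, (N <= n)%N.
Proof. exact: nbhs_infty_ge. Qed.

Lemma eps3_near (A : R) : \forall n \near \oo, A <= eps n ^+ 3 * 'C(n, j)%:R.
Proof.
near=> n; have kn : (2 * k <= n)%N by near: n; exact: leqn_near.
have h : bin_const R j * A <= eps n ^+ 3 * n%:R ^+ j.
  by near: n; move: (_ * A); apply/cvgryPge.
have b0 := bin_const_gt0 R j.
rewrite -(ler_pM2l b0); apply: le_trans h _.
rewrite mulrCA ler_wpM2l ?exprn_ge0 ?(ltW (eps_gt0 n))//.
exact: expn_le_bin j_gt0 jk kn.
Unshelve. all: by end_near.
Qed.

(** Everything is expressed by [x = n * eps n]: from [eps n ^+ 2 * n >= 1] follow [n <= x ^+ 2] and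
    [x ^- 2 <= eps n ^+ 2], and the exponential beats every power of [x]. *)
Lemma exp_decay_near (c K : R) : 0 < c -> 0 < K ->
  \forall n \near \oo, n%:R ^+ j * expR (1 - c * (n%:R * eps n)) <= K * eps n ^+ 2.
Proof.
(* The power [i.+1 = 2 * j + 3] accounts for [n ^+ j <= x ^+ (2 * j)], for the factor [x ^- 2] on
   the right, and for one more [x] to beat the constant [C]. *)
move=> c0 K0; pose i := (2 * j + 2)%N; pose C : R := expR 1 * i.+1`!%:R / c ^+ i.+1 / K.
near=> n; have e0 := eps_gt0 n.
have x1 : 1 <= n%:R * eps n by near: n; exact: neps_near.
have xC : C <= n%:R * eps n by near: n; exact: neps_near.
have e1 : 1 <= eps n ^+ 2 * n%:R by near: n; exact: eps2_ge.
have n1 : (1 <= n)%N by near: n; exact: leqn_near.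
have nR : 0 < n%:R :> R by rewrite ltr0n.
move: x1 xC; set x := n%:R * eps n => x1 xC.
have x0 : 0 < x by apply: mulr_gt0.
have nx : n%:R <= x ^+ 2.
  have -> : x ^+ 2 = n%:R * (eps n ^+ 2 * n%:R) by rewrite /x; ring.
  by rewrite ler_peMr// ltW.
have ex : (x ^+ 2)^-1 <= eps n ^+ 2.
  rewrite -[leLHS]mul1r ler_pdivrMr ?exprn_gt0//.
  have -> : eps n ^+ 2 * x ^+ 2 = (eps n ^+ 2 * n%:R) * (eps n ^+ 2 * n%:R) by rewrite /x; ring.
  by rewrite -[leLHS]mulr1; apply: ler_pM.
apply: (@le_trans _ _ (K * (x ^+ 2)^-1)); last by rewrite ler_wpM2l// ltW.
have cx : 0 < c * x by apply: mulr_gt0.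
have hE : expR (1 - c * x) <= expR 1 * (i.+1`!%:R / (c * x) ^+ i.+1).
  rewrite expRD expRN ler_wpM2l ?expR_ge0// -invf_div lef_pV2 ?posrE ?expR_gt0//.
    by apply: le_trans (expR_ge1Dxn i (ltW cx)); rewrite lerDr.
  by rewrite divr_gt0 ?exprn_gt0// ltr0n fact_gt0.
apply: (@le_trans _ _ ((x ^+ 2) ^+ j * (expR 1 * (i.+1`!%:R / (c * x) ^+ i.+1)))).
  apply: ler_pM => //; rewrite ?expR_ge0 ?exprn_ge0//.
  by apply: lerXn2r; rewrite // ?nnegrE ?ler0n// exprn_ge0// ltW.
have -> : (x ^+ 2) ^+ j * (expR 1 * (i.+1`!%:R / (c * x) ^+ i.+1)) = K * (x ^+ 2)^-1 * (C / x).
  rewrite /C [(c * x) ^+ _]exprMn /i.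
  have -> : x ^+ (2 * j + 2).+1 = (x ^+ 2) ^+ j * x ^+ 3 by rewrite -exprM -exprD; congr (_ ^+ _); lia.
  by field; rewrite !gt_eqF ?exprn_gt0.
rewrite -[leRHS]mulr1 ler_wpM2l//; first by apply/ltW/mulr_gt0 => //; rewrite invr_gt0 exprn_gt0.
by rewrite ler_pdivrMr// mul1r.
Unshelve. all: by end_near.
Qed.

Lemma super_regime_near (g : R) : 0 < g -> g <= 25^-1 ->
  \forall n \near \oo, super_regime n k j (eps n) g.
Proof.
move=> g0 g1.
have m0 : 0 < ('C(k, j).-1)%:R :> R by rewrite ltr0n bin_pred_gt0.
have sp0 : 0 < spread R k j by apply: lt_le_trans (spread_ge1 _ _ _).
have tau0 : 0 < deg_tau R k j by rewrite invr_gt0; apply: mulr_gt0.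
have big0 : 0 < deg_big R k j by apply: mulr_gt0; [exact: mulr_gt0|rewrite ltr0n cgeo_gt0].
have sc0 : 0 < deg_scale R k j by apply: divr_gt0 => //; apply: mulr_gt0 => //; apply: mulr_gt0.
have mc0 : 0 < mix_coef R k j by apply: mix_coef_gt0.
have ld0 : 0 < load_const R k j.
  by rewrite /load_const ltr_wpDl// mulr_ge0 ?exprn_ge0 ?mulr_ge0 ?(ltW big0) ?(ltW sp0).
have mr0 : 0 < mix_ratio R k j by rewrite mulr_gt0// bin_const_gt0.
have ms0 : 0 < mix_scale k j (mix_ratio R k j) by apply: mix_scale_gt0 => //; exact: ltW.
pose lam := g / (4 * load_const R k j); have lam0 : 0 < lam by rewrite divr_gt0// mulr_gt0.
have X0 : 0 < mix_ratio R k j * (j.+1%:R * 2 ^+ j) by apply: mulr_gt0 => //; apply: mulr_gt0 => //; rewrite exprn_gt0.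
have K0 : 0 < g * 4 / ('C(k, j).-1)%:R ^+ 2 by apply: divr_gt0; [exact: mulr_gt0|rewrite exprn_gt0].
have thE n : g * (2 * eps n / ('C(k, j).-1)%:R) ^+ 2 = g * 4 / ('C(k, j).-1)%:R ^+ 2 * eps n ^+ 2.
  by field; rewrite gt_eqF.
pose c2 := mix_scale k j (mix_ratio R k j) * mix_coef R k j / 8 * lam.
have c10 : 0 < deg_scale R k j * lam by rewrite mulr_gt0.
have c20 : 0 < c2 by apply: mulr_gt0 => //; apply: divr_gt0 => //; apply: mulr_gt0.
near=> n.
have xlam A : lam^-1 * A <= n%:R * eps n -> A <= lam * (n%:R * eps n) by rewrite ler_pdivrMl.
have xg A : g^-1 * A <= n%:R * eps n -> A <= g * (n%:R * eps n) by rewrite ler_pdivrMl.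
apply: SuperRegime => //.
- by rewrite ler_pdivlMr//; near: n; exact: nbhs_infty_ger.
- by rewrite mulrC -ler_pdivlMr//; near: n; apply: eps_near; rewrite divr_gt0.
- by near: n; exact: eps_near.
- by rewrite -ler_pdivlMr//; near: n; apply: eps_near; rewrite !divr_gt0.
- by apply: xg; near: n; exact: neps_near.
- by apply: xg; near: n; exact: neps_near.
- by apply: xg; near: n; exact: neps_near.
- by apply: xlam; near: n; exact: neps_near.
- by rewrite -/lam -ler_pdivrMl//; near: n; exact: eps3_near.
- by near: n; exact: eps3_near.
- by near: n; exact: eps3_near.
- by rewrite thE; near: n; exact: exp_decay_near.
- rewrite thE; apply: (@le_trans _ _ (n%:R ^+ j * expR (1 - c2 * (n%:R * eps n)))); last first.
    by near: n; exact: exp_decay_near.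
  rewrite ler_peMl ?expR_ge0// exprn_ege1// ler1n.
  by near: n; exact: leqn_near.
Unshelve. all: by end_near.
Qed.

End Asymptotics.

Theorem theorem1p2 (R : realType) (k j : nat) (eps : nat -> R) (delta : R) :
  (1 <= j)%N -> (j <= k - 1)%N ->
  (forall n, 0 < eps n) ->
  eps @ \oo --> (0 : R) ->
  (fun n => eps n ^+ 3 * (n%:R) ^+ j) @ \oo --> +oo ->
  0 < delta ->
  (fun n => eps n ^+ 2 * (n%:R) `^ (1 - 2 * delta)) @ \oo --> +oo ->
  (* (a) subcritical *)
  (exists C : R, 0 < C /\
     whp (fun n => hprob n k ((1 - eps n) * p0 k j n)
       (fun H => [forall J : {set 'I_n}, (#|J| == j) ==>
          (#|jcomp j H J|%:R <= C * (eps n)^-2 * ln (n%:R : R))]))) /\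
  (* (b) supercritical *)
  (forall gamma : R, 0 < gamma ->
     whp (fun n => hprob n k ((1 + eps n) * p0 k j n)
       (fun H => [exists J0 : {set 'I_n},
          [&& #|J0| == j,
              [forall J : {set 'I_n}, (#|J| == j) ==>
                 (#|jcomp j H J| <= #|jcomp j H J0|)%N],
              `| #|jcomp j H J0|%:R
                  - 2 * eps n / ('C(k, j)%:R - 1) * 'C(n, j)%:R |
                <= gamma * (2 * eps n / ('C(k, j)%:R - 1) * 'C(n, j)%:R) &
              [forall J : {set 'I_n}, ((#|J| == j) && (jcomp j H J != jcomp j H J0)) ==>
                 (#|jcomp j H J|%:R <= gamma * eps n * (n%:R) ^+ j)]]]))).
Proof.
move=> j0 jk1 eps0 epsc eps3 d0 epsd; have jk : (j < k)%N by lia.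
have eps2 (A : R) : \forall n \near \oo, A <= eps n ^+ 2 * n%:R.
  near=> n; have n1 : (1 <= n)%N by near: n; exact: leqn_near.
  have h : A <= eps n ^+ 2 * n%:R `^ (1 - 2 * delta).
    by near: n; move: A; apply/cvgryPge.
  apply: le_trans h _; rewrite ler_wpM2l ?exprn_ge0 ?(ltW (eps0 n))//.
  by rewrite -[leRHS]powRr1// ler_powR ?ler1n//; lra.
have m0 : 0 < ('C(k, j).-1)%:R :> R by rewrite ltr0n bin_pred_gt0.
split.
  exists (32 * ('C(k, j).-1)%:R * j.+1%:R); split; first by rewrite !mulr_gt0.
  apply: whpP => [|d dp]; near=> n.
    apply: hprob_le1; apply: sub_p01 => //; first by near: n; exact: leqn_near.
    by near: n; exact: eps_near.
  have kn : (2 * k <= n)%N by near: n; exact: leqn_near.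
  have e1 : eps n <= 1 by near: n; exact: eps_near.
  apply: le_trans (sub_components j0 jk kn (eps0 n) e1).
  rewrite lerD2l lerN2 ler_pdivrMr; last by rewrite ltr0n; lia.
  by rewrite -ler_pdivrMl//; near: n; exact: nbhs_infty_ger.
move=> gamma gp.
apply: whpP => [|d dp].
  near=> n; have kn : (2 * k <= n)%N by near: n; exact: leqn_near.
  (* Any admissible [g] serves to see that the edge probability is at most 1. *)
  apply: hprob_le1; apply: (@super_p01 R n k j j0 jk kn (eps n) 25^-1).
  by near: n; apply: super_regime_near.
(* The accuracy [t] is dictated by [gamma]; then [g] makes the failure probability [49 * g / t ^+ 2]
   at most [d]. *)
pose t := Num.min (gamma / 10) 10^-1; pose g := Num.min 25^-1 (d * t ^+ 2 / 49).
have t0 : 0 < t by rewrite lt_min divr_gt0//= invr_gt0.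
have g0 : 0 < g by rewrite lt_min invr_gt0 ltr0n /= divr_gt0// mulr_gt0// exprn_gt0.
have g1 : g <= 25^-1 by rewrite ge_min lexx.
have tg : 10 * t <= gamma by rewrite mulrC -ler_pdivlMr// ge_min lexx.
have t1 : 0 < t <= 10^-1 by rewrite t0 ge_min lexx orbT.
near=> n.
have kn : (2 * k <= n)%N by near: n; exact: leqn_near.
have rg : super_regime n k j (eps n) g by near: n; exact: super_regime_near.
have y1 : 4 * ('C(k, j).-1)%:R / g ^+ 2 <= gamma * (eps n ^+ 3 * 'C(n, j)%:R).
  by rewrite -ler_pdivrMl//; near: n; apply: eps3_near.
apply: le_trans (super_giant_component j0 jk kn rg t1 tg y1).
rewrite lerD2l lerN2 ler_pdivrMr ?exprn_gt0//.
have : g <= d * t ^+ 2 / 49 by rewrite ge_min lexx orbT.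
by rewrite ler_pdivlMr//; lra.
Unshelve. all: by end_near.
Qed.
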